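(* (i) There are uncountably many real numbers that are deterministic in base $2$ and normal in every odd base. (ii) For every even base $b$, there are uncountably many real numbers that are deterministic in base $2$ and that are simultaneously non-normal in all even bases $\le b$ (i.e. not normal in any even base $b'\le b$). (iii) In both cases (i) and (ii), an explicit construction of a countable family of such numbers is given.
   Context: A base is an integer $\ge 2$. The base-$b$ expansion of a real $x$ is the digit sequence $b_1(x),b_2(x),\dots\in\{0,\dots,b-1\}$ with $x=\lfloor x\rfloor+\sum_{j\ge1}b_j(x)b^{-j}$ that does not end with a tail of digits $b-1$. A real number $x$ is simply normal in base $b$ if each digit $0,\dots,b-1$ occurs with asymptotic frequency $1/b$ in its base-$b$ expansion, and normal in base $b$ if it is simply normal in base $b^k$ for every $k\ge1$. A real number is deterministic in base $b$ if, letting $w\in\{0,\dots,b-1\}^{\mathbb{N}}$ be its base-$b$ expansion and $T$ the shift map on $\{0,\dots,b-1\}^{\mathbb{N}}$ (product topology), every weak-$*$ limit point of the empirical measures $\frac1n\sum_{j=0}^{n-1}\delta_{T^jw}$ (as $n\to\infty$) has zero Kolmogorov--Sinai entropy with respect to $T$. Meaning of ''explicit construction'' in (iii). A set $\mathcal S$ of positive integers is sparse if it has density zero and there is a sparsity exponent $\rho>0$ with $\liminf_{k\to\infty}\min_{0\le a\le k^{\rho}}\frac{\#(\mathcal S\cap[a,a+k])}{30\log k}>1$ ($\log$ is the natural logarithm, $a$ ranges over integers). Let $\mathcal C(\mathcal S)$ be the set of $x\in[0,1)$ of the form $x=\sum_{k\in\mathcal S}b_k2^{-k}$ with $b_k\in\{0,1\}$.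 A set of positive integers is computable if its characteristic function is computable; a real number is computable if some computable function gives, for each $n$, the $n$-th digit of its expansion in some prescribed base. Let $\mathcal S$ be a computable sparse set with a computable sparsity exponent. The construction for (i) is an algorithm that, given a rational $\varepsilon$ with $0<\varepsilon<2/3$, produces the base-$2$ expansion of a number $x(\varepsilon)\in\mathcal C(\mathcal S)$ that is normal in all odd bases. The construction for (ii) takes the computable numbers $x=\sum_{i\ge1}2^{-n_i}$, where $(n_i)$ is a computable strictly increasing sequence of elements of $\mathcal S$ growing fast enough that $n_{i-1}/n_i\to0$; distinct sequences give distinct numbers. *)

(* Defs.v *)
From HB Require Import structures.
From mathcomp Require Import all_boot all_order all_algebra.
From mathcomp Require Import all_classical all_reals all_analysis.
Import Order.TTheory GRing.Theory Num.Theory numFieldNormedType.Exports.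

Set Implicit Arguments.
Unset Strict Implicit.
Unset Printing Implicit Defensive.

Local Open Scope classical_set_scope.
Local Open Scope ring_scope.

HB.instance Definition _ (n : nat) := isPointed.Build 'I_n.+1 ord0.

(* For a base b >= 2 this is 'I_b, the set {0, ..., b - 1}; the detour through
   the predecessor makes it nonempty for every b, as the measurable structure
   on the shift space requires. *)
Notation digit b := 'I_(b.-1.+1).

Definition digit_seq (b : nat) : Type := nat -> digit b.

(* Digit sequences are indexed from 0: w j is the digit of weight b ^- (j + 1). *)
Definition is_expansion (R : realType) (b : nat) (x : R) (w : digit_seq b) : Prop :=
  (series (fun j => (w j : nat)%:R / b%:R ^+ j.+1 : R) @ \oo
     --> x - (Num.floor x)%:~R) /\
  ~ (exists N, forall j, (N <= j)%N -> w j = b.-1 :> nat).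

Definition simply_normal (R : realType) (b : nat) (x : R) : Prop :=
  exists2 w : digit_seq b, is_expansion x w &
    forall d : digit b,
      (fun n => (\sum_(j < n) (w j == d))%N%:R / n%:R : R) @ \oo --> (b%:R^-1 : R).

Definition normal (R : realType) (b : nat) (x : R) : Prop :=
  forall k : nat, (0 < k)%N -> simply_normal (b ^ k) x.

Definition shift_space (b : nat) : topologicalType :=
  prod_topology (fun _ : nat => discrete_topology (digit b)).

Definition shift_borel (b : nat) :=
  g_sigma_algebraType (@open (shift_space b)).

Definition shift (b : nat) (w : shift_borel b) : shift_borel b :=
  fun j => w j.+1.

Section Entropy.
Context (d : measure_display) (X : measurableType d) (R : realType).
Variables (T : X -> X) (mu : {measure set X -> \bar R}).

Definition finite_partition (m : nat) (P : 'I_m -> set X) : Prop :=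
  [/\ forall i, measurable (P i), trivIset setT P & \bigcup_i P i = setT].

Definition join_cell (m : nat) (P : 'I_m -> set X) (n : nat)
    (u : {ffun 'I_n -> 'I_m}) : set X :=
  \bigcap_(i in [set: 'I_n]) (iter i T @^-1` P (u i)).

(* Here 0 * ln 0 = 0, since ln 0 = 0. *)
Definition join_entropy (m : nat) (P : 'I_m -> set X) (n : nat) : R :=
  - \sum_(u : {ffun 'I_n -> 'I_m})
      fine (mu (join_cell P u)) * ln (fine (mu (join_cell P u))).

(* For a T-invariant probability the upper limit is a limit. *)
Definition partition_entropy (m : nat) (P : 'I_m -> set X) : \bar R :=
  limn_esup (fun n => (join_entropy P n / n%:R)%:E).

Definition ks_entropy : \bar R :=
  ereal_sup [set h | exists m : nat, exists2 P : 'I_m -> set X,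
    finite_partition P & h = partition_entropy P].

End Entropy.

Definition empirical_measure (R : realType) (b : nat) (w : shift_borel b)
    (n : nat) : {measure set (shift_borel b) -> \bar R} :=
  mscale (n%:R^-1)%:nng
    (msum (fun j => dirac (iter j (@shift b) w)) n).

Definition weak_star_cvg (R : realType) (b : nat)
    (nu : nat -> {measure set (shift_borel b) -> \bar R})
    (mu : {measure set (shift_borel b) -> \bar R}) : Prop :=
  forall f : shift_space b -> R, continuous f ->
    (fun n => (\int[nu n]_x (f x)%:E)%E) @ \oo --> (\int[mu]_x (f x)%:E)%E.

(* The weak-* topology on the Borel probabilities of the compact metrizable
   shift space is metrizable, so limit points are limits of subsequences. *)
Definition weak_star_limit_point (R : realType) (b : nat)
    (nu : nat -> {measure set (shift_borel b) -> \bar R})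
    (mu : probability (shift_borel b) R) : Prop :=
  exists2 phi : nat -> nat, {homo phi : i j / (i < j)%N} &
    weak_star_cvg (fun i => nu (phi i)) mu.

Definition deterministic (R : realType) (b : nat) (x : R) : Prop :=
  exists2 w : digit_seq b, is_expansion x w &
    forall mu : probability (shift_borel b) R,
      weak_star_limit_point (fun n => empirical_measure R w n) mu ->
      ks_entropy (@shift b) mu = 0%E.

(* Total computable functions on tuples of naturals: the least class containing
   the basic functions and closed under composition, primitive recursion and
   minimization of functions that always have a zero. *)
Inductive computable : forall n : nat, (n.-tuple nat -> nat) -> Prop :=
| computable_zero n : computable (fun _ : n.-tuple nat => 0%N)
| computable_succ : computable (fun v : 1.-tuple nat => (thead v).+1)
| computable_proj n (i : 'I_n) : computable (fun v : n.-tuple nat => tnth v i)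
| computable_comp m n (g : m.-tuple nat -> nat) (h : 'I_m -> n.-tuple nat -> nat) :
    computable g -> (forall i, computable (h i)) ->
    computable (fun v => g [tuple h i v | i < m])
| computable_primrec n (g : n.-tuple nat -> nat) (h : n.+2.-tuple nat -> nat)
    (f : n.+1.-tuple nat -> nat) :
    computable g -> computable h ->
    (forall v : n.-tuple nat, f [tuple of 0%N :: v] = g v) ->
    (forall k (v : n.-tuple nat),
       f [tuple of k.+1 :: v] = h [tuple of k :: f [tuple of k :: v] :: v]) ->
    computable f
| computable_min n (g : n.+1.-tuple nat -> nat) (f : n.-tuple nat -> nat) :
    computable g ->
    (forall v : n.-tuple nat, g [tuple of f v :: v] = 0%N /\
       forall k, (k < f v)%N -> g [tuple of k :: v] <> 0%N) ->
    computable f.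

Definition computable_seq (u : nat -> nat) : Prop :=
  computable (fun v : 1.-tuple nat => u (thead v)).

Definition computable_set (S : set nat) : Prop :=
  computable_seq (fun k => nat_of_bool (k \in S)).

Definition computable_real (R : realType) (x : R) : Prop :=
  exists b : nat, (1 < b)%N /\
    exists2 w : digit_seq b, is_expansion x w & computable_seq (fun j => w j).

Definition count_in (S : set nat) (m n : nat) : nat :=
  (\sum_(m <= i < n.+1) (i \in S))%N.

Definition density_zero (R : realType) (S : set nat) : Prop :=
  (fun n => (count_in S 1 n)%:R / n%:R : R) @ \oo --> (0 : R).

(* The infimum over the finite, nonempty set of starting points is a minimum;
   the values at k = 0, 1, where ln k is not positive, do not affect the lower
   limit, which may be +oo. *)
Definition sparsity_exponent (R : realType) (S : set nat) (rho : R) : Prop :=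
  0 < rho /\
  let window_ratio (k a : nat) : R :=
    (count_in S a (a + k))%:R / (30%:R * ln k%:R) in
  let window_starts (k : nat) : set nat :=
    [set a : nat | (a%:R : R) <= k%:R `^ rho] in
  (1 < limn_einf (fun k =>
     ereal_inf [set (window_ratio k a)%:E | a in window_starts k]))%E.

Definition sparse (R : realType) (S : set nat) : Prop :=
  [/\ S `<=` [set k | (0 < k)%N], density_zero R S &
      exists rho : R, sparsity_exponent S rho].

Definition computably_sparse (R : realType) (S : set nat) : Prop :=
  [/\ computable_set S, sparse R S &
      exists2 rho : R, computable_real rho & sparsity_exponent S rho].

Definition digits_supported_in (R : realType) (S : set nat) : set R :=
  [set x : R | 0 <= x < 1 /\ exists c : nat -> bool,
     series (fun k => if k \in S then (c k)%:R / 2 ^+ k else 0 : R) @ \oo --> x].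

Definition normal_in_odd_bases (R : realType) (x : R) : Prop :=
  forall b : nat, (1 < b)%N -> odd b -> normal b x.

Definition nonnormal_in_even_bases_upto (R : realType) (b : nat) (x : R) : Prop :=
  forall b' : nat, (1 < b')%N -> ~~ odd b' -> (b' <= b)%N -> ~ normal b' x.

(* A single computable function yields the binary digits of all the x eps,
   uniformly in the reduced fraction eps. *)
Definition computes_binary_digits (R : realType) (x : rat -> R) : Prop :=
  exists2 F : 3.-tuple nat -> nat, computable F &
    forall eps : rat, 0 < eps < 2%:Q / 3%:Q ->
      exists2 w : digit_seq 2, is_expansion (x eps) w &
        forall j, F [tuple `|numq eps|%N; `|denq eps|%N; j] = w j.

Definition lacunary_seqs (R : realType) (S : set nat) : set (nat -> nat) :=
  [set n | [/\ computable_seq n, {homo n : i j / (i < j)%N},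
     forall i, S (n i) &
     (fun i => (n i)%:R / (n i.+1)%:R : R) @ \oo --> (0 : R)]].

(* The series converges for every strictly increasing n. *)
Definition dyadic_sum (R : realType) (n : nat -> nat) : R :=
  limn (series (fun i => (2 ^+ n i)^-1 : R)).

(* Main.v *)
Require Import Defs.
From HB Require Import structures.
From mathcomp Require Import all_boot all_order all_algebra.
From mathcomp Require Import all_classical all_reals all_analysis.
From mathcomp Require Import zify ring lra.
Import Order.TTheory GRing.Theory Num.Theory numFieldNormedType.Exports.

(** Why the statement holds.

    Determinism in base 2 is cheap: if the nonzero binary digits have density
    zero, then the only limit of the empirical measures is the point mass at the
    zero sequence, which has entropy zero ([deterministic_of_sparse]). So all the
    numbers constructed here have their nonzero binary digits in a set of density
    zero.

    Normality in odd bases comes from choosing the digits in a sparse set [S] at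
    random. Let [b] be odd. For a random [x] the second moment of the exponential
    sum over [h * b ^ i * x], i < N, is a sum over pairs (i, j) of products of the
    numbers |cos (pi * h * (b ^ i - b ^ j) / 2 ^ p)|, where [p] runs over the
    random places ([sum_leaves_cos]). The powers of an odd number are
    equidistributed modulo powers of 2, up to a bounded loss, by lifting the
    exponent ([sqr_powers_inj]), and averaging over binary digits from the top
    down gains a constant factor for each random place ([sum_prod_abscos]). A
    window of length about [log2 N] contains at least [30 * ln (log2 N)] random
    places, so the second moment is at most [N ^ 2] times a high negative power of
    [log2 N] ([sum_corr_pairs]). With a Fejer majorant ([digit_count_weyl]) and
    Chebyshev's inequality it follows that the [k]-th bad event, an excess of some
    digit in some small odd base at a length between [2 ^ k] and [2 ^ k.+1], has
    probability at most [1 / (k * k.+1)]. This bound is uniform in two respects: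
    the first digits, as long as there are at most [log2 k] of them, may be fixed
    in advance, and so may any digits outside [S] ([bad_probability]).

    The random choice is then replaced by the method of conditional expectations.
    At time [t] the expected number of bad events with index below [2 ^ t], given
    the digits chosen so far, is kept below [1 - 2 ^- t]; the events that enter
    later have total probability at most [2 ^- t] because the sum telescopes
    ([mean_potential_children]). An event is decided by finitely many digits and
    is expressed in integer arithmetic, so this greedy choice is computable
    ([computable_good_prefix]), and a number that avoids all the bad events from
    some index on is normal in every odd base ([normal_of_avoid]). Starting the
    choice later and later gives infinitely many numbers for the family in (iii);
    prescribing digits outside [S] freely gives uncountably many for (i).

    For (ii), if [n i / n i.+1] tends to 0, then the sum of the [2 ^- n i] has
    long runs of zeros in every even base, since a high power of an even number
    absorbs the first terms; the frequency of the digit 0 comes close to 1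
    infinitely often ([nonnormal_dyadic_sum]). There are uncountably many such
    sequences inside the set of squares, which is sparse, and inside any
    computable sparse set there are infinitely many computable ones, but only
    countably many because the programs are countable
    ([countable_computable]). *)

Set Implicit Arguments.
Unset Strict Implicit.
Unset Printing Implicit Defensive.

Local Open Scope classical_set_scope.
Local Open Scope ring_scope.

(** * Computable functions *)

Lemma eq_computable n (f g : n.-tuple nat -> nat) :
  f =1 g -> computable f -> computable g.
Proof. by move=> /funext ->. Qed.

Lemma tuple_of_head_behead n (w : n.+1.-tuple nat) :
  w = [tuple of thead w :: behead_tuple w].
Proof. by rewrite [LHS]tuple_eta. Qed.

Lemma thead_cons n (k : nat) (v : n.-tuple nat) : thead [tuple of k :: v] = k.
Proof. by []. Qed.

Lemma behead_cons n (k : nat) (v : n.-tuple nat) :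
  behead_tuple [tuple of k :: v] = v.
Proof. by apply: val_inj. Qed.

Lemma computable_thead n : computable (fun w : n.+1.-tuple nat => thead w).
Proof. exact: computable_proj. Qed.

Lemma computable_weaken n (f : n.-tuple nat -> nat) :
  computable f -> computable (fun w : n.+1.-tuple nat => f (behead_tuple w)).
Proof.
move=> cf.
apply: eq_computable (computable_comp cf
  (fun i => computable_proj (lift ord0 i))) => w /=.
congr f; apply: eq_from_tnth => i; rewrite tnth_mktuple.
by rewrite (tuple_of_head_behead w) behead_cons tnthS.
Qed.

Lemma computable_unary n (g : nat -> nat) (a : n.-tuple nat -> nat) :
  computable_seq g -> computable a -> computable (fun v => g (a v)).
Proof.
move=> cg ca; apply: eq_computable (computable_comp cg (fun _ => ca)) => v.
by congr g; rewrite /thead tnth_mktuple.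
Qed.

Lemma computableS n (a : n.-tuple nat -> nat) :
  computable a -> computable (fun v => (a v).+1).
Proof. exact: (computable_unary computable_succ). Qed.

Lemma computable_const n k : computable (fun _ : n.-tuple nat => k).
Proof. by elim: k => [|k ck]; [exact: computable_zero | exact: computableS]. Qed.

(** Together with [computable_weaken] this is all the variable handling that is
    needed: a body under a binder is a function of one more variable, the first. *)
Lemma computable_subst n (f : n.+1.-tuple nat -> nat) (a : n.-tuple nat -> nat) :
  computable f -> computable a ->
  computable (fun v => f [tuple of a v :: v]).
Proof.
move=> cf ca.
pose h (i : 'I_n.+1) (v : n.-tuple nat) := tnth [tuple of a v :: v] i.
have ch i : computable (h i).
  rewrite /h; case: (unliftP ord0 i) => [j|] ->.
    by apply: eq_computable (computable_proj j) => v; rewrite tnthS.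
  by apply: eq_computable ca => v; rewrite tnth0.
apply: eq_computable (computable_comp cf ch) => v.
by congr f; apply: eq_from_tnth => i; rewrite tnth_mktuple.
Qed.

(** Primitive recursion with the recursion variable and the parameters separated,
    which is the form of functions defined by structural recursion on [nat]. *)
Lemma computable_rec n (g : n.-tuple nat -> nat)
    (h : n.-tuple nat -> nat -> nat -> nat) (f : n.-tuple nat -> nat -> nat)
    (a : n.-tuple nat -> nat) :
  computable g ->
  computable (fun w : n.+2.-tuple nat =>
    h (behead_tuple (behead_tuple w)) (thead w) (thead (behead_tuple w))) ->
  (forall v, f v 0%N = g v) -> (forall v k, f v k.+1 = h v k (f v k)) ->
  computable a -> computable (fun v => f v (a v)).
Proof.
move=> cg ch f0 fS ca.
have cf : computable (fun w : n.+1.-tuple nat => f (behead_tuple w) (thead w)).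
  apply: (computable_primrec cg ch) => [v|k v].
    by rewrite behead_cons f0.
  by rewrite !behead_cons !thead_cons fS.
apply: eq_computable (computable_subst cf ca) => v.
by rewrite behead_cons.
Qed.

Lemma computable_pred n (a : n.-tuple nat -> nat) :
  computable a -> computable (fun v => (a v).-1).
Proof.
apply: (computable_rec (g := fun=> 0%N) (h := fun _ k _ => k)
          (f := fun _ k => k.-1)) => //.
  exact: computable_const.
exact: computable_thead.
Qed.

Lemma computableD n (a b : n.-tuple nat -> nat) :
  computable a -> computable b -> computable (fun v => (a v + b v)%N).
Proof.
move=> ca.
apply: (computable_rec (g := a) (h := fun _ _ r => r.+1)
          (f := fun v k => (a v + k)%N)) => //.
- by apply: computableS; apply: computable_weaken; apply: computable_thead.
- by move=> v; rewrite addn0.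
- by move=> v k; rewrite addnS.
Qed.

Lemma computableB n (a b : n.-tuple nat -> nat) :
  computable a -> computable b -> computable (fun v => (a v - b v)%N).
Proof.
move=> ca.
apply: (computable_rec (g := a) (h := fun _ _ r => r.-1)
          (f := fun v k => (a v - k)%N)) => //.
- by apply: computable_pred; apply: computable_weaken; apply: computable_thead.
- by move=> v; rewrite subn0.
- by move=> v k; rewrite subnS.
Qed.

Lemma computableM n (a b : n.-tuple nat -> nat) :
  computable a -> computable b -> computable (fun v => (a v * b v)%N).
Proof.
move=> ca.
apply: (computable_rec (g := fun=> 0%N) (h := fun v _ r => (r + a v)%N)
          (f := fun v k => (a v * k)%N)) => //.
- exact: computable_const.
- apply: computableD; first by apply: computable_weaken; apply: computable_thead.
  exact: (computable_weaken (computable_weaken ca)).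
- by move=> v; rewrite muln0.
- by move=> v k; rewrite mulnSr.
Qed.

Lemma computableX n (a b : n.-tuple nat -> nat) :
  computable a -> computable b -> computable (fun v => (a v ^ b v)%N).
Proof.
move=> ca.
apply: (computable_rec (g := fun=> 1%N) (h := fun v _ r => (r * a v)%N)
          (f := fun v k => (a v ^ k)%N)) => //.
- exact: computable_const.
- apply: computableM; first by apply: computable_weaken; apply: computable_thead.
  exact: (computable_weaken (computable_weaken ca)).
- by move=> v k; rewrite expnSr.
Qed.

Lemma computable_sum n (B : n.-tuple nat -> nat) (f : n.-tuple nat -> nat -> nat) :
  computable B ->
  computable (fun w : n.+1.-tuple nat => f (behead_tuple w) (thead w)) ->
  computable (fun v => \sum_(i < B v) f v i)%N.
Proof.
move=> cB cf.
apply: (computable_rec (g := fun=> 0%N) (h := fun v k r => (r + f v k)%N)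
          (f := fun v k => (\sum_(i < k) f v i)%N)) cB.
- exact: computable_const.
- apply: computableD; first by apply: computable_weaken; apply: computable_thead.
  (* the recursion value, second in the tuple, is skipped *)
  pose h (i : 'I_n.+1) (w : n.+2.-tuple nat) :=
    tnth [tuple of thead w :: behead_tuple (behead_tuple w)] i.
  have ch i : computable (h i).
    rewrite /h; case: (unliftP ord0 i) => [j|] ->.
      apply: eq_computable
        (computable_weaken (computable_weaken (computable_proj j))) => w.
      by rewrite tnthS.
    by apply: eq_computable (@computable_thead _) => w; rewrite tnth0.
  apply: eq_computable (computable_comp cf ch) => w /=.
  have -> : [tuple h i w | i < n.+1] =
      [tuple of thead w :: behead_tuple (behead_tuple w)].
    by apply: eq_from_tnth => i; rewrite tnth_mktuple.
  by rewrite behead_cons.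
- by move=> v; rewrite big_ord0.
- by move=> v k; rewrite big_ord_recr.
Qed.

Lemma computable_eq0 n (a : n.-tuple nat -> nat) :
  computable a -> computable (fun v => nat_of_bool (a v == 0%N)).
Proof.
move=> ca; apply: eq_computable (computableB (computable_const _ 1) ca) => v.
by case: (a v) => [|[]].
Qed.

Lemma computable_leq n (a b : n.-tuple nat -> nat) :
  computable a -> computable b -> computable (fun v => nat_of_bool (a v <= b v)%N).
Proof. by move=> ca cb; apply: computable_eq0; apply: computableB. Qed.

Lemma computable_ltn n (a b : n.-tuple nat -> nat) :
  computable a -> computable b -> computable (fun v => nat_of_bool (a v < b v)%N).
Proof. by move=> ca cb; apply: computable_leq => //; apply: computableS. Qed.

Lemma computable_neg n (p : n.-tuple nat -> bool) :
  computable (fun v => nat_of_bool (p v)) ->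
  computable (fun v => nat_of_bool (~~ p v)).
Proof.
move=> cp; apply: eq_computable (computable_eq0 cp) => v.
by case: (p v).
Qed.

Lemma computable_and n (p r : n.-tuple nat -> bool) :
  computable (fun v => nat_of_bool (p v)) ->
  computable (fun v => nat_of_bool (r v)) ->
  computable (fun v => nat_of_bool (p v && r v)).
Proof.
move=> cp cr; apply: eq_computable (computableM cp cr) => v.
by case: (p v) (r v) => [] [].
Qed.

Lemma computable_eq n (a b : n.-tuple nat -> nat) :
  computable a -> computable b -> computable (fun v => nat_of_bool (a v == b v)).
Proof.
move=> ca cb.
apply: eq_computable (computable_and (computable_leq ca cb)
                                     (computable_leq cb ca)) => v.
by rewrite -eqn_leq.
Qed.

Lemma computable_ex n (B : n.-tuple nat -> nat) (p : n.-tuple nat -> nat -> bool) :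
  computable B ->
  computable (fun w : n.+1.-tuple nat =>
    nat_of_bool (p (behead_tuple w) (thead w))) ->
  computable (fun v => nat_of_bool [exists i : 'I_(B v), p v i]).
Proof.
move=> cB cp.
have cs := computable_sum (f := fun v i => nat_of_bool (p v i)) cB cp.
apply: eq_computable (computable_ltn (computable_const _ 0) cs) => v.
congr nat_of_bool; rewrite lt0n sum_nat_eq0 negb_forall.
by apply: eq_existsb => i; case: (p v i).
Qed.

Lemma computable_if n (p : n.-tuple nat -> bool) (a b : n.-tuple nat -> nat) :
  computable (fun v => nat_of_bool (p v)) -> computable a -> computable b ->
  computable (fun v => if p v then a v else b v).
Proof.
move=> cp ca cb.
apply: eq_computable (computableD (computableM cp ca)
                                  (computableM (computable_neg cp) cb)) => v.
by case: (p v); rewrite ?mul1n ?mul0n ?addn0 ?add0n.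
Qed.

Lemma divn_sum (a b : nat) :
  (0 < b)%N -> (\sum_(i < a) (i.+1 * b <= a))%N = (a %/ b)%N.
Proof.
move=> b0.
have le_div : (a %/ b <= a)%N by exact: leq_div.
rewrite (eq_bigr (fun i : 'I_a => nat_of_bool (i < a %/ b)%N)); last first.
  by move=> i _; rewrite -leq_divRL.
move: (a %/ b)%N le_div => m le_ma; rewrite -(subnKC le_ma) big_split_ord /=.
rewrite [X in (_ + X)%N]big1 ?addn0; last by move=> i _; rewrite ltnNge leq_addr.
by rewrite (eq_bigr (fun=> 1%N)) ?sum1_card ?card_ord // => i _; rewrite ltn_ord.
Qed.

Lemma computable_divn n (a b : n.-tuple nat -> nat) :
  computable a -> computable b -> computable (fun v => (a v %/ b v)%N).
Proof.
move=> ca cb.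
have c1 := computable_sum (f := fun v i => nat_of_bool (i.+1 * b v <= a v)%N) ca
  (computable_leq (computableM (computableS (@computable_thead n))
    (computable_weaken cb)) (computable_weaken ca)).
apply: eq_computable (computableM (computable_ltn (computable_const _ 0) cb) c1) => v.
case: (posnP (b v)) => [-> | b0]; first by rewrite mul0n divn0.
by rewrite mul1n divn_sum.
Qed.

Lemma computable_modn n (a b : n.-tuple nat -> nat) :
  computable a -> computable b -> computable (fun v => (a v %% b v)%N).
Proof.
move=> ca cb.
apply: eq_computable
  (computableB ca (computableM (computable_divn ca cb) cb)) => v.
by rewrite [in X in (X - _)%N](divn_eq (a v) (b v)) addKn.
Qed.

Lemma computable_search n (p : n.-tuple nat -> nat -> bool) (f : n.-tuple nat -> nat) :
  computable (fun w : n.+1.-tuple nat =>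
    nat_of_bool (p (behead_tuple w) (thead w))) ->
  (forall v, p v (f v) /\ forall k, (k < f v)%N -> ~~ p v k) -> computable f.
Proof.
move=> cp fP; apply: (computable_min (computable_neg cp)) => v.
have [pv pmin] := fP v; split.
  by rewrite behead_cons thead_cons pv.
by move=> k /pmin; rewrite behead_cons thead_cons => ->.
Qed.

(** * Countability of the computable sequences *)

Section Codes.
Implicit Types c d : GenTree.tree nat.

Definition least (P : nat -> Prop) : nat :=
  xget 0%N [set k | P k /\ forall j, (j < k)%N -> ~ P j].

(** Trees evaluate to functions from lists to lists; as lists are untyped, the
    arities of the computable functions do not get in the way. *)
Fixpoint eval_code c (l : seq nat) : seq nat :=
  match c with
  | GenTree.Leaf 0 => [:: 0%N]
  | GenTree.Leaf 1 => [:: (head 0%N l).+1]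
  | GenTree.Leaf i.+2 => [:: nth 0%N l i]
  | GenTree.Node 0 [:: c; d] => eval_code c l ++ eval_code d l
  | GenTree.Node 1 [:: c; d] => eval_code c (eval_code d l)
  | GenTree.Node 2 [:: c; d] =>
      [:: (fix rec k := if k is k'.+1
           then head 0%N (eval_code d (k' :: rec k' :: behead l))
           else head 0%N (eval_code c (behead l))) (head 0%N l)]
  | GenTree.Node 3 [:: c] => [:: least (fun k => head 0%N (eval_code c (k :: l)) = 0%N)]
  | _ => [::]
  end.

Lemma least_eq (P : nat -> Prop) k :
  P k -> (forall j, (j < k)%N -> ~ P j) -> least P = k.
Proof.
move=> Pk kmin; rewrite /least; case: xgetP => [j _ [Pj jmin]|none].
  apply/eqP; rewrite eqn_leq (leqNgt j) (leqNgt k).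
  apply/andP; split; apply/negP => lt_jk; first exact: (jmin k lt_jk Pk).
  exact: (kmin j lt_jk Pj).
by case: (none k).
Qed.

Lemma computable_coded n (f : n.-tuple nat -> nat) : computable f ->
  exists c, forall v : n.-tuple nat, eval_code c v = [:: f v].
Proof.
elim=> {n f} [n | | n i | m n g h _ [cg Hg] _ Hh | n g h f _ [cg Hg] _ [ch Hh] f0 fS
             | n g f _ [cg Hg] Hf].
- by exists (GenTree.Leaf 0%N).
- by exists (GenTree.Leaf 1%N) => v; rewrite (tuple_of_head_behead v).
- by exists (GenTree.Leaf i.+2) => v; rewrite /= (tnth_nth 0%N).
- have [d Hd] : exists d, forall v : n.-tuple nat,
      eval_code d v = [seq h i v | i <- enum 'I_m].
    elim: (enum 'I_m) => [|i s [d Hd]]; first by exists (GenTree.Node 9 [::]).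
    have [c Hc] := Hh i; exists (GenTree.Node 0 [:: c; d]) => v.
    by rewrite /= Hc Hd.
  exists (GenTree.Node 1 [:: cg; d]) => v; rewrite /= Hd.
  exact: (Hg [tuple h i v | i < m]).
- exists (GenTree.Node 2 [:: cg; ch]) => v; rewrite (tuple_of_head_behead v) /=.
  congr [:: _]; elim: (thead v) => [|k IH].
    by rewrite f0 -[behead v]/(tval (behead_tuple v)) Hg.
  rewrite IH fS -[behead v]/(tval (behead_tuple v)).
  by rewrite (Hh [tuple of k :: f [tuple of k :: behead_tuple v] :: behead_tuple v]).
- exists (GenTree.Node 3 [:: cg]) => v /=; congr [:: _].
  have [gf gmin] := Hf v.
  apply: least_eq => [|j jf]; first by rewrite (Hg [tuple of f v :: v]).
  by rewrite (Hg [tuple of j :: v]) /=; exact: gmin.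
Qed.

Theorem countable_computable : countable [set u : nat -> nat | computable_seq u].
Proof.
pose codes (u : nat -> nat) : set (GenTree.tree nat) :=
  [set c | forall v : 1.-tuple nat, eval_code c v = [:: u (thead v)]].
pose code u := xget (GenTree.Leaf 0%N) (codes u).
have codeP u : computable_seq u -> codes u (code u).
  by move=> /computable_coded[c uc]; rewrite /code; case: xgetP => // /(_ c).
apply/countable_injP; exists (pickle \o code) => u u' /set_mem cu /set_mem cu' /=.
move=> /(pcan_inj pickleK) E; apply/funext => k.
have := codeP _ cu [tuple k]; have := codeP _ cu' [tuple k].
by rewrite E => -> [].
Qed.

End Codes.

(** * Expansions in integer bases *)

Fixpoint horner (b : nat) (w : nat -> nat) (n : nat) : nat :=
  if n is n'.+1 then (horner b w n' * b + w n')%N else 0%N.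

Lemma eq_horner b (w w' : nat -> nat) n :
  (forall j, (j < n)%N -> w j = w' j) -> horner b w n = horner b w' n.
Proof.
elim: n => //= n IH eqw; rewrite IH ?eqw // => j jn.
by apply: eqw; exact: ltnW.
Qed.

Section Horner.
Variables (b : nat) (w : nat -> nat).
Hypothesis b_gt1 : (1 < b)%N.
Hypothesis w_lt : forall j, (w j < b)%N.

Let b_gt0 : (0 < b)%N. Proof. exact: ltnW. Qed.

Lemma horner_leD n i : (horner b w n * b ^ i <= horner b w (n + i))%N.
Proof.
elim: i => [|i IH]; first by rewrite addn0 muln1.
rewrite addnS expnSr mulnA /=.
by rewrite (leq_trans _ (leq_addr _ _)) // leq_mul2r IH orbT.
Qed.

Lemma hornerS_leD n i : ((horner b w (n + i)).+1 <= (horner b w n).+1 * b ^ i)%N.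
Proof.
elim: i => [|i IH]; first by rewrite addn0 muln1.
rewrite addnS expnSr mulnA /=.
apply: leq_trans (leq_mul IH (leqnn b)).
by have := w_lt (n + i); lia.
Qed.

Lemma horner_mod n : (horner b w n.+1 %% b)%N = w n.
Proof. by rewrite /= modnMDl modn_small. Qed.

End Horner.

Section Expansions.
Variable R : realType.
Implicit Types (x : R) (b : nat).

Definition fracpart x : R := x - (Num.floor x)%:~R.

Lemma fracpart_ge0 x : 0 <= fracpart x.
Proof. by rewrite subr_ge0 Num.Theory.floor_le. Qed.

Lemma fracpart_lt1 x : fracpart x < 1.
Proof.
by rewrite ltrBlDl -[X in _ < _ + X]/(1%:~R) -intrD; case/andP: (floor_itv x).
Qed.

Lemma fracpart_id x : 0 <= x < 1 -> fracpart x = x.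
Proof.
move=> x01; rewrite /fracpart (_ : Num.floor x = 0) ?subr0 //.
by apply: floor_def; rewrite add0r.
Qed.

Section Series.
Variables (b : nat) (w : nat -> nat).
Hypothesis b_gt1 : (1 < b)%N.
Hypothesis w_lt : forall j, (w j < b)%N.

Let bR_gt0 n : 0 < b%:R ^+ n :> R.
Proof. by rewrite exprn_gt0 // ltr0n ltnW. Qed.

Lemma series_horner n :
  series (fun j => (w j)%:R / b%:R ^+ j.+1 : R) n = (horner b w n)%:R / b%:R ^+ n.
Proof.
elim: n => [|n IH]; first by rewrite /series /= big_geq // mul0r.
have b0 : b%:R != 0 :> R by rewrite -(expr1 b%:R) gt_eqF.
rewrite seriesEnat /= in IH *; rewrite big_nat_recr //= IH natrD natrM exprS.
by field; rewrite ?b0 ?expf_neq0.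
Qed.

Lemma horner_lower_mono n m : (n <= m)%N ->
  (horner b w n)%:R / b%:R ^+ n <= (horner b w m)%:R / b%:R ^+ m :> R.
Proof.
move=> /subnKC <-; move: (m - n)%N => i.
rewrite exprD ler_pdivlMr ?mulr_gt0 // mulrA divfK ?gt_eqF //.
by rewrite -natrX -natrM ler_nat horner_leD.
Qed.

Lemma horner_upper_mono n m : (n <= m)%N ->
  (horner b w m).+1%:R / b%:R ^+ m <= (horner b w n).+1%:R / b%:R ^+ n :> R.
Proof.
move=> /subnKC <-; move: (m - n)%N => i.
rewrite exprD ler_pdivrMr ?mulr_gt0 // mulrA divfK ?gt_eqF //.
by rewrite -natrX -natrM ler_nat hornerS_leD.
Qed.

Lemma horner_lt_upper n m :
  (horner b w n)%:R / b%:R ^+ n < (horner b w m).+1%:R / b%:R ^+ m :> R.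
Proof.
have /orP[le_nm|le_mn] := leq_total n m.
  apply: le_lt_trans (horner_lower_mono le_nm) _.
  by rewrite ltr_pM2r ?invr_gt0 // ltr_nat.
apply: lt_le_trans (horner_upper_mono le_mn).
by rewrite ltr_pM2r ?invr_gt0 // ltr_nat.
Qed.

(** The partial sums of a digit series are nondecreasing and bounded. *)
Lemma horner_cvg : exists x : R,
  series (fun j => (w j)%:R / b%:R ^+ j.+1 : R) @ \oo --> x.
Proof.
have mono : nondecreasing_seq (series (fun j => (w j)%:R / b%:R ^+ j.+1 : R)).
  by move=> n m nm; rewrite !series_horner horner_lower_mono.
have bounded : has_ubound (range (series (fun j => (w j)%:R / b%:R ^+ j.+1 : R))).
  exists 1 => _ [n _ <-]; rewrite series_horner.
  by apply: le_trans (ltW (horner_lt_upper n 0)) _; rewrite /= expr0 divr1.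
by exists (sup (range (series (fun j => (w j)%:R / b%:R ^+ j.+1 : R))));
  exact: nondecreasing_cvgn.
Qed.

Lemma invX_cvg0 (c : nat) : (1 < c)%N -> (fun n => (c%:R ^+ n)^-1 : R) @ \oo --> 0.
Proof.
move=> c1; under eq_fun do rewrite -exprVn.
apply: cvg_expr; rewrite ger0_norm ?invr_ge0 ?ler0n //.
by rewrite invf_lt1 ?ltr1n // ltr0n ltnW.
Qed.

Lemma series_cvg_bounds x :
  (series (fun j => (w j)%:R / b%:R ^+ j.+1 : R) @ \oo --> x) <->
  forall n, (horner b w n)%:R / b%:R ^+ n <= x <= (horner b w n).+1%:R / b%:R ^+ n.
Proof.
split=> [cvx n | bx].
  have Ex : limn (series (fun j => (w j)%:R / b%:R ^+ j.+1 : R)) = x.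
    exact: cvg_lim.
  rewrite -Ex; apply/andP; split.
    apply: limr_ge; first exact: (cvgP x cvx).
    near=> m; rewrite series_horner horner_lower_mono //.
    by near: m; exact: nbhs_infty_ge.
  apply: limr_le; first exact: (cvgP x cvx).
  by near=> m; rewrite series_horner ltW // horner_lt_upper.
rewrite (funext series_horner).
apply: (@squeeze_cvgr _ _ _ _ (fun n => x - (b%:R ^+ n)^-1) (fun=> x)).
- near=> n; have /andP[-> up] := bx n; rewrite andbT lerBlDr.
  by apply: le_trans up _; rewrite -natr1 mulrDl mul1r.
- rewrite -[X in _ --> X]subr0; apply: cvgB; first exact: cvg_cst.
  exact: invX_cvg0.
- exact: cvg_cst.
Unshelve. all: by end_near. Qed.

(** A run of maximal digits from place [N] on makes the sum of the series reach
    the upper end of its interval; any other digit keeps it strictly below. *)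
Lemma series_upper_strict x :
  (series (fun j => (w j)%:R / b%:R ^+ j.+1 : R) @ \oo --> x) ->
  (~ exists N, forall j, (N <= j)%N -> w j = b.-1) <->
  forall n, x < (horner b w n).+1%:R / b%:R ^+ n.
Proof.
move=> /series_cvg_bounds bx; split=> [notail n | strict [N tail]].
  have [j nj wj] : exists2 j, (n <= j)%N & w j != b.-1.
    apply: contra_notP notail => nj; exists n => j le_nj.
    by apply/eqP/negP => wj; apply: nj; exists j => //; apply/negP.
  have wj1 : ((w j).+1 < b)%N by rewrite ltn_neqAle w_lt -(ltn_predK b_gt1) eqSS wj.
  have /andP[_ up] := bx j.+1.
  apply: le_lt_trans up _; apply: lt_le_trans (horner_upper_mono nj).
  rewrite exprS ltr_pdivrMr ?mulr_gt0 ?ltr0n ?(ltnW b_gt1) //.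
  rewrite mulrA mulrAC divfK ?gt_eqF // -natrM ltr_nat /=.
  by lia.
have run i : (horner b w (N + i)).+1 = ((horner b w N).+1 * b ^ i)%N.
  elim: i => [|i IH]; first by rewrite addn0 muln1.
  rewrite addnS expnSr mulnA -IH /= tail ?leq_addr //.
  by have := ltn_predK b_gt1; lia.
have low i : (horner b w N).+1%:R / b%:R ^+ N - (b%:R ^+ i)^-1 <= x.
  have /andP[lo _] := bx (N + i)%N; apply: le_trans lo.
  have -> : (horner b w (N + i))%:R =
      (horner b w N).+1%:R * b%:R ^+ i - 1 :> R.
    by rewrite -natrX -natrM -run -natr1 addrK.
  rewrite exprD mulrBl mul1r -mulf_div mulfV ?gt_eqF // mulr1 lerD2l lerN2.
  rewrite lef_pV2 ?posrE ?mulr_gt0 // ler_peMl //.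
  by rewrite exprn_ege1 // ler1n ltnW.
have := strict N; apply/negP; rewrite -leNgt.
have lim : (fun i => (horner b w N).+1%:R / b%:R ^+ N - (b%:R ^+ i)^-1 : R) @ \oo
    --> ((horner b w N).+1%:R / b%:R ^+ N : R).
  rewrite -[X in _ --> X]subr0; apply: cvgB; [exact: cvg_cst | exact: invX_cvg0].
rewrite -(cvg_lim _ lim) //.
by apply: limr_le; [exact: (cvgP _ lim) | near=> i; exact: low].
Unshelve. all: by end_near. Qed.

End Series.

Lemma digit_lt b (w : digit_seq b) j : (1 < b)%N -> (w j < b)%N.
Proof. by move=> b1; rewrite -[X in (_ < X)%N](ltn_predK b1). Qed.

(** The strict upper bound that comes with the absence of a tail of maximal digits
    is what makes the prefixes integer parts, and thus determines the digits. *)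
Lemma expansionP b x (w : digit_seq b) : (1 < b)%N ->
  is_expansion x w <->
  forall n, Num.trunc (b%:R ^+ n * fracpart x) = horner b (fun j => w j) n.
Proof.
move=> b1; have wlt j := digit_lt w j b1.
have b0 n : 0 < b%:R ^+ n :> R by rewrite exprn_gt0 // ltr0n ltnW.
have trE n : Num.trunc (b%:R ^+ n * fracpart x) = horner b (fun j => w j) n <->
    (horner b (fun j => w j) n)%:R / b%:R ^+ n <= fracpart x <
      (horner b (fun j => w j) n).+1%:R / b%:R ^+ n.
  rewrite ler_pdivrMr // ltr_pdivlMr // [fracpart x * _]mulrC.
  split=> [<-|]; last exact: truncn_def.
  by apply: truncn_itv; rewrite mulr_ge0 ?fracpart_ge0 // ltW.
split=> [[cvw notail] n | tr].
  apply/trE; have /andP[-> _] := (series_cvg_bounds b1 wlt _).1 cvw n.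
  exact: ((series_upper_strict b1 wlt cvw).1 notail).
have cvw : series (fun j => (w j : nat)%:R / b%:R ^+ j.+1 : R) @ \oo --> fracpart x.
  apply: (series_cvg_bounds b1 wlt _).2 => n.
  by have /trE/andP[-> /ltW] := tr n.
split=> //; apply: (series_upper_strict b1 wlt cvw).2 => n.
by have /trE/andP[] := tr n.
Qed.

Definition expansion_digit b x (j : nat) : nat :=
  (Num.trunc (b%:R ^+ j.+1 * fracpart x) %% b)%N.

Lemma expansion_unique b x (w : digit_seq b) j : (1 < b)%N ->
  is_expansion x w -> w j = expansion_digit b x j :> nat.
Proof.
move=> b1 /(expansionP _ _ b1) wP; rewrite /expansion_digit wP horner_mod //.
by move=> i; exact: digit_lt.
Qed.

Lemma trunc_divX b (y : R) i : (0 < b)%N -> 0 <= y ->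
  (Num.trunc (b%:R ^+ i * y) %/ b ^ i)%N = Num.trunc y.
Proof.
move=> b0 y0; apply/esym/truncn_def.
have bi : 0 < b%:R ^+ i :> R by rewrite exprn_gt0 // ltr0n.
have := truncn_itv (mulr_ge0 (ltW bi) y0).
move: (Num.trunc _) => a /andP[lo up]; apply/andP; split.
  rewrite -(ler_pM2l bi); apply: le_trans lo.
  by rewrite -natrX -natrM ler_nat mulnC leq_trunc_div.
rewrite -(ltr_pM2l bi); apply: (lt_le_trans up).
rewrite -natrX -natrM ler_nat mulnC.
by rewrite {1}(divn_eq a (b ^ i)) mulSn addnC -addSn leq_add2r ltn_mod expn_gt0 b0.
Qed.

Lemma expansion_exists b x : (1 < b)%N ->
  is_expansion x (fun j => inord (expansion_digit b x j) : digit b).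
Proof.
move=> b1; apply/expansionP => //; elim=> [|n IH] /=.
  apply: truncn_def.
  by rewrite expr0 mul1r fracpart_ge0 fracpart_lt1.
rewrite inordK ?(ltn_predK b1) ?ltn_mod ?(ltnW b1) // -IH.
rewrite -(@trunc_divX b (b%:R ^+ n * _) 1) ?(ltnW b1) //; last first.
  by rewrite mulr_ge0 ?fracpart_ge0 // exprn_ge0.
by rewrite expr1 expn1 mulrA -exprS -divn_eq.
Qed.

Lemma expansion_sum b (w : digit_seq b) : (1 < b)%N ->
  ~ (exists N, forall j, (N <= j)%N -> w j = b.-1 :> nat) ->
  exists x : R, [/\ 0 <= x < 1, is_expansion x w,
    series (fun j => (w j : nat)%:R / b%:R ^+ j.+1 : R) @ \oo --> x &
    forall n, (horner b (fun j => w j) n)%:R / b%:R ^+ n <= x <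
      (horner b (fun j => w j) n).+1%:R / b%:R ^+ n].
Proof.
move=> b1 notail; have wlt j := digit_lt w j b1.
have [x cvx] := horner_cvg b1 wlt; exists x.
have up := (series_upper_strict b1 wlt cvx).1 notail.
have lo n : (horner b (fun j => w j) n)%:R / b%:R ^+ n <= x.
  by have /andP[] := (series_cvg_bounds b1 wlt _).1 cvx n.
have x01 : 0 <= x < 1.
  by have := lo 0%N; have := up 0%N; rewrite /= expr0 !divr1 => -> ->.
split=> // [|n]; last by rewrite lo up.
by split => //; rewrite -/(fracpart x) fracpart_id.
Qed.

End Expansions.

(** * Few nonzero digits make a number deterministic *)

Lemma cvg_inv_nat (R : realType) : (fun n => n%:R^-1 : R) @ \oo --> (0 : R).
Proof. by rewrite -cvg_shiftS; exact: cvg_harmonic. Qed.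

Section Deterministic.
Variables (R : realType) (b : nat).

Definition nonzero_at (i : nat) : set (shift_borel b) :=
  [set v | v i != ord0].

Lemma open_coord (i : nat) (B : set (digit b)) :
  open ([set v : shift_space b | B (v i)]).
Proof.
rewrite openE => v Bv; 
have /cvg_sup/(_ i) : nbhs (v : shift_space b) --> (v : shift_space b) by [].
apply.
exists [set v : shift_space b | B (v i)]; split=> //; exists B => //.
exact: discrete_open.
Qed.

Lemma measurable_nonzero_at i : measurable (nonzero_at i).
Proof. by apply: sub_sigma_algebra; exact: open_coord i [set d | d != ord0]. Qed.

Lemma continuous_indic_nonzero i :
  continuous (\1_(nonzero_at i) : shift_space b -> R).
Proof.
apply/continuousP => U _.
rewrite (_ : _ @^-1` U =
  [set v : shift_space b | [set d | U (d != ord0)%:R] (v i)]); last first.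
  by apply/seteqP; split=> v /=; rewrite indicE /nonzero_at mem_setE.
exact: open_coord i [set d | U (d != ord0)%:R].
Qed.

Lemma cvg_coord (F : set_system (shift_space b)) (v : shift_space b) :
  Filter F -> (forall i, F [set u : shift_space b | u i = v i]) -> F --> v.
Proof.
move=> FF Fv; apply/cvg_sup => i U [W [[B oB BW] Wv] WU].
apply: filterS (Fv i) => u /= uv; apply: WU; move: Wv; rewrite -BW /= uv.
by [].
Qed.

Definition shift_cont (v : shift_space b) : shift_space b := fun j => v j.+1.

Lemma open_shift (U : set (shift_space b)) : open U -> open (shift_cont @^-1` U).
Proof.
move=> oU; rewrite openE => v Uv.
pose F : set_system (shift_space b) := fmap shift_cont (nbhs v).
have FF : Filter F by apply: (@fmap_filter _ _ shift_cont (nbhs v) (nbhs_filter v)).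
have HF i : F [set u | u i = shift_cont v i].
  apply: (@open_nbhs_nbhs _ v [set u | u i.+1 = v i.+1]); split=> //.
  exact: open_coord i.+1 [set d | d = v i.+1].
have H := @cvg_coord F (shift_cont v) FF HF U.
apply: H.
by apply: open_nbhs_nbhs.
Qed.

Lemma measurable_iter_shift i : measurable_fun setT (iter i (@Defs.shift b)).
Proof.
elim: i => [|i IH] /=; first exact: measurable_id.
apply: (measurableT_comp _ IH).
apply: (@measurability _ _ (shift_borel b) (shift_borel b) setT (@Defs.shift b)
  (@open (shift_space b))) => //.
move=> _ [U oU <-]; rewrite setTI; apply: sub_sigma_algebra.
exact: open_shift.
Qed.

(** Every term [p * ln p] of the entropy of a partition vanishes when all the
    probabilities are 0 or 1. *)
Lemma zero_one_entropy (mu : {measure set (shift_borel b) -> \bar R}) :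
  (forall A, measurable A -> mu A = 0%E \/ mu A = 1%E) ->
  ks_entropy (@Defs.shift b) mu = 0%E.
Proof.
move=> mu01; have entropy0 m (P : 'I_m -> set (shift_borel b)) :
    finite_partition P -> partition_entropy (@Defs.shift b) mu P = 0%E.
  move=> [mP _ _]; rewrite /partition_entropy.
  rewrite (_ : (fun n => _) = (fun=> 0%E)); last first.
    apply/funext => n; rewrite /join_entropy big1 ?oppr0 ?mul0r // => u _.
    have mj : measurable (join_cell (@Defs.shift b) P u).
      apply: fin_bigcap_measurable; first exact: finite_finset.
      move=> i _; rewrite -[X in measurable X]setTI.
      exact: measurable_iter_shift.
    by have [->|->] := mu01 _ mj; rewrite ?mul0r //= ln1 mulr0.
  by rewrite (cvg_limn_einf_sup (@cvg_cst _ _ _ _ _)).2.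
rewrite /ks_entropy (_ : [set h | _] = [set 0%E]) ?ereal_sup1 //.
apply/seteqP; split=> h /=; first by move=> [m [P /entropy0 P0 ->]].
move=> ->; have part : finite_partition (fun _ : 'I_1 => setT : set (shift_borel b)).
  split=> //; last by apply/seteqP; split=> // v _; exists ord0.
  by move=> i j _ _ _; rewrite !ord1.
by exists 1%N, (fun=> setT) => //; rewrite entropy0.
Qed.

(** The indicator of a nonzero digit in a given place is continuous, so its
    integral against a limit measure is a limit of frequencies, which is 0. Hence
    every limit measure is the point mass at the zero sequence. *)
Lemma deterministic_of_sparse (x : R) (w : digit_seq b) :
  is_expansion x w ->
  (fun n => (\sum_(j < n) (w j != ord0))%N%:R / n%:R : R) @ \oo --> (0 : R) ->
  deterministic b x.
Proof.
move=> xw sparse_w; exists w => // mu [phi phi_mono cvg_mu].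
have iterE i j : iter i (@Defs.shift b) w j = w (j + i)%N.
  elim: i j => [|i IH] j; first by rewrite addn0.
  by rewrite iterS /Defs.shift IH addSnnS.
have phi_ge i : (i <= phi i)%N.
  by elim: i => // i IH; exact: leq_ltn_trans IH (phi_mono _ _ (ltnSn i)).
have nuE i n : empirical_measure R w n (nonzero_at i) =
    ((\sum_(j < n) (w (i + j)%N != ord0))%N%:R / n%:R)%:E.
  rewrite /empirical_measure /= /mscale /= /msum /=.
  rewrite (eq_bigr (fun j : 'I_n => (w (i + j)%N != ord0)%:R%:E)); last first.
    by move=> j _; rewrite diracE mem_setE -(iterE j i).
  by rewrite sumEFin -EFinM mulrC natr_sum.
have freq0 i : (fun n => (\sum_(j < n) (w (i + j)%N != ord0))%N%:R / n%:R : R)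
    @ \oo --> (0 : R).
  pose freq n : R := (\sum_(j < n) (w j != ord0))%N%:R / n%:R.
  apply: (@squeeze_cvgr _ _ _ _ (fun=> 0) (fun n => freq n + i%:R / n%:R)).
  - near=> n; rewrite divr_ge0 //= /freq -mulrDl ler_wpM2r ?invr_ge0 //.
    rewrite -natrD ler_nat -(big_mkord predT (fun j => (w (i + j)%N != ord0) : nat)).
    rewrite -(big_mkord predT (fun j => (w j != ord0) : nat)).
    rewrite (_ : (\sum_(0 <= j < n) _)%N =
                 (\sum_(i <= j < n + i) (w j != ord0))%N); last first.
      rewrite -{2}[i]add0n big_addn addnK.
      by apply: eq_bigr => j _; rewrite addnC.
    apply: (@leq_trans (\sum_(0 <= j < n + i) (w j != ord0))%N).
      by rewrite [X in (_ <= X)%N](big_cat_nat (n := i)) ?leq_addl //= leq_addl.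
    rewrite (big_cat_nat (n := n)) ?leq_addr //= leq_add2l.
    apply: leq_trans (leq_sum _ (fun j _ => leq_b1 _)) _.
    by rewrite sum_nat_const_nat muln1 addKn.
  - exact: cvg_cst.
  - rewrite -[X in _ --> X]addr0; apply: cvgD => //.
    rewrite -[X in _ --> X](mulr0 i%:R); apply: cvgM; first exact: cvg_cst.
    exact: cvg_inv_nat.
have mu0 i : mu (nonzero_at i) = 0%E.
  have := cvg_mu _ (@continuous_indic_nonzero i).
  rewrite integral_indic // ?setIT; last exact: measurable_nonzero_at.
  move=> cvg1.
  have cvg2 : (fun k => (\int[empirical_measure R w (phi k)]_v
      (\1_(nonzero_at i) v)%:E)%E) @ \oo --> 0%E.
    rewrite (_ : (fun k => _) = (fun k =>
      ((\sum_(j < phi k) (w (i + j)%N != ord0))%N%:R / (phi k)%:R)%:E)); last first.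
      apply/funext => k; rewrite -nuE integral_indic ?setIT //.
      exact: measurable_nonzero_at.
    apply: cvg_EFin; first by near=> k.
    apply: (@cvg_comp _ _ _ phi _ _ _ _ _ (freq0 i)).
    by move=> A [N _ NA]; exists N => // k /= Nk; apply: NA; exact: leq_trans Nk (phi_ge k).
  exact: (cvg_unique _ cvg1 cvg2).
pose U := \bigcup_i (nonzero_at i : set (shift_borel b)).
have mU : measurable U by apply: bigcupT_measurable => i; exact: measurable_nonzero_at.
have muU : mu U = 0%E.
  apply/(negligibleP _ mU)/negligible_bigcup => i.
  by apply/negligibleP; [exact: measurable_nonzero_at | exact: mu0].
have null A : measurable A -> A `<=` U -> mu A = 0%E.
  move=> mA AU; apply/eqP; rewrite eq_le measure_ge0 andbT -muU.
  by apply: le_measure; rewrite ?inE.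
pose zero : shift_borel b := fun=> ord0.
have zero_only A : ~ A zero -> A `<=` U.
  move=> nA v Av; apply: contrapT => nU; apply: nA.
  suff <- : v = zero by [].
  apply/funext => i; apply/eqP/negPn/negP => vi.
  by apply: nU; exists i.
apply: zero_one_entropy => A mA.
have [Az|nAz] := pselect (A zero); [right | left; exact: null (zero_only _ nAz)].
have nullC : mu (~` A) = 0%E.
  by apply: null; [exact: measurableC | apply: zero_only => /(_ Az)].
have := probability_setC mu (measurableC mA).
by rewrite setCK nullC sube0.
Unshelve. all: by end_near. Qed.
End Deterministic.

(** * Cosine averages over binary digits *)

Lemma odd_sum_exp c i : odd c -> odd (\sum_(j < i) c ^ j) = odd i.
Proof.
move=> oc; elim: i => [|i IH]; first by rewrite big_ord0.
by rewrite big_ord_recr /= oddD IH oddX oc orbT addbT.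
Qed.

(** An odd factor of [i] contributes an odd geometric sum; each factor 2 of [i]
    contributes a factor [c ^ j + 1], which is 2 modulo 4. *)
Lemma logn2_exp_sub1 c i : (1 < c)%N -> (c %% 4 = 1)%N -> (0 < i)%N ->
  logn 2 (c ^ i - 1) = (logn 2 (c - 1) + logn 2 i)%N.
Proof.
move=> c1 c4; have oc : odd c by rewrite (divn_eq c 4) c4 oddD oddM /= andbF.
elim/ltn_ind: i => i IH i0.
have [oi|ei] := boolP (odd i).
  have oS : odd (\sum_(j < i) c ^ j) by rewrite odd_sum_exp.
  rewrite !subn1 predn_exp lognM; last by case: (\sum_(j < i) c ^ j)%N oS.
    by rewrite (@logn_coprime 2 (\sum_(j < i) _)) ?(@logn_coprime 2 i) ?coprime2n.
  by rewrite -ltnS prednK // ltnW.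
have [j Ej] : exists j, i = j.*2 by exists i./2; rewrite -[LHS]odd_double_half (negbTE ei).
have j0 : (0 < j)%N by rewrite -double_gt0 -Ej.
have cj1 : (1 < c ^ j)%N by rewrite -(exp1n j) ltn_exp2r.
have cj4 : (c ^ j %% 4 = 1)%N by rewrite -modnXm c4 exp1n.
have -> : (c ^ i - 1 = (c ^ j - 1) * (c ^ j + 1))%N.
  by rewrite Ej -muln2 expnM -[in RHS](exp1n 2) -subn_sqr.
have jlt : (j < i)%N by rewrite Ej -addnn -[X in (X < _)%N]addn0 ltn_add2l.
have -> : (c ^ j + 1 = 2 * (c ^ j + 1)./2)%N.
  rewrite mul2n -[LHS]odd_double_half oddD oddX oc orbT //.
have oh : odd (c ^ j + 1)./2.
  move: cj4; move: (c ^ j)%N => m m4; rewrite (divn_eq m 4) m4; lia.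
rewrite !lognM ?subn_gt0 ?muln_gt0 //=; last by case: (_./2) oh.
  rewrite (IH j jlt j0) (@logn_coprime 2 (_./2)) ?coprime2n // addn0.
  rewrite (_ : logn 2 2 = 1%N) // Ej -mul2n lognM // (_ : logn 2 2 = 1%N) //; lia.
by case: (_./2) oh.
Qed.

Section CosineAverages.
Variable R : realType.

(** The absolute value makes the period one instead of two. *)
Definition abscos (x : R) : R := `|cos (pi * x)|.

Lemma abscos_ge0 x : 0 <= abscos x.
Proof. exact: normr_ge0. Qed.

Lemma abscos_le1 x : abscos x <= 1.
Proof. by rewrite ler_norml cos_geN1 cos_le1. Qed.

Lemma abscos0 : abscos 0 = 1.
Proof. by rewrite /abscos mulr0 cos0 normr1. Qed.

Lemma abscosDn x n : abscos (x + n%:R) = abscos x.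
Proof.
elim: n => [|n IH]; first by rewrite addr0.
rewrite -natr1 addrA -IH /abscos mulrDr mulr1 cosDpi normrN //.
Qed.

Lemma abscosN x : abscos (- x) = abscos x.
Proof. by rewrite /abscos mulrN cosN. Qed.

(** The mean is at most the square root of 1/2; the rational 3/4 is enough. *)
Lemma abscos_half x : abscos x + abscos (x + 2^-1) <= 3 / 2.
Proof.
rewrite /abscos mulrDr cosDpihalf normrN.
have := cos2Dsin2 (pi * x); rewrite -(real_normK (num_real (cos _))).
rewrite -(real_normK (num_real (sin _))).
have := normr_ge0 (cos (pi * x)); have := normr_ge0 (sin (pi * x)).
move: `|cos _| `|sin _| => c s _ _ cs1.
have := sqr_ge0 (c - 3 / 4); have := sqr_ge0 (s - 3 / 4); nra.
Qed.

Lemma sum_ord_double (n : nat) (F : nat -> R) :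
  \sum_(u < n + n) F u = \sum_(u < n) (F u + F (u + n)%N).
Proof.
rewrite big_split_ord big_split /=; congr (_ + _).
by apply: eq_bigr => u _; rewrite addnC.
Qed.

(** Averaging over the top binary digit gains a factor 3/4 for each active
    factor: flipping that digit moves the top argument by 1/2 and every lower
    one by an integer. *)
Lemma sum_prod_abscos (s : nat -> bool) (c e k : nat) :
  \sum_(u < 2 ^ k) \prod_(i < k) abscos ((s i)%:R * (c + 2 ^ e * u)%:R / 2 ^+ (e + i).+1)
  <= 2 ^+ k * \prod_(i < k) (if s i then 3 / 4 else 1).
Proof.
elim: k => [|k IH]; first by rewrite expn0 big_ord1 !big_ord0 mulr1.
rewrite expnS mul2n -addnn (sum_ord_double _ (fun u => \prod_(i < k.+1)
  abscos ((s i)%:R * (c + 2 ^ e * u)%:R / 2 ^+ (e + i).+1))).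
rewrite [X in _ <= _ * X]big_ord_recr /= exprSr.
have -> (x : R) : 2 ^+ k * 2 * (x * (if s k then 3 / 4 else 1)) =
    (2 ^+ k * x) * (if s k then 3 / 2 else 2) by case: (s k); field.
apply: le_trans (ler_wpM2r _ IH); last by case: (s k).
rewrite mulr_suml; apply: ler_sum => u _.
rewrite !big_ord_recr /=.
set P := \prod_(i < k) abscos ((s i)%:R * (c + 2 ^ e * u)%:R / 2 ^+ (e + i).+1).
have -> : \prod_(i < k) abscos ((s i)%:R * (c + 2 ^ e * (u + 2 ^ k))%:R / 2 ^+ (e + i).+1) = P.
  apply: eq_bigr => i _.
  have -> : (s i)%:R * (c + 2 ^ e * (u + 2 ^ k))%:R / 2 ^+ (e + i).+1 =
    (s i)%:R * (c + 2 ^ e * u)%:R / 2 ^+ (e + i).+1 + ((s i) * 2 ^ (k - i.+1))%:R :> R.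
    rewrite mulnDr addnA natrD mulrDr mulrDl; congr (_ + _).
    rewrite [RHS]natrM -mulrA; congr (_ * _).
    apply: (@mulIf _ (2 ^+ (e + i).+1)); first by rewrite expf_neq0.
    rewrite divfK ?expf_neq0 // -!natrX -natrM -!expnD; congr (_ ^ _)%:R.
    by have := ltn_ord i; lia.
  by rewrite abscosDn.
rewrite -mulrDr ler_wpM2l //; first by apply: prodr_ge0 => i _; exact: abscos_ge0.
case: (s k); last by rewrite !mul0r abscos0.
have -> : (c + 2 ^ e * (u + 2 ^ k))%:R = (c + 2 ^ e * u)%:R + (2 ^ e * 2 ^ k)%:R :> R.
  by rewrite mulnDr addnA natrD.
rewrite !mul1r [(_ + _) / _]mulrDl.
have -> : (2 ^ e * 2 ^ k)%:R / 2 ^+ (e + k).+1 = 2^-1 :> R.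
  rewrite -expnD natrX exprSr invfM mulrA divff ?mul1r // expf_neq0 //.
exact: abscos_half.
Qed.

End CosineAverages.

(** * Powers of an odd base modulo powers of 2 *)

Lemma exp_gt1 m n : (1 < m)%N -> (0 < n)%N -> (1 < m ^ n)%N.
Proof. by move=> m1 n0; rewrite -[X in (X < _)%N](exp1n n) ltn_exp2r. Qed.

Section PowerAverages.
Variable R : realType.
Local Notation abscos := (@abscos R).

Definition cosprod (s : nat -> bool) (e k w : nat) : R :=
  \prod_(i < k) abscos ((s i)%:R * w%:R / 2 ^+ (e + i).+1).

Lemma cosprod_mod s e k w : cosprod s e k w = cosprod s e k (w %% 2 ^ (e + k)).
Proof.
apply: eq_bigr => i _; rewrite [in LHS](divn_eq w (2 ^ (e + k))).
set q := (w %/ _)%N; set r := (w %% _)%N.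
have -> : (s i)%:R * (q * 2 ^ (e + k) + r)%:R / 2 ^+ (e + i).+1 =
    (s i)%:R * r%:R / 2 ^+ (e + i).+1 + (s i * q * 2 ^ (k - i.+1))%:R :> R.
  rewrite addnC natrD mulrDr mulrDl; congr (_ + _).
  rewrite -mulnA [RHS]natrM -mulrA; congr (_ * _).
  apply: (@mulIf _ (2 ^+ (e + i).+1)); first by rewrite expf_neq0.
  rewrite divfK ?expf_neq0 // -natrX -natrM -mulnA -expnD.
  by congr (_ * 2 ^ _)%:R; have := ltn_ord i; lia.
by rewrite abscosDn.
Qed.

Section OddBase.
Variable b : nat.
Hypothesis b_gt1 : (1 < b)%N.
Hypothesis b_odd : odd b.

(** Squares of odd numbers are 1 modulo 8, and this is the exact power of 2 up to
    which the square of the base is 1. *)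
Definition sqr_level := logn 2 (b ^ 2 - 1).
Local Notation e := sqr_level.

Let sqr_mod4 : (b ^ 2 %% 4 = 1)%N.
Proof. by rewrite (divn_eq b 2) modn2 b_odd; lia. Qed.

Let sqr_gt1 : (1 < b ^ 2)%N.
Proof. exact: exp_gt1. Qed.

(** By lifting the exponent. As a consequence the even powers of the base run
    exactly once through the residues modulo [2 ^ (e + k)] that are 1 modulo
    [2 ^ e], that is, their digits above place [e] are equidistributed. *)
Lemma sqr_powers_inj (D k i j : nat) : odd D -> (i < 2 ^ k)%N -> (j < 2 ^ k)%N ->
  ((b ^ 2) ^ i * D = (b ^ 2) ^ j * D %[mod 2 ^ (e + k)])%N -> i = j.
Proof.
move=> oD; wlog le_ij : i j / (i <= j)%N.
  move=> H ik jk E; case/orP: (leq_total i j) => [|] le; first exact: H.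
  by apply/esym/H.
move=> _ jk /eqP; rewrite eq_sym eqn_mod_dvd; last first.
  by rewrite leq_mul2r leq_exp2l ?sqr_gt1 // le_ij orbT.
have Ej : ((b ^ 2) ^ j = (b ^ 2) ^ i * (b ^ 2) ^ (j - i))%N by rewrite -expnD subnKC.
rewrite -mulnBl Ej -{2}[((b ^ 2) ^ i)%N]muln1 -mulnBr.
case: (posnP (j - i)) => [|ji0]; first by lia.
rewrite -mulnA mulnC Gauss_dvdl; last first.
  by apply: coprimeXl; rewrite coprime2n !oddX b_odd !orbT.
rewrite Gauss_dvdl; last by apply: coprimeXl; rewrite coprime2n.
rewrite pfactor_dvdn //; last by rewrite subn_gt0 exp_gt1.
rewrite logn2_exp_sub1 // leq_add2l -pfactor_dvdn // => /(dvdn_leq ji0).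
by lia.
Qed.

Lemma sqr_powers_mod D i : ((b ^ 2) ^ i * D = D %[mod 2 ^ e])%N.
Proof.
rewrite -modnMml -modnXm.
have -> : (b ^ 2 = 1 %[mod 2 ^ e])%N.
  by apply/eqP; rewrite eqn_mod_dvd ?(ltnW sqr_gt1) // pfactor_dvdnn.
by rewrite modnXm exp1n modnMml mul1n.
Qed.

Lemma sum_sqr_powers (s : nat -> bool) (D k : nat) : odd D ->
  \sum_(i < 2 ^ k) cosprod s e k ((b ^ 2) ^ i * D) <=
  2 ^+ k * \prod_(i < k) (if s i then 3 / 4 else 1).
Proof.
move=> oD; pose r i := ((b ^ 2) ^ i * D %% 2 ^ (e + k))%N.
have u_lt (i : 'I_(2 ^ k)) : (r i %/ 2 ^ e < 2 ^ k)%N.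
  by rewrite ltn_divLR ?expn_gt0 // -expnD addnC ltn_mod expn_gt0.
pose u (i : 'I_(2 ^ k)) := Ordinal (u_lt i).
have rE i : r i = (D %% 2 ^ e + 2 ^ e * (r i %/ 2 ^ e))%N.
  rewrite [LHS](divn_eq _ (2 ^ e)) addnC mulnC; congr (_ + _)%N.
  by rewrite /r modn_dvdm ?dvdn_exp2l ?leq_addr // sqr_powers_mod.
have u_inj : injective u.
  move=> i j [] Eu; have Er : r i = r j by rewrite (rE i) (rE j) Eu.
  exact: val_inj (sqr_powers_inj oD (ltn_ord i) (ltn_ord j) Er).
rewrite (eq_bigr (fun i => cosprod s e k (D %% 2 ^ e + 2 ^ e * u i))); last first.
  by move=> i _; rewrite cosprod_mod; congr cosprod; exact: rE.
rewrite -(reindex_inj u_inj (op := +%R) (P := predT)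
  (F := fun i : 'I_(2 ^ k) => cosprod s e k (D %% 2 ^ e + 2 ^ e * i))) /=.
exact: sum_prod_abscos.
Qed.

Lemma sum_ord_parity (n : nat) (F : nat -> R) :
  \sum_(j < n.*2) F j = \sum_(i < n) F i.*2 + \sum_(i < n) F i.*2.+1.
Proof.
elim: n => [|n IH]; first by rewrite !big_ord0 addr0.
by rewrite doubleS !big_ord_recr /= IH; ring.
Qed.

Lemma sum_powers (s : nat -> bool) (D k : nat) : odd D ->
  \sum_(j < 2 ^ k.+1) cosprod s e k (b ^ j * D) <=
  2 ^+ k.+1 * \prod_(i < k) (if s i then 3 / 4 else 1).
Proof.
move=> oD; rewrite expnS mul2n (sum_ord_parity _ (fun j => cosprod s e k (b ^ j * D))).
rewrite exprS -mulrA mulrDl mul1r; apply: lerD.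
  under eq_bigr do rewrite -mul2n expnM.
  exact: sum_sqr_powers.
under eq_bigr do rewrite -mul2n expnSr expnM -mulnA.
by apply: sum_sqr_powers; rewrite oddM b_odd.
Qed.

(** The factor that the random digits of places [t + 1] to [K] contribute to a
    correlation of two characters whose frequencies differ by [z]. *)
Definition corr (s : nat -> bool) (t K : nat) (z : R) : R :=
  \prod_(t.+1 <= p < K.+1) abscos ((s p)%:R * z / 2 ^+ p).

Lemma prodr01 (f : nat -> R) (m n : nat) :
  (forall i, 0 <= f i <= 1) -> 0 <= \prod_(m <= i < n) f i <= 1.
Proof.
move=> f01; apply: (big_ind (fun x => 0 <= x <= 1)); first by rewrite ler01 lexx.
  by move=> x y /andP[x0 x1] /andP[y0 y1]; rewrite mulr_ge0 // mulr_ile1.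
by move=> i _; exact: f01.
Qed.

Lemma corr_ge0 s t K z : 0 <= corr s t K z.
Proof. by apply: prodr_ge0 => p _; exact: abscos_ge0. Qed.

Lemma corr_le1 s t K z : corr s t K z <= 1.
Proof.
by case/andP: (@prodr01 (fun p => abscos ((s p)%:R * z / 2 ^+ p)) t.+1 K.+1
  (fun p => introT andP (conj (abscos_ge0 _) (abscos_le1 _)))).
Qed.

Lemma corrN s t K z : corr s t K (- z) = corr s t K z.
Proof. by apply: eq_bigr => p _; rewrite mulrN mulNr abscosN. Qed.

Lemma prod_nat_sub_le (f : nat -> R) (m n p q : nat) :
  (forall i, 0 <= f i <= 1) -> (m <= n)%N -> (n <= p)%N -> (p <= q)%N ->
  \prod_(m <= i < q) f i <= \prod_(n <= i < p) f i.
Proof.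
move=> f01 mn np pq.
have prod01 a c : 0 <= \prod_(a <= i < c) f i <= 1 by exact: prodr01.
rewrite (big_cat_nat (n := n)) ?(leq_trans np) //= (big_cat_nat (n := p) (m := n)) //=.
have /andP[a0 a1] := prod01 m n; have /andP[c0 c1] := prod01 p q.
have /andP[x0 _] := prod01 n p.
move: (\prod_(m <= i < n) f i) (\prod_(n <= i < p) f i) (\prod_(p <= i < q) f i) a0 a1 c0 c1 x0.
move=> a x c a0 a1 c0 c1 x0.
by rewrite -[leRHS]mul1r ler_pM ?mulr_ge0 // ler_piMr.
Qed.

Lemma prod_drop (f : nat -> R) (t k : nat) :
  (forall i, (i < t)%N -> f i = 1) -> (t <= k)%N ->
  \prod_(i < k) f i = \prod_(t <= i < k) f i.
Proof.
move=> f1 tk; rewrite -(big_mkord predT f) (big_cat_nat (n := t)) //=.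
rewrite (_ : \prod_(0 <= i < t) f i = 1) ?mul1r //.
by rewrite big_mkord big1 // => i _; exact: f1.
Qed.

(** The factors 2 of [C] shift all binary digits by [logn 2 C] places, and the
    lowest [e] of the remaining places carry no randomness because the even powers
    of the base agree there. *)
Lemma sum_corr_powers (s : nat -> bool) (t K C k : nat) :
  (0 < C)%N -> (t <= k)%N -> (logn 2 C + e + k <= K)%N ->
  \sum_(j < 2 ^ k.+1) corr s t K (b ^ j * C)%:R <=
  2 ^+ k.+1 * (3 / 4) ^+ (\sum_((t + logn 2 C + e).+1 <= p < (logn 2 C + e + k).+1) s p).
Proof.
move=> C0 tk kK; set v := logn 2 C.
have [D oD CE] : exists2 D, odd D & C = (2 ^ v * D)%N.
  have [D + ->] := @pfactor_coprime 2 C isT C0.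
  by rewrite coprime2n mulnC => oD; exists D.
pose s' i := (t <= i)%N && s (v + e + i.+1)%N.
have -> : (3 / 4) ^+ (\sum_((t + v + e).+1 <= p < (v + e + k).+1) s p) =
    \prod_(i < k) (if s' i then 3 / 4 else 1) :> R.
  rewrite (@prod_drop (fun i => if s' i then 3 / 4 else 1) t k) //; last first.
    by move=> i it; rewrite /s' leqNgt it.
  rewrite (_ : (t + v + e).+1 = (t + (v + e).+1)%N); last by lia.
  rewrite (_ : (v + e + k).+1 = (k + (v + e).+1)%N); last by lia.
  rewrite big_addn addnK expr_sum big_nat_cond [RHS]big_nat_cond.
  apply: eq_bigr => i /andP[/andP[ti _] _].
  by rewrite /s' ti /= addnC addSnnS; case: (s _).
apply: le_trans (sum_powers s' k oD); apply: ler_sum => j _.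
rewrite /corr /cosprod.
apply: (@le_trans _ _ (\prod_((t + v + e).+1 <= p < (v + e + k).+1)
    abscos ((s p)%:R * (b ^ j * C)%:R / 2 ^+ p))).
  apply: prod_nat_sub_le; [by move=> i; rewrite abscos_ge0 abscos_le1 | lia..].
rewrite (@prod_drop (fun i => abscos ((s' i)%:R * (b ^ j * D)%:R / 2 ^+ (e + i).+1))
  t k) //; last by move=> i it; rewrite /s' leqNgt it /= !mul0r abscos0.
rewrite (_ : (t + v + e).+1 = (t + (v + e).+1)%N); last by lia.
rewrite (_ : (v + e + k).+1 = (k + (v + e).+1)%N); last by lia.
rewrite big_addn addnK big_nat_cond [leRHS]big_nat_cond.
rewrite le_eqVlt; apply/orP; left; apply/eqP.
apply: eq_bigr => i /andP[/andP[ti _] _]; rewrite /s' ti /=.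
rewrite -[(v + e + i.+1)%N]addSnnS [((v + e).+1 + i)%N]addnC -!mulrA; congr (abscos (_ * _)).
rewrite CE (_ : (i + (v + e).+1 = v + (e + i).+1)%N); last by lia.
rewrite mulnCA natrM natrX exprD invfM mulrACA divff ?expf_neq0 // mul1r //.
Qed.

(** The pairs are sorted by their difference; letting the smaller member run up to
    [N] only adds nonnegative terms. *)
Lemma sum_pairs_le (N : nat) (g : nat -> nat -> R) :
  (forall i j, 0 <= g i j) -> (forall i j, g i j = g j i) ->
  \sum_(i < N) \sum_(j < N) g i j <=
  2 * \sum_(r < N) \sum_(j < N) g (j + r)%N j.
Proof.
move=> g0 gC; pose T := \sum_(j < N) \sum_(i < N) (if (j <= i)%N then g i j else 0).
have TE : T = \sum_(i < N) \sum_(j < N) (if (j <= i)%N then g i j else 0).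
  exact: exchange_big.
apply: (@le_trans _ _ (2 * T)).
  rewrite mulrDl mul1r {1}TE /T -big_split /=; apply: ler_sum => i _.
  rewrite -big_split /=; apply: ler_sum => j _.
  move: (leq_total i j) (g0 j i); rewrite (gC i j).
  by case: (j <= i)%N; case: (i <= j)%N => //= _ h; lra.
rewrite ler_wpM2l // [leRHS]exchange_big; apply: ler_sum => j _.
apply: (@le_trans _ _ (\sum_(i < j + N) (if (j <= i)%N then g i j else 0))).
  rewrite addnC [leRHS]big_split_ord /= lerDl; apply: sumr_ge0 => i _.
  by case: ifP.
rewrite big_split_ord /= big1 ?add0r; last by move=> i _; rewrite leqNgt ltn_ord.
by apply: ler_sum => i _; rewrite leq_addr.
Qed.

Lemma count_multiples (d N : nat) : (\sum_(r < N) (d %| r) <= (N %/ d).+1)%N.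
Proof.
rewrite divn_count_dvd -(big_mkord predT (fun r => (d %| r) : nat)).
apply: (@leq_trans (\sum_(0 <= r < N.+1) (d %| r))%N).
  by rewrite [leqRHS]big_nat_recr //= leq_addr.
by rewrite big_ltn // dvdn0.
Qed.

Lemma logn_pow_sub1 r : (0 < r)%N -> (logn 2 (b ^ r - 1) <= e + logn 2 r)%N.
Proof.
move=> r0; rewrite -logn2_exp_sub1 // -expnM mulnC expnM.
have br : (1 < b ^ r)%N by exact: exp_gt1.
have -> : ((b ^ r) ^ 2 - 1 = (b ^ r - 1) * (b ^ r + 1))%N.
  by rewrite -[in LHS](exp1n 2) subn_sqr.
by rewrite lognM ?subn_gt0 ?addn1 // leq_addr.
Qed.

(** Second moment of a Weyl sum along the powers of the base: differences of
    exponents divisible by a high power of 2 are rare, and for the others the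
    random digits decorrelate. [Z] bounds below the number of active places in
    every window that can occur. *)
Lemma sum_corr_pairs (s : nat -> bool) (t K k N h l Z : nat) :
  (0 < h)%N -> (2 ^ k <= N <= 2 ^ k.+1)%N -> (t <= k)%N -> (l <= k)%N ->
  (logn 2 h + 2 * e + l + k <= K)%N ->
  (forall a, (a <= t + logn 2 h + 2 * e + l + 1)%N ->
     (Z <= \sum_(a <= p < a + (k - t)) s p)%N) ->
  \sum_(i < N) \sum_(j < N) corr s t K (h%:R * (b%:R ^+ i - b%:R ^+ j)) <=
  4 * N%:R ^+ 2 * ((3 / 4) ^+ Z + (2 ^+ l)^-1).
Proof.
move=> h0 /andP[kN Nk] tk lk kK window.
have q0 : 0 <= 3 / 4 :> R by lra.
have q1 : 3 / 4 <= 1 :> R by lra.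
pose g i j := corr s t K (h%:R * (b%:R ^+ i - b%:R ^+ j)).
have gC i j : g i j = g j i by rewrite /g -opprB mulrN corrN.
apply: (le_trans (@sum_pairs_le N g _ gC)); first by move=> i j; exact: corr_ge0.
have gE r j : g (j + r)%N j = corr s t K (b ^ j * (h * (b ^ r - 1)))%:R.
  rewrite /g; congr (corr _ _ _ _); rewrite !natrM natrB ?expn_gt0 ?(ltnW b_gt1) //.
  by rewrite !natrX exprD; ring.
have inner r : \sum_(j < N) g (j + r)%N j <=
    2 ^+ k.+1 * (3 / 4) ^+ Z + (2 ^ l %| r)%:R * N%:R.
  have [dr|ndr] := boolP (2 ^ l %| r)%N.
    apply: (@le_trans _ _ N%:R); last by rewrite mul1r lerDr mulr_ge0 ?exprn_ge0.
    rewrite -[leRHS]mulr1 mulr_natl -[X in _ *+ X]card_ord -sumr_const.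
    by apply: ler_sum => j _; exact: corr_le1.
  have r0 : (0 < r)%N by case: r ndr; rewrite ?dvdn0.
  have br0 : (0 < b ^ r - 1)%N by rewrite subn_gt0 exp_gt1.
  set C := (h * (b ^ r - 1))%N; have C0 : (0 < C)%N by rewrite muln_gt0 h0.
  have vC : (logn 2 C + e <= logn 2 h + 2 * e + l)%N.
    rewrite /C lognM //; have := logn_pow_sub1 r0.
    by move: ndr; rewrite pfactor_dvdn // -ltnNge; lia.
  rewrite mul0r addr0.
  apply: (@le_trans _ _ (\sum_(j < 2 ^ k.+1) corr s t K (b ^ j * C)%:R)).
    rewrite -(subnKC Nk) [leRHS]big_split_ord /= -[leLHS]addr0; apply: lerD.
      by apply: ler_sum => j _; rewrite gE.
    by apply: sumr_ge0 => j _; exact: corr_ge0.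
  apply: (le_trans (sum_corr_powers s C0 tk _)); first by lia.
  rewrite ler_wpM2l ?exprn_ge0 // ler_wiXn2l //.
  apply: leq_trans (window (t + logn 2 C + e).+1 _) _; first by lia.
  rewrite (_ : ((t + logn 2 C + e).+1 + (k - t) = (logn 2 C + e + k).+1)%N) //; lia.
have -> : 4 * N%:R ^+ 2 * ((3 / 4) ^+ Z + (2 ^+ l)^-1) =
   2 * (N%:R * (2 * N%:R * (3 / 4) ^+ Z) + 2 * N%:R / 2 ^+ l * N%:R) :> R by ring.
rewrite ler_wpM2l //.
apply: (@le_trans _ _
    (\sum_(r < N) (2 ^+ k.+1 * (3 / 4) ^+ Z + (2 ^ l %| r)%:R * N%:R))).
  by apply: ler_sum => r _; exact: inner.
rewrite big_split /=; apply: lerD.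
  rewrite sumr_const card_ord -[leLHS]mulr_natl ler_wpM2l // ler_wpM2r ?exprn_ge0 //.
  by rewrite exprS ler_wpM2l // -natrX ler_nat.
rewrite -mulr_suml ler_wpM2r // -natr_sum.
apply: (@le_trans _ _ (N %/ 2 ^ l).+1%:R); first by rewrite ler_nat count_multiples.
have l0 : 0 < 2 ^+ l :> R by rewrite exprn_gt0.
rewrite ler_pdivlMr // -natrX -!natrM ler_nat.
have lN : (2 ^ l <= N)%N by apply: leq_trans kN; rewrite leq_exp2l.
by have := leq_trunc_div N (2 ^ l); lia.
Qed.

End OddBase.
End PowerAverages.

(** * The Fejer kernel *)

Section Fejer.
Variable R : realType.
Implicit Types (u x : R).

Lemma sum_cos_sub (N : nat) (z : nat -> R) :
  \sum_(i < N) \sum_(j < N) cos (z i - z j) =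
  (\sum_(i < N) cos (z i)) ^+ 2 + (\sum_(i < N) sin (z i)) ^+ 2.
Proof.
rewrite !expr2 !mulr_suml -big_split /=; apply: eq_bigr => i _.
rewrite !mulr_sumr -big_split /=; apply: eq_bigr => j _.
by rewrite cosB.
Qed.

Lemma sqr_sum_cos_le (N : nat) (z : nat -> R) (phi : R) :
  (\sum_(i < N) cos (z i - phi)) ^+ 2 <= \sum_(i < N) \sum_(j < N) cos (z i - z j).
Proof.
rewrite sum_cos_sub.
have -> : \sum_(i < N) cos (z i - phi) =
    cos phi * (\sum_(i < N) cos (z i)) + sin phi * (\sum_(i < N) sin (z i)).
  rewrite !mulr_sumr -big_split /=; apply: eq_bigr => i _.
  by rewrite cosB mulrC [sin _ * sin _]mulrC.
have := cos2Dsin2 phi; move: (cos phi) (sin phi) => c s cs.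
set C := \sum_(i < N) _; set S := \sum_(i < N) _.
rewrite -[leRHS]mul1r -cs -subr_ge0.
have -> : (c ^+ 2 + s ^+ 2) * (C ^+ 2 + S ^+ 2) - (c * C + s * S) ^+ 2 =
  (c * S - s * C) ^+ 2 by ring.
exact: sqr_ge0.
Qed.

(** [M] times the Fejer kernel of order [M]. *)
Definition fejer (M : nat) u : R :=
  \sum_(a < M) \sum_(a' < M) cos (2 * pi * ((a%:R - a'%:R) * u)).

Let fejerE M u : fejer M u = (\sum_(a < M) cos (2 * pi * (a%:R * u))) ^+ 2
  + (\sum_(a < M) sin (2 * pi * (a%:R * u))) ^+ 2.
Proof.
rewrite -(sum_cos_sub _ (fun a => 2 * pi * (a%:R * u))).
by apply: eq_bigr => a _; apply: eq_bigr => a' _; congr cos; ring.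
Qed.

Lemma fejer_ge0 M u : 0 <= fejer M u.
Proof. by rewrite fejerE addr_ge0 ?sqr_ge0. Qed.

Lemma cosD_2piM (z : R) (k : nat) : cos (z + 2 * pi * k%:R) = cos z.
Proof.
rewrite -(periodicn (@cosD2pi R) k z); congr cos; rewrite -mulr_natr -[pi *+ 2]mulr_natl; ring.
Qed.

Lemma sinD_2piM (z : R) (k : nat) : sin (z + 2 * pi * k%:R) = sin z.
Proof.
rewrite -(periodicn (@sinD2pi R) k z); congr sin; rewrite -mulr_natr -[pi *+ 2]mulr_natl; ring.
Qed.

Lemma fejerDn M u n : fejer M (u + n%:R) = fejer M u.
Proof.
have shift a : 2 * pi * (a%:R * (u + n%:R)) = 2 * pi * (a%:R * u) + 2 * pi * (a * n)%:R :> R.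
  by rewrite natrM; ring.
rewrite !fejerE; congr (_ ^+ 2 + _ ^+ 2); apply: eq_bigr => a _; rewrite shift.
  exact: cosD_2piM.
exact: sinD_2piM.
Qed.

(** Telescoping with the factor 2 sin makes sums along arithmetic progressions
    explicit. *)
Lemma sin_sum_cos (n : nat) (phi th : R) :
  2 * sin th * (\sum_(j < n) cos (phi + j%:R * (2 * th))) =
  sin (phi + (2 * n%:R - 1) * th) - sin (phi - th).
Proof.
elim: n => [|n IH]; first by rewrite big_ord0 mulr0 mulr0 sub0r mulN1r subrr.
rewrite big_ord_recr /= mulrDr IH -[n.+1%:R]natr1.
have -> : phi + (2 * (n%:R + 1) - 1) * th = (phi + n%:R * (2 * th)) + th by ring.
have -> : phi + (2 * n%:R - 1) * th = (phi + n%:R * (2 * th)) - th by ring.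
set X := phi + n%:R * (2 * th).
by rewrite (sinD X th) (sinB X th); ring.
Qed.

Lemma sin_sum_sin (n : nat) (phi th : R) :
  2 * sin th * (\sum_(j < n) sin (phi + j%:R * (2 * th))) =
  cos (phi - th) - cos (phi + (2 * n%:R - 1) * th).
Proof.
elim: n => [|n IH]; first by rewrite big_ord0 mulr0 mulr0 sub0r mulN1r subrr.
rewrite big_ord_recr /= mulrDr IH -[n.+1%:R]natr1.
have -> : phi + (2 * (n%:R + 1) - 1) * th = (phi + n%:R * (2 * th)) + th by ring.
have -> : phi + (2 * n%:R - 1) * th = (phi + n%:R * (2 * th)) - th by ring.
set X := phi + n%:R * (2 * th).
by rewrite (cosD X th) (cosB X th); ring.
Qed.

Lemma sum_cos_roots (M c : nat) (phi : R) : (0 < c < M)%N ->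
  \sum_(j < M) cos (phi + j%:R * (2 * (pi * (c%:R / M%:R)))) = 0.
Proof.
move=> /andP[c0 cM]; have M0 : 0 < M%:R :> R by rewrite ltr0n (leq_ltn_trans _ cM).
set th := pi * _.
have sth : sin th != 0.
  have cM0 : 0 < c%:R / M%:R :> R by rewrite divr_gt0 // ltr0n.
  have cM1 : c%:R / M%:R < 1 :> R by rewrite ltr_pdivrMr // mul1r ltr_nat.
  have pi0 := pi_gt0 R.
  rewrite gt_eqF // sin_gt0_pi // mulr_gt0 //=.
  by rewrite -[ltRHS]mulr1 ltr_pM2l.
have two : (2 : R) != 0 by rewrite pnatr_eq0.
apply: (mulfI (mulf_neq0 two sth)).
rewrite sin_sum_cos mulr0.
have -> : phi + (2 * M%:R - 1) * th = (phi - th) + 2 * pi * c%:R.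
  by rewrite /th; field; rewrite gt_eqF.
by rewrite sinD_2piM subrr.
Qed.

(** Averaging over the [M]-th roots of unity kills all nonzero frequencies below
    [M]. *)
Lemma sum_fejer (M : nat) u : (0 < M)%N ->
  \sum_(r < M) fejer M (u - r%:R / M%:R) = M%:R ^+ 2.
Proof.
move=> M0; have MR : M%:R != 0 :> R by rewrite pnatr_eq0 -lt0n.
rewrite /fejer exchange_big /=.
rewrite (eq_bigr (fun _ => M%:R)); last first.
  move=> a _; rewrite exchange_big /= (bigD1 a) //= [X in _ + X]big1 ?addr0; last first.
    move=> a' a'a; have [lt_a|gt_a|/val_inj eq_a] := ltngtP a' a; last by rewrite eq_a eqxx in a'a.
      have c0 : (0 < a - a' < M)%N.
        by rewrite subn_gt0 lt_a (leq_ltn_trans (leq_subr _ _)).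
      rewrite -[RHS](sum_cos_roots (- (2 * pi * ((a%:R - a'%:R) * u))) c0).
      apply: eq_bigr => r _; rewrite -[LHS]cosN; congr cos.
      by rewrite natrB ?(ltnW lt_a) //; field.
    have c0 : (0 < a' - a < M)%N.
      by rewrite subn_gt0 gt_a (leq_ltn_trans (leq_subr _ _)).
    rewrite -[RHS](sum_cos_roots (2 * pi * ((a%:R - a'%:R) * u)) c0).
    apply: eq_bigr => r _; congr cos.
    by rewrite natrB ?(ltnW gt_a) //; field.
  rewrite (eq_bigr (fun=> 1)); first by rewrite sumr_const card_ord.
  by move=> r _; rewrite subrr mul0r mulr0 cos0.
by rewrite sumr_const card_ord expr2 mulr_natr.
Qed.

Lemma fejer_sin (M : nat) u : sin (pi * u) ^+ 2 * fejer M u <= 2.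
Proof.
have bnd (x y z : R) : -1 <= x <= 1 -> -1 <= y <= 1 -> 2 * z = x - y -> z ^+ 2 <= 1.
  move=> /andP[x1 x2] /andP[y1 y2] E.
  have z1 : -1 <= z by lra.
  have z2 : z <= 1 by lra.
  nra.
have sin1 (z : R) : -1 <= sin z <= 1 by rewrite sin_geN1 sin_le1.
have cos1 (z : R) : -1 <= cos z <= 1 by rewrite cos_geN1 cos_le1.
have HC := sin_sum_cos M 0 (pi * u); have HS := sin_sum_sin M 0 (pi * u).
rewrite -mulrA in HC; rewrite -mulrA in HS.
have := bnd _ _ _ (sin1 _) (sin1 _) HC; have := bnd _ _ _ (cos1 _) (cos1 _) HS.
rewrite fejerE mulrDr -!exprMn => S1 C1.
rewrite (_ : 2 = 1 + 1 :> R); last by ring.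
apply: lerD; [move: C1 | move: S1]; congr (_ <= 1); congr ((_ * _) ^+ 2);
  by apply: eq_bigr => a _; congr (_ _); ring.
Qed.

Lemma sinMn_le (n : nat) (z : R) : `|sin (n%:R * z)| <= n%:R * `|sin z|.
Proof.
elim: n => [|n IH]; first by rewrite !mul0r sin0 normr0.
rewrite -[n.+1%:R]natr1 !mulrDl !mul1r sinD; apply: le_trans (ler_normD _ _) _.
have cos1 (t : R) : `|cos t| <= 1 by rewrite ler_norml cos_geN1 cos_le1.
apply: lerD; rewrite normrM.
  by apply: le_trans IH; rewrite ler_piMr.
by rewrite ler_piMl.
Qed.

(** Away from the integers the sine is bounded below; comparing with the multiple
    [pi / 2] of the argument avoids any convexity. *)
Lemma sin_ge_inv (n : nat) u : (0 < n)%N ->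
  (2 * n%:R)^-1 <= u <= 1 - (2 * n%:R)^-1 -> n%:R^-1 <= sin (pi * u).
Proof.
move=> n0; have nR : 0 < n%:R :> R by rewrite ltr0n.
set d : R := (2 * n%:R)^-1.
have d0 : 0 < d by rewrite invr_gt0 mulr_gt0.
have d1 : d <= 2^-1.
  by rewrite lef_pV2 ?posrE ?mulr_gt0 // ler_peMr // ler1n.
have pi0 := pi_gt0 R.
have base : n%:R^-1 <= sin (pi * d).
  have := sinMn_le n (pi * d).
  have -> : n%:R * (pi * d) = pi / 2 by rewrite /d; field; rewrite gt_eqF.
  rewrite sin_pihalf normr1 ger0_norm; last first.
    apply: sin_ge0_pi; rewrite mulr_ge0 ?(ltW pi0) ?(ltW d0) //=.
    by rewrite -[leRHS]mulr1 ler_wpM2l ?(ltW pi0) //; lra.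
  by rewrite -ler_pdivrMl // mulr1.
have low (v : R) : d <= v -> v <= 2^-1 -> n%:R^-1 <= sin (pi * v).
  move=> dv v2; apply: (le_trans base).
  have dom (t : R) : 0 < t -> t <= 2^-1 -> pi * t \in `[- (pi / 2), pi / 2].
    move=> t0 t2; rewrite in_itv /=; apply/andP; split.
      apply: (@le_trans _ _ 0); last by rewrite mulr_ge0 ?(ltW pi0) ?(ltW t0).
      by rewrite oppr_le0; rewrite divr_ge0 ?(ltW pi0).
    by rewrite ler_wpM2l ?(ltW pi0).
  move: (dv); rewrite le_eqVlt => /orP[/eqP <- //|dlt].
  by rewrite ltW // ltr_sin ?dom ?(lt_trans d0 dlt) // ltr_pM2l.
move=> /andP[du ud]; case: (leP u 2^-1) => u2; first exact: low.
have -> : sin (pi * u) = sin (pi * (1 - u)).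
  by rewrite mulrBr mulr1 sinB sinpi cospi mul0r mulN1r sub0r opprK.
by apply: low; lra.
Qed.

Lemma fejer_le (M n : nat) u : (0 < n)%N ->
  (2 * n%:R)^-1 <= u <= 1 - (2 * n%:R)^-1 -> fejer M u <= 2 * n%:R ^+ 2.
Proof.
move=> n0 /(sin_ge_inv n0) sn; have nR : 0 < n%:R :> R by rewrite ltr0n.
have := fejer_sin M u; have F0 := fejer_ge0 M u.
have sn2 : (n%:R ^+ 2)^-1 <= sin (pi * u) ^+ 2.
  by rewrite -exprVn lerXn2r // nnegrE ?invr_ge0 ?ltW // (lt_le_trans _ sn) ?invr_gt0.
move=> H; rewrite -ler_pdivrMr ?exprn_gt0 // mulrC.
exact: le_trans (ler_wpM2r F0 sn2) H.
Qed.

(** The translates of the kernel by the grid points near the cell of a digit form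
    a majorant of the indicator of that cell, up to a small relative error: all
    the translates add up to a constant, and those centred away from the cell are
    small on it. *)
Lemma fejer_cell (b g g0 n T : nat) (th : R) (d : nat) :
  (0 < b)%N -> (0 < g0)%N -> (0 < n)%N -> (g + 2 * g0 <= b * g)%N ->
  (b * g <= 2 * n * g0)%N -> (d < b)%N ->
  T%:R + d%:R / b%:R <= th -> th < T%:R + d.+1%:R / b%:R ->
  (b * g)%:R ^+ 2 - (b * g)%:R * (2 * n%:R ^+ 2) <=
  \sum_(r < g + 2 * g0) fejer (b * g) (th - ((d * g)%:R + r%:R - g0%:R) / (b * g)%:R).
Proof.
move=> b0 g00 n0 + + db lo up; set M := (b * g)%N => gM Mn.
have M0 : (0 < M)%N by apply: leq_trans gM; lia.
have MR : 0 < M%:R :> R by rewrite ltr0n.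
have nR : 0 < n%:R :> R by rewrite ltr0n.
have bR : 0 < b%:R :> R by rewrite ltr0n.
have gR : 0 < g%:R :> R by move: M0; rewrite /M muln_gt0 ltr0n => /andP[].
rewrite lerBlDr -(sum_fejer (th - ((d * g)%:R - g0%:R) / M%:R) M0).
pose F r := fejer M (th - ((d * g)%:R + r%:R - g0%:R) / M%:R).
rewrite (eq_bigr (fun r : 'I_M => F r)); last first.
  by move=> r _; congr fejer; field; rewrite gt_eqF.
rewrite -/(F _) -(big_mkord predT F) (big_cat_nat (n := (g + 2 * g0)%N)) //=.
rewrite big_mkord lerD2l.
apply: (@le_trans _ _ (\sum_(g + 2 * g0 <= r < M) (2 * n%:R ^+ 2))); last first.
  rewrite sumr_const_nat -[leLHS]mulr_natl ler_wpM2r //.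
  by rewrite ler_nat leq_subr.
rewrite big_nat_cond [leRHS]big_nat_cond; apply: ler_sum => r /andP[/andP[gr rM] _].
(* moving the argument into the unit interval *)
have -> : F r = fejer M (th - T%:R - ((d * g)%:R + r%:R - g0%:R) / M%:R + 1).
  set c := (_ / M%:R); rewrite /F -/c.
  transitivity (fejer M (th - T%:R - c)); last by rewrite -[LHS](fejerDn M _ 1).
  by rewrite -[RHS](fejerDn M _ T); congr fejer; ring.
apply: fejer_le => //.
set v := (th - T%:R) * M%:R - (d * g)%:R.
have v0 : 0 <= v.
  rewrite /v /M !natrM subr_ge0 mulrA ler_wpM2r ?(ltW gR) // -ler_pdivrMr //; lra.
have vg : v < g%:R.
  have vlt : (th - T%:R) * b%:R < d.+1%:R by rewrite -ltr_pdivlMr //; lra.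
  rewrite /v /M !natrM ltrBlDr mulrA -[X in _ < X + _]mul1r -mulrDl ltr_pM2r //.
  by rewrite [1 + _]addrC natr1.
have -> : th - T%:R - ((d * g)%:R + r%:R - g0%:R) / M%:R + 1 =
    (v + g0%:R + (M%:R - r%:R)) / M%:R by rewrite /v; field; rewrite gt_eqF.
have g0M : (2 * n%:R)^-1 <= g0%:R / M%:R :> R.
  rewrite ler_pdivlMr // mulrC ler_pdivrMr ?mulr_gt0 // -!natrM ler_nat mulnC //.
have rR : r%:R + 1 <= M%:R :> R by rewrite natr1 ler_nat.
have grR : g%:R + 2 * g0%:R <= r%:R :> R by rewrite -natrM -natrD ler_nat.
apply/andP; split.
  apply: (le_trans g0M); rewrite ler_wpM2r ?invr_ge0 ?(ltW MR) //; lra.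
apply: (@le_trans _ _ (1 - g0%:R / M%:R)); last by rewrite lerD2l lerN2.
rewrite ler_pdivrMr // mulrBl mul1r divfK ?gt_eqF //; lra.
Qed.

End Fejer.

(** * Digit counts and exponential sums *)

Definition digit_count (b d N A : nat) : nat := \sum_(j < N) ((A %/ b ^ j) %% b == d).

Section DigitCounts.
Variable R : realType.
Local Notation fejer := (@fejer R).

(** The squared modulus of the exponential sum over [h * b ^ i * x], expanded. *)
Definition weyl (N h b : nat) (x : R) : R :=
  \sum_(i < N) \sum_(j < N) cos (2 * pi * (h%:R * (b%:R ^+ i - b%:R ^+ j) * x)).

Lemma weyl_ge0 N h b x : 0 <= weyl N h b x.
Proof.
have -> : weyl N h b x = \sum_(i < N) \sum_(j < N)
    cos (2 * pi * (h%:R * b%:R ^+ i * x) - 2 * pi * (h%:R * b%:R ^+ j * x)).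
  by apply: eq_bigr => i _; apply: eq_bigr => j _; congr cos; ring.
rewrite (sum_cos_sub _ (fun i => 2 * pi * (h%:R * b%:R ^+ i * x))).
by rewrite addr_ge0 // sqr_ge0.
Qed.

Lemma digit_count_trunc (b d N : nat) (x : R) : (0 < b)%N -> 0 <= x ->
  digit_count b d N (Num.trunc (b%:R ^+ N * x)) =
  (\sum_(i < N) (Num.trunc (b%:R ^+ i.+1 * x) %% b == d)%N)%N.
Proof.
move=> b0 x0; rewrite /digit_count (reindex_inj rev_ord_inj) /=.
apply: eq_bigr => i _; congr (nat_of_bool (_ %% b == d)%N).
rewrite -{1}(subnK (ltn_ord i)) exprD -mulrA trunc_divX //.
by rewrite mulr_ge0 // exprn_ge0.
Qed.

(** Expanding the kernels, equal frequencies give the main term, and any two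
    different ones give an exponential sum up to a phase. *)
Lemma sum_fejer_le (M N b rho : nat) (B x : R) (c : nat -> R) :
  0 <= B ->
  (forall h, (0 < h < M)%N -> weyl N h b x <= B ^+ 2) ->
  \sum_(i < N) \sum_(r < rho) fejer M (b%:R ^+ i * x - c r) <=
  rho%:R * (M%:R * N%:R + M%:R ^+ 2 * B).
Proof.
move=> B0 weylB.
have offdiag (a a' : nat) (z : R) : (a < M)%N -> (a' < a)%N ->
    \sum_(i < N) cos (2 * pi * ((a%:R - a'%:R) * (b%:R ^+ i * x - z))) <= B.
  move=> aM a'a; have h0 : (0 < a - a' < M)%N.
    by rewrite subn_gt0 a'a (leq_ltn_trans (leq_subr _ _)).
  have := weylB _ h0; rewrite /weyl.
  pose zz i : R := 2 * pi * ((a%:R - a'%:R) * (b%:R ^+ i * x)).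
  have := sqr_sum_cos_le N zz (2 * pi * ((a%:R - a'%:R) * z)).
  have -> : \sum_(i < N) \sum_(j < N) cos (zz i - zz j) = \sum_(i < N) \sum_(j < N)
      cos (2 * pi * ((a - a')%:R * (b%:R ^+ i - b%:R ^+ j) * x)).
    apply: eq_bigr => i _; apply: eq_bigr => j _; rewrite natrB ?(ltnW a'a) //.
    by congr cos; rewrite /zz; ring.
  have -> : \sum_(i < N) cos (zz i - 2 * pi * ((a%:R - a'%:R) * z)) =
      \sum_(i < N) cos (2 * pi * ((a%:R - a'%:R) * (b%:R ^+ i * x - z))).
    by apply: eq_bigr => i _; congr cos; rewrite /zz; ring.
  move=> H1 H2; have := le_trans H1 H2.
  move: (\sum_(i < N) _) => C CB; rewrite leNgt; apply/negP => BC.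
  by nra.
rewrite exchange_big /=.
apply: (@le_trans _ _ (\sum_(r < rho) (M%:R * N%:R + M%:R ^+ 2 * B))); last first.
  by rewrite sumr_const card_ord -[leLHS]mulr_natl.
apply: ler_sum => r _; rewrite /fejer exchange_big /=.
apply: (@le_trans _ _ (\sum_(a < M) (N%:R + M%:R * B))); last first.
  by rewrite sumr_const card_ord -[leLHS]mulr_natl mulrDr expr2 mulrA.
apply: ler_sum => a _; rewrite exchange_big /=.
rewrite (bigD1 a) //=; apply: lerD.
  rewrite (eq_bigr (fun=> 1)); first by rewrite sumr_const card_ord.
  by move=> i _; rewrite subrr mul0r mulr0 cos0.
apply: (@le_trans _ _ (\sum_(a' < M | a' != a) B)).
  apply: ler_sum => a' a'a.
  have [lt_a|gt_a|/val_inj eq_a] := ltngtP a' a; last by rewrite eq_a eqxx in a'a.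
    exact: offdiag.
  apply: le_trans (offdiag _ _ (c r) (ltn_ord a') gt_a); rewrite le_eqVlt; apply/orP; left.
  by apply/eqP; apply: eq_bigr => i _; rewrite -cosN; congr cos; ring.
rewrite sumr_const -[leLHS]mulr_natl ler_wpM2r // ler_nat.
by rewrite -[X in (_ <= X)%N]card_ord max_card.
Qed.

(** Arithmetic of the majorant: with [q ^ 5] grid points per digit, [q ^ 4] extra
    ones on each side and exponential sums below [N / q ^ 7], all the losses
    together stay below the allowed excess [10 / q]. *)
Lemma excess_contradiction (b q N D : R) :
  3 <= b -> b <= q -> 0 <= N -> 0 <= D -> N * (q + 10 * b) < b * q * D ->
  D * ((b * q ^+ 5) ^+ 2 - b * q ^+ 5 * (2 * (b * q) ^+ 2)) <=
  (q ^+ 5 + 2 * q ^+ 4) * (b * q ^+ 5 * N + (b * q ^+ 5) ^+ 2 * (N / q ^+ 7)) ->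
  False.
Proof.
move=> b3R bqR N0 D0 big' H.
have q0 : 0 < q by lra.
have {}H : D * b * (q ^+ 3 - 2 * b) <= N * (q + 2) * (q ^+ 2 + b).
  have P0 : 0 < b * q ^+ 7 by rewrite mulr_gt0 ?exprn_gt0 //; lra.
  rewrite -(ler_pM2r P0).
  move: H; congr (_ <= _); first by ring.
  by field; rewrite gt_eqF.
have q3R : 3 <= q by lra.
have L0 : 0 < q ^+ 3 - 2 * b by nra.
have H1 : N * (q + 10 * b) * (q ^+ 3 - 2 * b) < b * q * D * (q ^+ 3 - 2 * b).
  by rewrite ltr_pM2r.
have H2 : b * q * D * (q ^+ 3 - 2 * b) <= q * (N * (q + 2) * (q ^+ 2 + b)).
  by rewrite -[X in X <= _](_ : q * (D * b * (q ^+ 3 - 2 * b)) = _) ?ler_pM2l //; ring.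
have : N * (q + 10 * b) * (q ^+ 3 - 2 * b) < q * (N * (q + 2) * (q ^+ 2 + b)).
  exact: lt_le_trans H1 H2.
have -> : q * (N * (q + 2) * (q ^+ 2 + b)) = N * (q * (q + 2) * (q ^+ 2 + b)) by ring.
rewrite -mulrA => H3; move: (H3); rewrite ltNge => /negP; apply.
apply: ler_wpM2l => //.
have bq2 : b * b <= b * q by nra.
have q2 : 9 <= q * q by nra.
have bq3 : b * q * 9 <= b * q * (q * q) by apply: ler_wpM2l => //; nra.
have bq4 : b * (q * q) * 3 <= b * (q * q) * q by apply: ler_wpM2l => //; nra.
have bq5 : 3 * (q * q * q) <= b * (q * q * q) by apply: ler_wpM2r => //; nra.
lra.
Qed.

(** Quantitative form of Weyl's criterion for one digit: an excess of the digit
    [d] over its expected frequency by a fixed amount forces a large exponential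
    sum with a small frequency. *)
Lemma digit_count_weyl (b q N d : nat) (x : R) :
  (3 <= b <= q)%N -> (d < b)%N -> 0 <= x ->
  (N * (q + 10 * b) < b * q * digit_count b d N (Num.trunc (b%:R ^+ N * x)))%N ->
  exists2 h, (0 < h < b * q ^ 5)%N & (N%:R / q%:R ^+ 7) ^+ 2 < weyl N h b x.
Proof.
move=> /andP[b3 bq] db x0; set D := digit_count _ _ _ _ => big.
have b0 : (0 < b)%N by lia.
have q3 : (3 <= q)%N by lia.
have q0 : 0 < q%:R :> R by rewrite ltr0n; lia.
apply: contrapT => nbig; set M := (b * q ^ 5)%N.
set B : R := N%:R / q%:R ^+ 7.
have weylB h : (0 < h < M)%N -> weyl N h b x <= B ^+ 2.
  move=> hM; rewrite leNgt; apply/negP => lt_h; apply: nbig.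
  by exists h.
have B0 : 0 <= B by rewrite divr_ge0 // exprn_ge0 // ltW.
pose rho := (q ^ 5 + 2 * q ^ 4)%N.
pose c r : R := ((d * q ^ 5)%:R + r%:R - (q ^ 4)%:R) / M%:R.
have up := sum_fejer_le rho c B0 weylB.
set low : R := M%:R ^+ 2 - M%:R * (2 * (b * q)%:R ^+ 2).
have lo : D%:R * low <= \sum_(i < N) \sum_(r < rho) fejer M (b%:R ^+ i * x - c r).
  rewrite /D digit_count_trunc // natr_sum mulr_suml; apply: ler_sum => i _.
  case: eqP => [digit_d|_]; last first.
    by rewrite mul0r; apply: sumr_ge0 => r _; exact: fejer_ge0.
  rewrite mul1r.
  have th0 : 0 <= b%:R ^+ i * x by rewrite mulr_ge0 // exprn_ge0.
  have bR : 0 < b%:R :> R by rewrite ltr0n.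
  set a := Num.trunc (b%:R ^+ i.+1 * x) in digit_d.
  have aE : a = ((a %/ b) * b + d)%N by rewrite {1}(divn_eq a b) digit_d.
  have /andP[alo aup] : a%:R <= b%:R * (b%:R ^+ i * x) < a.+1%:R.
    by rewrite mulrA -exprS; apply: truncn_itv; rewrite exprS -mulrA mulr_ge0.
  apply: (@fejer_cell _ b (q ^ 5) (q ^ 4) (b * q) (a %/ b)) => //.
  - by rewrite expn_gt0; lia.
  - by rewrite muln_gt0 b0; lia.
  - by rewrite !expnS expn0; nia.
  - by rewrite !expnS expn0; nia.
  - rewrite -(ler_pM2l bR) mulrDr [b%:R * (d%:R / _)]mulrCA divff ?gt_eqF // mulr1.
    by rewrite -natrM mulnC -natrD -aE.
  - rewrite -(ltr_pM2l bR) mulrDr [b%:R * (d.+1%:R / _)]mulrCA divff ?gt_eqF // mulr1.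
    by rewrite -natrM mulnC -natrD addnS -aE.
have H := le_trans lo up.
have big' : N%:R * (q%:R + 10 * b%:R) < b%:R * q%:R * D%:R :> R.
  by move: big; rewrite -(ltr_nat R) !natrM natrD natrM.
have b3R : 3 <= b%:R :> R by rewrite (ler_nat R 3).
have bqR : b%:R <= q%:R :> R by rewrite ler_nat.
have N0 : 0 <= N%:R :> R by [].
have D0 : 0 <= D%:R :> R by [].
have MR : M%:R = b%:R * q%:R ^+ 5 :> R by rewrite natrM natrX.
have rhoR : rho%:R = q%:R ^+ 5 + 2 * q%:R ^+ 4 :> R by rewrite natrD natrM !natrX.
move: H; rewrite /low rhoR MR /B natrM.
move=> H; exact: (excess_contradiction b3R bqR N0 D0 big' H).
Qed.

End DigitCounts.

(** * Random completions of a binary prefix *)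

(** The completions by [n] further binary digits of the prefix [m] of length [t],
    with multiplicity: places outside the set [s] receive the digit 0 twice, so
    that all completions have weight [2 ^- n]. *)
Fixpoint leaves (s : nat -> bool) (n t m : nat) : seq nat :=
  if n is n'.+1
  then leaves s n' t.+1 (2 * m) ++ leaves s n' t.+1 (2 * m + s t.+1)
  else [:: m].

Lemma size_leaves s n t m : size (leaves s n t m) = (2 ^ n)%N.
Proof. by elim: n t m => //= n IH t m; rewrite size_cat !IH expnS mul2n addnn. Qed.

(** The digits of [N] places are tested in all bases up to [q], for [q + 1] values
    of [N] that subdivide the interval from [2 ^ k] to [2 ^ k.+1]. *)
Definition grid (q k i : nat) : nat := (2 ^ k + (i * 2 ^ k) %/ q)%N.

Definition excess (b d q N A : nat) : bool :=
  (N * (q + 10 * b) < b * q * digit_count b d N A)%N.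

(** [A N b] stands for the integer part of [b ^ N] times a number known only up to
    a truncation error; adding [e] accounts for the carry that this error may
    cause. *)
Definition bad (q k : nat) (A : nat -> nat -> nat) : bool :=
  [exists i : 'I_q.+1, exists b : 'I_q.+1, exists d : 'I_b, exists e : 'I_2,
    [&& odd b, (3 <= b)%N & excess b d q (grid q k i) (A (grid q k i) b + e)]].

Section Leaves.
Variable R : realType.
Implicit Types (x y : R) (s : nat -> bool).

Lemma sum_leavesS s n t m (f : nat -> R) :
  \sum_(u <- leaves s n.+1 t m) f u =
  \sum_(u <- leaves s n t.+1 (2 * m)) f u +
  \sum_(u <- leaves s n t.+1 (2 * m + s t.+1)) f u.
Proof. by rewrite /= big_cat. Qed.

(** Each random digit contributes one cosine factor and a phase, because
    cos (X - t) + cos (X + t) = 2 cos X cos t. *)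
Lemma sum_leaves_cos s n t (al : R) : exists psi : R, forall m (phi : R),
  \sum_(u <- leaves s n t m) cos (phi + 2 * pi * (al * u%:R / 2 ^+ (t + n))) =
  2 ^+ n * cos (phi + 2 * pi * (al * m%:R / 2 ^+ t) + psi) *
  \prod_(t.+1 <= p < (t + n).+1) cos (pi * ((s p)%:R * al / 2 ^+ p)).
Proof.
elim: n t => [|n IH] t.
  by exists 0 => m phi; rewrite big_seq1 addn0 big_geq // mulr1 mul1r addr0.
have [psi IHpsi] := IH t.+1; pose th : R := pi * ((s t.+1)%:R * al / 2 ^+ t.+1).
exists (th + psi) => m phi; rewrite sum_leavesS -addSnnS !IHpsi.
rewrite [in RHS]big_ltn ?ltnS ?leq_addr // -/th -!mulrDl.
set P := \prod_(_ <= p < _) _.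
have p2 : (2 : R) ^+ t != 0 by rewrite expf_neq0.
pose X := phi + 2 * pi * (al * m%:R / 2 ^+ t) + (th + psi).
have -> : phi + 2 * pi * (al * (2 * m)%:R / 2 ^+ t.+1) + psi = X - th.
  by rewrite /X natrM exprS; field.
have -> : phi + 2 * pi * (al * (2 * m + s t.+1)%:R / 2 ^+ t.+1) + psi = X + th.
  by rewrite /X /th natrD natrM exprS; field.
by rewrite -/X (cosD X th) (cosB X th) [2 ^+ n.+1]exprS; ring.
Qed.

Lemma norm_sum_leaves_cos s n t m (al phi : R) :
  `|\sum_(u <- leaves s n t m) cos (phi + 2 * pi * (al * u%:R / 2 ^+ (t + n)))| <=
  2 ^+ n * corr s t (t + n) al.
Proof.
have [psi ->] := sum_leaves_cos s n t al.
rewrite !normrM ger0_norm ?exprn_ge0 // normr_prod -mulrA ler_wpM2l ?exprn_ge0 //.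
rewrite ler_piMl ?corr_ge0 //; last by rewrite ler_norml cos_geN1 cos_le1.
Qed.

Lemma mean_weyl s n t m (N h b : nat) y :
  \sum_(u <- leaves s n t m) weyl N h b (y + u%:R / 2 ^+ (t + n)) <=
  2 ^+ n * \sum_(i < N) \sum_(j < N)
    corr s t (t + n) (h%:R * (b%:R ^+ i - b%:R ^+ j)).
Proof.
rewrite /weyl exchange_big /= mulr_sumr; apply: ler_sum => i _.
rewrite exchange_big /= mulr_sumr; apply: ler_sum => j _.
set al := h%:R * _.
apply: le_trans (norm_sum_leaves_cos s n t m al (2 * pi * (al * y))).
apply: le_trans (ler_norm _); rewrite le_eqVlt; apply/orP; left; apply/eqP.
by apply: eq_bigr => u _; congr cos; rewrite -!mulrA; ring.
Qed.

Lemma truncDn x (n : nat) : 0 <= x -> Num.trunc (x + n%:R) = (Num.trunc x + n)%N.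
Proof.
move=> x0; apply: truncn_def; have /andP[lo up] := truncn_itv x0.
by rewrite -addSn !natrD lerD2r ltrD2r lo up.
Qed.

Lemma le_sum_term (I : finType) (P : pred I) (F : I -> R) (i : I) (c : R) :
  P i -> (forall j, 0 <= F j) -> c <= F i -> c <= \sum_(j | P j) F j.
Proof.
move=> Pi F0 cF; rewrite (bigD1 i) //= -[c]addr0; apply: lerD => //.
exact: sumr_ge0.
Qed.

Definition shifted_weyl q k i b e h y : R :=
  (q%:R ^+ 7 / (grid q k i)%:R) ^+ 2 *
  weyl (grid q k i) h b (y + e%:R / b%:R ^+ grid q k i).

(** A bad event makes one of the normalised exponential sums at least 1, and all
    of them are nonnegative. *)
Lemma bad_le_weyl q k y : 0 <= y ->
  (bad q k (fun N b => Num.trunc (b%:R ^+ N * y)))%:R <=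
  \sum_(i < q.+1) \sum_(b < q.+1 | odd b && (3 <= b)%N) \sum_(e < 2)
    \sum_(1 <= h < b * q ^ 5) shifted_weyl q k i b e h y.
Proof.
move=> y0.
have sw0 i b e h : 0 <= shifted_weyl q k i b e h y.
  by rewrite mulr_ge0 ?sqr_ge0 ?weyl_ge0.
case: (boolP (bad _ _ _)) => [|_]; last first.
  by do 3 (apply: sumr_ge0 => ? _); apply: sumr_ge0.
move=> /existsP[i /existsP[b /existsP[d /existsP[e /and3P[ob b3 ex]]]]].
have bq : (3 <= b <= q)%N by rewrite b3 -ltnS ltn_ord.
have b0 : (0 < b)%N by exact: leq_trans b3.
have q0 : (0 < q)%N by case/andP: bq; lia.
set N := grid q k i in ex.
have N0 : 0 < N%:R :> R by rewrite ltr0n addn_gt0 expn_gt0.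
have bN : 0 < b%:R ^+ N :> R by rewrite exprn_gt0 // ltr0n.
have y'0 : 0 <= y + e%:R / b%:R ^+ N by rewrite addr_ge0 // divr_ge0 // ltW.
have ex' : (N * (q + 10 * b) < b * q *
    digit_count b d N (Num.trunc (b%:R ^+ N * (y + e%:R / b%:R ^+ N))))%N.
  rewrite mulrDr [_ * (e%:R / _)]mulrC divfK ?gt_eqF // truncDn //.
  by rewrite mulr_ge0 // ltW.
have [h /andP[h0 hM] big] := digit_count_weyl bq (ltn_ord d) y'0 ex'.
have gt1 : 1 <= shifted_weyl q k i b e h y.
  rewrite /shifted_weyl -/N; set W := weyl _ _ _ _ in big *.
  have -> : (q%:R ^+ 7 / N%:R) ^+ 2 = ((N%:R / q%:R ^+ 7) ^+ 2)^-1 :> R.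
    by rewrite -exprVn invf_div.
  rewrite mulrC ler_pdivlMr ?mul1r ?ltW //.
  by rewrite exprn_gt0 // divr_gt0 // exprn_gt0 // ltr0n.
apply: (le_trans gt1).
apply: (@le_sum_term _ _ _ i) => // [j|].
  by do 2 (apply: sumr_ge0 => ? _); apply: sumr_ge0.
apply: (@le_sum_term _ _ _ b); first by rewrite ob.
  by move=> j; do 1 (apply: sumr_ge0 => ? _); apply: sumr_ge0.
apply: (@le_sum_term _ _ _ e) => // [j|]; first exact: sumr_ge0.
rewrite (bigD1_seq h) ?mem_index_iota ?h0 ?iota_uniq //= lerDl.
exact: sumr_ge0.
Qed.

(** Chebyshev's inequality, summed over the tests. *)
Lemma mean_bad s (q k n t m l Z : nat) y :
  0 <= y -> (0 < q)%N -> (t <= k)%N -> (l <= k)%N ->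
  (forall b h, (3 <= b <= q)%N -> (0 < h < q ^ 6)%N ->
     (logn 2 h + 2 * sqr_level b + l + k <= t + n)%N /\
     forall a, (a <= t + logn 2 h + 2 * sqr_level b + l + 1)%N ->
       (Z <= \sum_(a <= p < a + (k - t)) s p)%N) ->
  \sum_(u <- leaves s n t m)
    (bad q k (fun N b => Num.trunc (b%:R ^+ N * (y + u%:R / 2 ^+ (t + n)))))%:R <=
  2 ^+ n * (32 * q%:R ^+ 22 * ((3 / 4) ^+ Z + (2 ^+ l)^-1)) :> R.
Proof.
move=> y0 q0 tk lk window; pose E : R := (3 / 4) ^+ Z + (2 ^+ l)^-1; rewrite -/E.
have E0 : 0 <= E by rewrite addr_ge0 ?exprn_ge0 ?invr_ge0 ?exprn_ge0 //; lra.
have y'0 u : 0 <= y + u%:R / 2 ^+ (t + n) by rewrite addr_ge0 // divr_ge0 // exprn_ge0.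
apply: (le_trans (ler_sum _ (fun u _ => bad_le_weyl q k (y'0 u)))).
rewrite exchange_big /=.
pose c1 : R := 2 ^+ n * (4 * q%:R ^+ 14 * E).
have c10 : 0 <= c1 by rewrite !mulr_ge0 ?exprn_ge0.
have q1 : 1 <= q%:R :> R by rewrite ler1n.
have term (i b e h : nat) : (i < q.+1)%N -> (b < q.+1)%N -> odd b -> (3 <= b)%N ->
    (1 <= h < b * q ^ 5)%N ->
    \sum_(u <- leaves s n t m)
      shifted_weyl q k i b e h (y + u%:R / 2 ^+ (t + n)) <= c1.
  move=> iq bq ob b3 /andP[h0 hM]; rewrite /shifted_weyl -mulr_sumr.
  set N := grid q k i; set c := e%:R / _.
  have N0 : 0 < N%:R :> R by rewrite ltr0n addn_gt0 expn_gt0.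
  have bq' : (3 <= b <= q)%N by rewrite b3.
  have h6 : (0 < h < q ^ 6)%N.
    by rewrite h0 (leq_trans hM) // [leqRHS]expnS leq_mul2r -ltnS bq orbT.
  have [hK hw] := window b h bq' h6.
  have kN : (2 ^ k <= N <= 2 ^ k.+1)%N.
    rewrite leq_addr /= expnS mul2n -addnn leq_add2l.
    by rewrite -{2}(mulKn (2 ^ k) q0) leq_div2r // leq_mul2r -ltnS iq orbT.
  have b1 : (1 < b)%N by exact: leq_trans b3.
  have := @sum_corr_pairs R b b1 ob s t (t + n) k N h l Z h0 kN tk lk hK hw.
  rewrite -/E => second.
  have := mean_weyl s n t m N h b (y + c); set mean := \sum_(u <- _) _ => mean_le.
  have -> : \sum_(u <- leaves s n t m) weyl N h b (y + u%:R / 2 ^+ (t + n) + c) = mean.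
    by apply: eq_bigr => u _; rewrite addrAC.
  have mean_le' : mean <= 2 ^+ n * (4 * N%:R ^+ 2 * E).
    by apply: (le_trans mean_le); rewrite ler_wpM2l // exprn_ge0.
  apply: (le_trans (ler_wpM2l (sqr_ge0 _) mean_le')).
  rewrite le_eqVlt; apply/orP; left; apply/eqP; rewrite /c1.
  by field; rewrite gt_eqF.
apply: (@le_trans _ _ (\sum_(i < q.+1) \sum_(b < q.+1) \sum_(e < 2) (q ^ 6)%:R * c1)).
  apply: ler_sum => i _; rewrite exchange_big /= big_mkcond /=; apply: ler_sum => b _.
  case: ifP => [/andP[ob b3]|_]; last first.
    by apply: sumr_ge0 => e _; rewrite mulr_ge0.
  rewrite exchange_big /=; apply: ler_sum => e _; rewrite exchange_big /=.
  apply: (@le_trans _ _ (\sum_(1 <= h < b * q ^ 5) c1)).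
    rewrite big_nat_cond [leRHS]big_nat_cond; apply: ler_sum => h /andP[hM _].
    exact: term.
  rewrite sumr_const_nat -[leLHS]mulr_natl ler_wpM2r // ler_nat.
  by rewrite (leq_trans (leq_subr _ _)) // [leqRHS]expnS leq_mul2r -ltnS ltn_ord orbT.
rewrite !sumr_const !card_ord -!mulrnA -[leLHS]mulr_natl natrX.
have -> : 2 ^+ n * (32 * q%:R ^+ 22 * E) = 8 * q%:R ^+ 2 * (q%:R ^+ 6 * c1).
  by rewrite /c1; ring.
rewrite ler_wpM2r ?mulr_ge0 ?exprn_ge0 //.
rewrite -natrX -natrM ler_nat !mulSn mul0n; nia.
Qed.

End Leaves.

(** * Windows of sparse sets *)

(** The precision tends to infinity so slowly that its fortieth power stays below
    [log2 k]. Counting the admissible values is visibly primitive recursive. *)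
Definition qlevel (k : nat) : nat := (\sum_(j < k) (2 ^ (j.+1 ^ 40) <= k))%N.

Lemma sum_downward (P : nat -> bool) (n : nat) :
  (forall i j, (i <= j)%N -> P j -> P i) ->
  forall j, (j < \sum_(i < n) P i)%N -> P j.
Proof.
move=> down j; apply: contraTT => nPj; rewrite -leqNgt.
have -> : (\sum_(i < n) P i = \sum_(i < n | (i < j)%N) P i)%N.
  rewrite (bigID (fun i : 'I_n => (i < j)%N)) /= [X in (_ + X)%N]big1 ?addn0 //.
  move=> i; rewrite -leqNgt => ji; case Pi: (P i) => //.
  by rewrite (down _ _ ji Pi) in nPj.
apply: (@leq_trans (\sum_(i < n | (i < j)%N) 1)%N); first by apply: leq_sum => i _; case: (P i).
rewrite -(big_mkord (fun i => (i < j)%N) (fun=> 1%N)).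
have [nj|jn] := leqP n j.
  apply: leq_trans nj; rewrite big_mkcond /=.
  apply: (@leq_trans (\sum_(0 <= i < n) 1)%N); last by rewrite sum_nat_const_nat muln1 subn0.
  by apply: leq_sum => i _; case: ifP.
rewrite (big_cat_nat (n := j)) ?(ltnW jn) //= [X in (_ + X)%N]big_nat_cond.
rewrite [X in (_ + X)%N]big1 ?addn0; last first.
  by move=> i /andP[/andP[ji _] ij]; rewrite ltnNge ji in ij.
rewrite big_mkcond /=.
apply: (@leq_trans (\sum_(0 <= i < j) 1)%N); last by rewrite sum_nat_const_nat muln1 subn0.
by apply: leq_sum => i _; case: ifP.
Qed.

Lemma qlevel_le k : (0 < k)%N -> (2 ^ (qlevel k ^ 40) <= k)%N.
Proof.
move=> k0; case Eq: (qlevel k) => [|q]; first by rewrite exp0n.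
have down i j : (i <= j)%N -> (2 ^ (j.+1 ^ 40) <= k)%N -> (2 ^ (i.+1 ^ 40) <= k)%N.
  by move=> ij; apply: leq_trans; rewrite leq_exp2l // leq_exp2r.
apply: (@sum_downward (fun j => 2 ^ (j.+1 ^ 40) <= k)%N k down q).
by rewrite -/(qlevel k) Eq.
Qed.

Lemma qlevel_ge j k : (2 ^ (j ^ 40) <= k)%N -> (j <= qlevel k)%N.
Proof.
move=> jk; have jle : (j <= k)%N.
  apply: leq_trans jk; apply: leq_trans (ltnW (ltn_expl _ (ltnSn 1))).
  by case: (posnP j) => [->//|j0]; rewrite -[X in (X <= _)%N]expn1 leq_pexp2l.
rewrite /qlevel -(big_mkord predT (fun j => (2 ^ (j.+1 ^ 40) <= k)%N : nat)).
rewrite (big_cat_nat (n := j)) //; apply: leq_trans (leq_addr _ _).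
rewrite -{1}[j]muln1 -{1}(subn0 j) -sum_nat_const_nat.
rewrite big_nat_cond [leqRHS]big_nat_cond; apply: leq_sum => i /andP[/andP[_ ij] _].
by rewrite (leq_trans _ jk) // leq_exp2l // leq_exp2r.
Qed.

Section Sparse.
Variable R : realType.

Lemma limn_einf_gt1 (u : (\bar R)^nat) : (1 < limn_einf u)%E ->
  exists n0, forall n, (n0 <= n)%N -> (1 < u n)%E.
Proof.
rewrite limn_einf_lim (cvg_lim _ (@cvg_einfs_sup R u)) // => sup1.
have [n0 gt1] : exists n0, (1 < einfs u n0)%E.
  apply: contrapT => none; have := sup1; apply/negP; rewrite -leNgt.
  apply: ub_ereal_sup => _ [n _ <-]; rewrite leNgt; apply/negP => gt1.
  by apply: none; exists n.
exists n0 => n n0n; apply: lt_le_trans gt1 _.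
by apply: ereal_inf_lbound; exists n.
Qed.

Lemma ln2_ge_half : 2^-1 <= ln 2 :> R.
Proof.
have := @le_ln1Dx R (- 2^-1); rewrite (_ : 1 - 2^-1 = 2^-1 :> R); last by field.
rewrite lnV ?posrE // => /(_ _); move=> /(_ ltac:(lra)); lra.
Qed.

Lemma sparse_windows (S : set nat) (rho : R) : sparsity_exponent S rho ->
  exists k0, forall k a, (k0 <= k)%N -> (a%:R : R) <= k%:R `^ rho ->
    30%:R * ln k%:R < (count_in S a (a + k))%:R :> R.
Proof.
move=> [rho0 /= /limn_einf_gt1[n0 gt1]]; exists (maxn n0 2) => k a.
rewrite geq_max => /andP[nk k2] ak.
have ln0 : 0 < 30%:R * ln k%:R :> R.
  by rewrite mulr_gt0 // ln_gt0 // (ltr_nat R 1).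
rewrite -[ltLHS]mul1r -ltr_pdivlMr // -lte_fin.
apply: lt_le_trans (gt1 k nk) _.
by apply: ereal_inf_lbound; exists a.
Qed.

(** The same with the logarithm replaced by the binary length [L] and the power
    [k ^ rho] by a linear function of [L]. *)
Lemma sparse_binary (S : set nat) (rho : R) : sparsity_exponent S rho ->
  exists L0, forall L k a, (L0 <= L)%N -> (2 ^ L.-1 <= k)%N -> (a <= 8 * L + 9)%N ->
    (15 * L.-1 <= count_in S a (a + k))%N.
Proof.
move=> Srho; have rho0 := Srho.1; have [k0 H] := sparse_windows Srho.
have [L1 L1P] : exists L1 : nat, forall L, (L1 <= L)%N ->
    (8 * L.+1 + 9)%:R <= (rho * ln 2 * L%:R) ^+ 2 / 2 :> R.
  have c0 : 0 < (rho * ln 2) ^+ 2 / 2.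
    by rewrite divr_gt0 // exprn_gt0 // mulr_gt0 // ln_gt0 // ltr1n.
  exists (Num.trunc (25 / ((rho * ln 2) ^+ 2 / 2))).+1 => L LL.
  have Lge : 25 / ((rho * ln 2) ^+ 2 / 2) <= L%:R.
    apply: le_trans (ltW (truncnS_gt _)) _; by rewrite ler_nat.
  have L1 : 1 <= L%:R :> R by rewrite ler1n; exact: leq_ltn_trans LL.
  rewrite exprMn mulrAC expr2; rewrite ler_pdivrMr // in Lge.
  rewrite [leRHS](_ : _ = L%:R * (L%:R * ((rho * ln 2) ^+ 2 / 2))); last by ring.
  apply: (@le_trans _ _ (L%:R * 25)); last by rewrite ler_wpM2l.
  by rewrite natrD natrM -natr1; lra.
exists (maxn k0 L1).+1 => [[|L]] k a //; rewrite ltnS geq_max => /andP[k0L L1L] /= Lk aL.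
have kL : (k0 <= k)%N by apply: leq_trans k0L (leq_trans (ltnW (ltn_expl _ _)) Lk).
have k1 : 0 < k%:R :> R by rewrite ltr0n (leq_trans _ Lk) // expn_gt0.
have lnk : ln 2 * L%:R <= ln k%:R :> R.
  rewrite mulr_natr -lnXn // ler_ln ?posrE ?exprn_gt0 // -natrX ler_nat //.
have ln20 : 0 < ln 2 :> R by apply: lt_le_trans ln2_ge_half; rewrite invr_gt0.
have ak : (a%:R : R) <= k%:R `^ rho.
  rewrite /powR gt_eqF //; apply: (@le_trans _ _ (expR (rho * ln 2 * L%:R))); last first.
    by rewrite ler_expR -mulrA ler_wpM2l // ltW.
  have x0 : 0 <= rho * ln 2 * L%:R by rewrite !mulr_ge0 // ltW.
  apply: le_trans (expR_ge1Dxn 1 x0); rewrite -[leLHS]add0r; apply: lerD => //.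
  by apply: le_trans (L1P L L1L); rewrite ler_nat.
rewrite -(ler_nat R); apply/ltW; apply: le_lt_trans (H k a kL ak); rewrite natrM.
have L0 : 0 <= L%:R :> R by []; have := ln2_ge_half.
move: (ln 2) (ln k%:R) L%:R lnk L0 => c x l; nra.
Qed.

End Sparse.

(** * Probability of the bad events *)

(** [2 ^ horizon k] exceeds [b ^ N] for all bases [b] and lengths [N] tested at
    stage [k], so this many binary digits decide the [k]-th event. *)
Definition horizon (k : nat) : nat := (k * 2 ^ k.+1)%N.

Section BadProbability.
Variable R : realType.

(** The constant 30 in the sparsity condition makes [15 * L.-1] places active.
    Since (3 / 4) ^ 5 is less than 1 / 4, both terms decay faster than [k ^ -2],
    even after multiplication by a power of [q]. *)
Lemma decay_bound (L k q : nat) :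
  (5 <= L)%N -> (k < 2 ^ L.+1)%N -> (0 < k)%N -> (q ^ 40 <= L)%N -> (0 < q)%N ->
  32 * q%:R ^+ 22 * ((3 / 4) ^+ (15 * L.-1) + (2 ^+ (4 * L + 8))^-1) <=
  (k%:R * k.+1%:R)^-1 :> R.
Proof.
move=> L5 kL k0 qL q0.
have kk : k%:R * k.+1%:R <= (2 ^+ (2 * L + 2)) :> R.
  rewrite -natrM -natrX ler_nat (_ : (2 * L + 2 = L.+1 + L.+1)%N); last by lia.
  by rewrite expnD leq_mul // ltnW.
have kk0 : 0 < k%:R * k.+1%:R :> R by rewrite -natrM ltr0n muln_gt0 k0.
apply: (@le_trans _ _ (2 ^+ (2 * L + 2))^-1); last by rewrite lef_pV2 ?posrE ?exprn_gt0.
have q22 : q%:R ^+ 22 <= 2 ^+ L :> R.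
  rewrite -!natrX ler_nat; apply: leq_trans (ltnW (ltn_expl L (ltnSn 1))).
  by apply: leq_trans qL; rewrite leq_pexp2l.
have decay : (3 / 4) ^+ (15 * L.-1) <= (2 ^+ (6 * L.-1))^-1 :> R.
  rewrite (_ : (15 * L.-1 = 5 * (3 * L.-1))%N); last by lia.
  rewrite (_ : (6 * L.-1 = 2 * (3 * L.-1))%N); last by lia.
  rewrite [leLHS]exprM [in leRHS]exprM -exprVn; apply: lerXn2r.
  - by rewrite nnegrE; apply: exprn_ge0; lra.
  - by rewrite nnegrE invr_ge0 exprn_ge0.
  - have -> : (3 / 4) ^+ 5 = 243 / 1024 :> R by field.
    have -> : (2 ^+ 2)^-1 = 1 / 4 :> R by field.
    lra.
have p2 n : 0 < 2 ^+ n :> R by rewrite exprn_gt0.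
have -> : (2 ^+ (2 * L + 2))^-1 = (2 ^+ (2 * L + 3))^-1 + (2 ^+ (2 * L + 3))^-1 :> R.
  have -> : 2 ^+ (2 * L + 3) = 2 * 2 ^+ (2 * L + 2) :> R by rewrite -exprS -addnS.
  by field; rewrite gt_eqF.
have c22 : 32 * q%:R ^+ 22 <= 2 ^+ (5 + L) :> R.
  by rewrite exprD (_ : 2 ^+ 5 = 32 :> R) ?ler_wpM2l //; ring.
have pow_le a c d : (a + d <= c)%N -> 2 ^+ a * (2 ^+ c)^-1 <= (2 ^+ d)^-1 :> R.
  move=> acd; rewrite ler_pdivrMr // mulrC ler_pdivlMr // -exprD.
  by rewrite ler_eXn2l // ltr1n.
rewrite mulrDr; apply: lerD.
  apply: (@le_trans _ _ (2 ^+ (5 + L) * (2 ^+ (6 * L.-1))^-1)); last by apply: pow_le; lia.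
  have r0 : 0 <= (3 / 4) ^+ (15 * L.-1) :> R by apply: exprn_ge0; lra.
  by apply: ler_pM => //; rewrite mulr_ge0 // exprn_ge0.
apply: (@le_trans _ _ (2 ^+ (5 + L) * (2 ^+ (4 * L + 8))^-1)); last by apply: pow_le; lia.
by rewrite ler_wpM2r // invr_ge0 exprn_ge0.
Qed.

Lemma logn2_le n : (logn 2 n <= n)%N.
Proof.
case: (posnP n) => [->|n0]; first by rewrite logn0.
have := dvdn_leq n0 (pfactor_dvdnn 2 n); apply: leq_trans.
exact: ltnW (ltn_expl _ _).
Qed.

(** The probability of the [k]-th bad event is summable in [k], uniformly in a
    fixed prefix of length at most [log2 k] and in a fixed background number [y]. *)
Theorem bad_probability (S : set nat) (rho : R) : sparsity_exponent S rho ->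
  exists k0, forall k t m n (y : R), (k0 <= k)%N -> (2 ^ t <= k)%N ->
    (t + n = horizon k)%N -> 0 <= y ->
    \sum_(u <- leaves (fun p => p \in S) n t m)
      (bad (qlevel k) k (fun N b =>
        Num.trunc (b%:R ^+ N * (y + u%:R / 2 ^+ horizon k))))%:R <=
    2 ^+ n * (k%:R * k.+1%:R)^-1 :> R.
Proof.
move=> /sparse_binary[L0 windows]; exists (2 ^ (maxn L0 10))%N => k t m n y k0k tk tn y0.
set L := trunc_log 2 k.
have k_gt0 : (0 < k)%N by apply: leq_trans k0k; rewrite expn_gt0.
have /andP[Lk kL] := @trunc_log_bounds 2 k isT k_gt0; rewrite -/L in Lk kL.
have LL : (maxn L0 10 <= L)%N by exact: trunc_log_max.
have [L0L L10] : (L0 <= L)%N /\ (10 <= L)%N by move: LL; rewrite geq_max => /andP.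
have tL : (t <= L)%N by exact: trunc_log_max.
have qL : (qlevel k ^ 40 <= L)%N by apply: trunc_log_max => //; exact: qlevel_le.
have q0 : (0 < qlevel k)%N.
  by apply: qlevel_ge; rewrite exp1n; apply: leq_trans Lk; rewrite leq_exp2l //; lia.
have LLk : (9 * L + 9 <= k)%N.
  apply: leq_trans Lk; move: L10; clear; elim: L => // L IH; rewrite leq_eqVlt.
  by case/orP => [/eqP <- //|L10]; have := IH L10; rewrite expnS; lia.
apply: le_trans (ler_wpM2l _ (decay_bound _ kL k_gt0 qL q0)); rewrite ?exprn_ge0 //; last by lia.
rewrite -tn; apply: mean_bad => //; [lia | lia |].
move=> b h /andP[b3 bq] /andP[h0 hq].
set q := qlevel k in qL q0 bq hq *.
have q6 : (q ^ 6 <= L)%N by apply: leq_trans qL; rewrite leq_pexp2l.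
have q2 : (q ^ 2 <= L)%N by apply: leq_trans qL; rewrite leq_pexp2l.
have lh : (logn 2 h <= L)%N by apply: leq_trans (logn2_le h) _; lia.
have lb : (sqr_level b <= L)%N.
  apply: leq_trans (logn2_le _) _; apply: leq_trans (leq_subr _ _) _.
  by apply: leq_trans q2; rewrite leq_exp2r.
split.
  rewrite tn /horizon; apply: (@leq_trans (k * 4)); first by lia.
  by rewrite leq_mul2l -[4%N]/(2 ^ 2)%N leq_exp2l //; lia.
move=> a aL; have -> : (a + (k - t) = (a + (k - t).-1).+1)%N by lia.
apply: (windows L (k - t).-1 a) => //; last by lia.
have : (2 ^ L = 2 ^ L.-1 + 2 ^ L.-1)%N by rewrite addnn -mul2n -expnS prednK //; lia.
have dbl j : (9 <= j)%N -> (2 * j <= 2 ^ j)%N.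
  elim: j => // j IH; rewrite leq_eqVlt => /orP[/eqP <- //|j9].
  by have := IH j9; rewrite expnS; lia.
have := dbl L.-1.
lia.
Qed.

End BadProbability.

(** * Greedy choice of binary digits *)

Lemma horizon_mono i j : (i <= j)%N -> (horizon i <= horizon j)%N.
Proof. by move=> ij; rewrite /horizon leq_mul // leq_exp2l. Qed.

Lemma horizon_ge k : (k <= horizon k)%N.
Proof. by rewrite /horizon leq_pmulr // expn_gt0. Qed.

Lemma leaves_div s n t m u : u \in leaves s n t m -> (u %/ 2 ^ n)%N = m.
Proof.
elim: n t m => [|n IH] t m /=; first by rewrite inE divn1 => /eqP.
rewrite expnSr divnMA mem_cat => /orP[] /IH ->.
  by rewrite mulKn.
by rewrite mulnC divnMDl // divn_small ?addn0 //; case: (s _).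
Qed.

Lemma sum_leaves_extend s n n' t m (f : nat -> nat) :
  (\sum_(u <- leaves s (n + n') t m) f (u %/ 2 ^ n') =
   2 ^ n' * \sum_(u <- leaves s n t m) f u)%N.
Proof.
elim: n t m => [|n IH] t m; last by rewrite addSn /= !big_cat /= !IH mulnDr.
rewrite add0n big_seq1 (eq_big_seq (fun=> f m)); last by move=> u /leaves_div ->.
by rewrite big_const_seq count_predT size_leaves iter_addn_0 mulnC.
Qed.

Section Derandomization.
Variables (s : nat -> bool) (E : nat -> nat -> bool).

Definition common_horizon (t : nat) : nat := horizon (2 ^ t).

(** Expected number, in units of [2 ^- (common_horizon t - t)], of bad events with
    index between [2 ^ tau] and [2 ^ t] for a random completion of the prefix. *)
Definition potential (tau t m : nat) : nat :=
  (\sum_(u <- leaves s (common_horizon t - t) t m)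
     \sum_(2 ^ tau <= k < 2 ^ t) E k (u %/ 2 ^ (common_horizon t - horizon k)))%N.

(** The expected number of the events considered so far leaves room for [2 ^- t],
    the bound on the total probability of all the later ones. *)
Definition good (tau t m : nat) : bool :=
  (2 ^ t * potential tau t m + 2 ^ (common_horizon t - t) <
   2 ^ t * 2 ^ (common_horizon t - t))%N.

(** Digits are zero up to place [tau], and from then on the first digit that keeps
    the prefix good. *)
Fixpoint good_prefix (tau t : nat) : nat :=
  if t is t'.+1 then
    let m := (2 * good_prefix tau t')%N in
    if (t <= tau)%N || good tau t m then m else (m + s t)%N
  else 0%N.

Variable k0 : nat.
Hypothesis E_rare : forall k t m n, (k0 <= k)%N -> (2 ^ t <= k)%N ->
  (t + n = horizon k)%N ->
  ((\sum_(u <- leaves s n t m) E k u) * (k * k.+1) <= 2 ^ n)%N.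

Lemma sum_inv_range (m n : nat) : (0 < m)%N -> (m <= n)%N ->
  \sum_(m <= k < n) (k * k.+1)%:R^-1 = m%:R^-1 - n%:R^-1 :> rat.
Proof.
move=> m0 /subnKC <-; elim: (n - m)%N => [|i IH].
  by rewrite addn0 big_geq // subrr.
rewrite addnS big_nat_recr ?leq_addr //= IH natrM.
have x0 : 0 < (m + i)%:R :> rat by rewrite ltr0n addn_gt0 m0.
have -> : (m + i).+1%:R = (m + i)%:R + 1 :> rat by rewrite natr1.
have y0 : (m%:R : rat) != 0 by rewrite pnatr_eq0 -lt0n.
move: (_ + _)%:R x0 => x x0.
by field; rewrite y0 !gt_eqF // addr_gt0.
Qed.

Definition mean_potential (tau t m : nat) : rat :=
  (potential tau t m)%:R / 2 ^+ (common_horizon t - t).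

Lemma goodE tau t m : good tau t m = (mean_potential tau t m + (2 ^+ t)^-1 < 1).
Proof.
have p2 n : 0 < 2 ^+ n :> rat by rewrite exprn_gt0.
rewrite /good -(ltr_nat rat) natrD !natrM !natrX /mean_potential.
have P0 := p2 t; have Q0 := p2 (common_horizon t - t)%N.
rewrite -[RHS](ltr_pM2r (mulr_gt0 P0 Q0)).
move: (2 ^+ t : rat) (2 ^+ (common_horizon t - t) : rat) P0 Q0 => P Q P0 Q0.
by rewrite mul1r; congr (_ < _); field; rewrite !gt_eqF.
Qed.

Lemma common_horizon_ge t : (t <= common_horizon t)%N.
Proof. exact: leq_trans (ltnW (ltn_expl _ _)) (horizon_ge _). Qed.

(** Averaging over the next digit does not change the probabilities of the old
    events, and the new ones have total probability at most [2 ^- t.+1]. *)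
Lemma mean_potential_children tau t m : (k0 <= 2 ^ tau)%N -> (tau <= t)%N ->
  mean_potential tau t.+1 (2 * m) + mean_potential tau t.+1 (2 * m + s t.+1) <=
  2 * (mean_potential tau t m + (2 ^+ t.+1)^-1).
Proof.
move=> k0tau taut; set H := common_horizon t; set H' := common_horizon t.+1.
have HH' : (H <= H')%N by apply: horizon_mono; rewrite leq_exp2l.
have tH : (t <= H)%N := common_horizon_ge t.
have tH' : (t < H')%N := common_horizon_ge t.+1.
have p2 n : 0 < 2 ^+ n :> rat by rewrite exprn_gt0.
have tau_t : (2 ^ tau <= 2 ^ t)%N by rewrite leq_exp2l.
have tS : (2 ^ t <= 2 ^ t.+1)%N by rewrite leq_exp2l.
pose cnt k n := (\sum_(u <- leaves s n t m) E k (u %/ 2 ^ (t + n - horizon k)))%N.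
have cnt_extend k n n' : (horizon k <= t + n)%N -> cnt k (n + n')%N = (2 ^ n' * cnt k n)%N.
  move=> kn; rewrite /cnt -sum_leaves_extend; apply: eq_bigr => u _.
  by rewrite -divnMA -expnD (_ : (t + (n + n') - horizon k = n' + (t + n - horizon k))%N) //; lia.
have children : (potential tau t.+1 (2 * m) + potential tau t.+1 (2 * m + s t.+1) =
    \sum_(2 ^ tau <= k < 2 ^ t.+1) cnt k (H' - t))%N.
  rewrite /potential -/H' -big_cat /= -/(leaves s (H' - t.+1).+1 t m) -subSn //.
  by rewrite exchange_big /= /cnt subnKC // ltnW.
have old : (\sum_(2 ^ tau <= k < 2 ^ t) cnt k (H' - t) =
    2 ^ (H' - H) * potential tau t m)%N.
  rewrite /potential -/H [X in (_ = _ * X)%N]exchange_big /= big_distrr /=.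
  rewrite big_nat_cond [RHS]big_nat_cond; apply: eq_bigr => k /andP[/andP[_ kt] _].
  have kH : (horizon k <= t + (H - t))%N by rewrite subnKC //; apply/horizon_mono/ltnW.
  rewrite (_ : (H' - t = H - t + (H' - H))%N); last by lia.
  by rewrite cnt_extend // /cnt subnKC.
have new k : (2 ^ t <= k)%N -> (k < 2 ^ t.+1)%N ->
    (cnt k (H' - t)%N)%:R <= 2 ^+ (H' - t) * (k * k.+1)%:R^-1 :> rat.
  move=> tk kt; have tk' : (t <= horizon k)%N.
    by apply: leq_trans (horizon_ge k); apply: leq_trans (ltnW (ltn_expl _ _)) tk.
  have kH : (horizon k <= H')%N by apply/horizon_mono/ltnW.
  have k_gt0 : (0 < k)%N by apply: leq_trans tk; rewrite expn_gt0.
  rewrite (_ : (H' - t = horizon k - t + (H' - horizon k))%N); last by lia.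
  rewrite cnt_extend; last by rewrite subnKC.
  rewrite ler_pdivlMr ?ltr0n ?muln_gt0 ?k_gt0 // -natrX -natrM ler_nat.
  rewrite -mulnA expnD mulnC leq_mul2r; apply/orP; right.
  rewrite /cnt subnKC // subnn; under eq_bigr do rewrite divn1.
  by apply: E_rare; rewrite ?subnKC // (leq_trans k0tau) // (leq_trans tau_t).
rewrite /mean_potential -/H -/H' -mulrDl -natrD children (big_cat_nat (n := (2 ^ t)%N)) //= old natrD.
set new_sum := (\sum_(2 ^ t <= k < 2 ^ t.+1) _)%N.
have new_le : new_sum%:R <= 2 ^+ (H' - t) * (2 ^+ t.+1)^-1 :> rat.
  rewrite /new_sum natr_sum; apply: (@le_trans _ _
      (\sum_(2 ^ t <= k < 2 ^ t.+1) (2 ^+ (H' - t) * (k * k.+1)%:R^-1 : rat))).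
    rewrite big_nat_cond [leRHS]big_nat_cond; apply: ler_sum => k /andP[/andP[tk kt] _].
    exact: new.
  rewrite -mulr_sumr sum_inv_range ?expn_gt0 // !natrX ler_wpM2l ?(ltW (p2 _)) //.
  by rewrite exprS invfM; lra.
rewrite natrM natrX mulrDl.
have e1 : 2 ^+ (H' - t.+1) = 2 ^+ (H' - H) * 2 ^+ (H - t) / 2 :> rat.
  rewrite -exprD (_ : (H' - H + (H - t) = (H' - t.+1).+1)%N); last by lia.
  by rewrite exprS; field.
have e2 : 2 ^+ (H' - t) = 2 * 2 ^+ (H' - t.+1) :> rat.
  by rewrite -exprS; congr (_ ^+ _); lia.
rewrite e2 in new_le.
have {}new_le : new_sum%:R / 2 ^+ (H' - t.+1) <= 2 * (2 ^+ t.+1)^-1 :> rat.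
  by rewrite ler_pdivrMr // mulrAC.
have -> : 2 ^+ (H' - H) * (potential tau t m)%:R / 2 ^+ (H' - t.+1) =
    2 * mean_potential tau t m :> rat.
  have P0 := p2 (H' - H)%N; have Q0 := p2 (H - t)%N; rewrite e1 /mean_potential -/H.
  by field; rewrite !gt_eqF.
by rewrite mulrDr lerD2l.
Qed.

Lemma good_child tau t m : (k0 <= 2 ^ tau)%N -> (tau <= t)%N -> good tau t m ->
  ~~ good tau t.+1 (2 * m) -> good tau t.+1 (2 * m + s t.+1).
Proof.
move=> k0tau taut; rewrite !goodE -leNgt => gm bad0.
have := mean_potential_children m k0tau taut; rewrite exprS invfM in bad0 *; lra.
Qed.

Lemma good_prefix_good tau t : (k0 <= 2 ^ tau)%N -> (0 < tau)%N -> (tau <= t)%N ->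
  good tau t (good_prefix tau t).
Proof.
move=> k0tau tau0; elim: t => [|t IH]; first by case: tau tau0 {k0tau}.
rewrite leq_eqVlt => /orP[/eqP Etau | taut].
  rewrite goodE /mean_potential /potential big1; last by move=> u _; rewrite Etau big_geq.
  by rewrite mul0r add0r invf_lt1 ?exprn_gt0 // -natrX ltr1n exp_gt1.
rewrite /= leqNgt taut /=; case: ifP => // /negbT bad0.
by apply: good_child => //; exact: IH.
Qed.

(** At time [horizon k] the [k]-th event is decided, so its occurrence would
    contribute a full unit to the expectation. *)
Lemma good_prefix_avoids tau k : (k0 <= 2 ^ tau)%N -> (0 < tau)%N ->
  (2 ^ tau <= k)%N -> ~~ E k (good_prefix tau (horizon k)).
Proof.
move=> k0tau tau0 tauk; set t := horizon k; set m := good_prefix tau t.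
have tk : (k <= t)%N := horizon_ge k.
have taut : (tau <= t)%N.
  by apply: leq_trans tk; apply: leq_trans tauk; exact: ltnW (ltn_expl _ _).
have := good_prefix_good k0tau tau0 taut; rewrite -/m /good.
apply: contraTN => Ek; rewrite -leqNgt; apply: leq_trans (leq_addr _ _).
rewrite leq_mul2l; apply/orP; right; rewrite /potential.
rewrite -[X in (X <= _)%N]muln1 -(size_leaves s _ t m) -sum1_size big_distrl /=.
rewrite big_seq [leqRHS]big_seq; apply: leq_sum => u /leaves_div um; rewrite mul1n.
have kt : (k < 2 ^ t)%N by apply: leq_ltn_trans tk (ltn_expl _ _).
rewrite (bigD1_seq k) ?mem_index_iota ?tauk ?iota_uniq //=.
by rewrite -/t um Ek leq_addr.
Qed.

End Derandomization.

(** * Computability of the greedy choice *)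

(** The digits of [v] after a prefix of length [t], erased in the places outside [s]. *)
Definition mask (s : nat -> bool) (n t v : nat) : nat :=
  (\sum_(j < n) s (t + n - j) * ((v %/ 2 ^ j) %% 2) * 2 ^ j)%N.

Lemma mask_low s n t v : (v < 2 ^ n)%N -> mask s n.+1 t v = mask s n t.+1 v.
Proof.
move=> vn; rewrite /mask big_ord_recr /= divn_small // mod0n muln0 mul0n addn0.
by apply: eq_bigr => j _; rewrite addnS addSn.
Qed.

Lemma mask_high s n t v : (v < 2 ^ n)%N ->
  mask s n.+1 t (v + 2 ^ n) = (s t.+1 * 2 ^ n + mask s n t.+1 v)%N.
Proof.
move=> vn; rewrite /mask big_ord_recr /= addnC; congr (_ + _)%N.
  rewrite -[X in (v + X)%N]mul1n divnDMl ?expn_gt0 // divn_small // addnS subSn ?leq_addl //.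
  by rewrite addnK add0n modn_small // muln1.
apply: eq_bigr => j _; rewrite addnS addSn.
have -> : (2 ^ n = 2 ^ (n - j) * 2 ^ j)%N by rewrite -expnD subnK // ltnW.
rewrite divnDMl ?expn_gt0 // (_ : (2 ^ (n - j) = 2 ^ (n - j).-1 * 2)%N).
  by rewrite -modnDmr modnMl addn0.
by rewrite -expnSr prednK // subn_gt0.
Qed.

(** Unlike the recursion over the tree of completions, a sum over a range is
    evidently computable. *)
Lemma sum_leaves_mask s n t m (f : nat -> nat) :
  (\sum_(u <- leaves s n t m) f u = \sum_(v < 2 ^ n) f (m * 2 ^ n + mask s n t v))%N.
Proof.
elim: n t m => [|n IH] t m.
  by rewrite big_seq1 expn0 big_ord1 /mask big_ord0 muln1 addn0.
have E2 : (2 ^ n.+1 = 2 ^ n + 2 ^ n)%N by rewrite expnS mul2n addnn.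
rewrite [leaves _ _ _ _]/(_ ++ _) big_cat /= !IH E2 big_split_ord.
congr (_ + _)%N; apply: eq_bigr => v _; congr f.
  by rewrite /= mask_low //; lia.
by rewrite /= [(2 ^ n + v)%N]addnC mask_high //; lia.
Qed.

(** The bad event for the number [m / 2 ^ horizon k], in integer arithmetic. *)
Definition bad_dyadic (k m : nat) : bool :=
  bad (qlevel k) k (fun N b => (b ^ N * m) %/ 2 ^ horizon k)%N.

(** Syntax-directed application of the closure properties; sums and quantifiers,
    whose bodies need higher-order unification, are left to the user. *)
Ltac auto_computable :=
  match goal with
  | H : computable _ |- _ => exact H
  | H : computable _ |- _ => exact (computable_weaken H)
  | H : computable _ |- _ => exact (computable_weaken (computable_weaken H))
  | H : computable _ |- _ =>
      exact (computable_weaken (computable_weaken (computable_weaken H)))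
  | H : computable _ |- _ =>
      exact (computable_weaken (computable_weaken (computable_weaken (computable_weaken H))))
  | |- computable (fun v => ?k) => exact (computable_const _ k)
  | |- _ => exact (@computable_thead _)
  | |- _ => exact (computable_weaken (@computable_thead _))
  | |- _ => exact (computable_weaken (computable_weaken (@computable_thead _)))
  | |- _ =>
      exact (computable_weaken (computable_weaken (computable_weaken (@computable_thead _))))
  | |- computable (fun v => addn (@?a v) (@?b v)) => apply: (@computableD _ a b); auto_computable
  | |- computable (fun v => subn (@?a v) (@?b v)) => apply: (@computableB _ a b); auto_computable
  | |- computable (fun v => muln (@?a v) (@?b v)) => apply: (@computableM _ a b); auto_computable
  | |- computable (fun v => expn (@?a v) (@?b v)) => apply: (@computableX _ a b); auto_computable
  | |- computable (fun v => divn (@?a v) (@?b v)) => apply: (@computable_divn _ a b); auto_computable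
  | |- computable (fun v => modn (@?a v) (@?b v)) => apply: (@computable_modn _ a b); auto_computable
  | |- computable (fun v => S (@?a v)) => apply: (@computableS _ a); auto_computable
  | |- computable (fun v => nat_of_bool (leq (@?a v) (@?b v))) =>
      apply: (@computable_leq _ a b); auto_computable
  | |- computable (fun v => nat_of_bool (@eq_op _ (@?a v) (@?b v))) =>
      apply: (@computable_eq _ a b); auto_computable
  | |- computable (fun v => nat_of_bool (andb (@?a v) (@?b v))) =>
      apply: (@computable_and _ a b); auto_computable
  | |- computable (fun v => nat_of_bool (negb (@?a v))) =>
      apply: (@computable_neg _ a); auto_computable
  | |- _ => idtac
  end.

Section ComputablePrefix.

Lemma computable_digit_count n (b d N A : n.-tuple nat -> nat) :
  computable b -> computable d -> computable N -> computable A ->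
  computable (fun v => digit_count (b v) (d v) (N v) (A v)).
Proof.
move=> cb cd cN cA.
apply: (@computable_sum _ N (fun v j => ((A v %/ b v ^ j) %% b v == d v)%N : nat)).
  by auto_computable.
auto_computable.
Qed.

Lemma computable_excess n (b d q N A : n.-tuple nat -> nat) :
  computable b -> computable d -> computable q -> computable N -> computable A ->
  computable (fun v => nat_of_bool (excess (b v) (d v) (q v) (N v) (A v))).
Proof.
move=> cb cd cq cN cA; rewrite /excess.
have cD := computable_digit_count cb cd cN cA.
auto_computable.
Qed.

Lemma computable_qlevel n (k : n.-tuple nat -> nat) :
  computable k -> computable (fun v => qlevel (k v)).
Proof.
move=> ck.
apply: (@computable_sum _ k (fun v j => (2 ^ (j.+1 ^ 40) <= k v)%N : nat)) => //.
auto_computable.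
Qed.

Lemma computable_horizon n (k : n.-tuple nat -> nat) :
  computable k -> computable (fun v => horizon (k v)).
Proof. by move=> ck; rewrite /horizon; auto_computable. Qed.

Lemma computable_bad_dyadic n (k m : n.-tuple nat -> nat) :
  computable k -> computable m ->
  computable (fun v => nat_of_bool (bad_dyadic (k v) (m v))).
Proof.
move=> ck cm; have cq := computable_qlevel ck; have ch := computable_horizon ck.
pose A (v : n.-tuple nat) N b := ((b ^ N * m v) %/ 2 ^ horizon (k v))%N.
pose test (v : n.-tuple nat) i b d e :=
  [&& odd b, (3 <= b)%N & excess b d (qlevel (k v)) (grid (qlevel (k v)) (k v) i)
     (A v (grid (qlevel (k v)) (k v) i) b + e)].
apply: (@computable_ex _ (fun v => (qlevel (k v)).+1) (fun v i =>
  [exists b : 'I_(qlevel (k v)).+1, exists d : 'I_b, exists e : 'I_2,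
    test v i b d e])); first by auto_computable.
apply: (@computable_ex _ (fun w : n.+1.-tuple nat => (qlevel (k (behead_tuple w))).+1) (fun w b =>
  [exists d : 'I_b, exists e : 'I_2, test (behead_tuple w) (thead w) b d e])).
  by auto_computable.
apply: (@computable_ex _ (fun w : n.+2.-tuple nat => thead w) (fun w d => [exists e : 'I_2,
   test (behead_tuple (behead_tuple w)) (thead (behead_tuple w)) (thead w) d e])).
  by auto_computable.
apply: (@computable_ex _ (fun w : n.+3.-tuple nat => 2%N) (fun w e =>
   test (behead_tuple (behead_tuple (behead_tuple w)))
     (thead (behead_tuple (behead_tuple w))) (thead (behead_tuple w)) (thead w) e)).
  by auto_computable.
rewrite /test.
have co : computable (fun w : n.+4.-tuple nat =>
    nat_of_bool (odd (thead (behead_tuple (behead_tuple w))))).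
  apply: (eq_computable (f := fun w : n.+4.-tuple nat =>
    (thead (behead_tuple (behead_tuple w)) %% 2)%N)); last by auto_computable.
  by move=> w; rewrite modn2.
apply: (@computable_and _ (fun w : n.+4.-tuple nat => odd _)) => //.
apply: (@computable_and _ (fun w : n.+4.-tuple nat => (_ <= _)%N)); first by auto_computable.
apply: computable_excess; try by auto_computable.
  by rewrite /grid; auto_computable.
by rewrite /A /grid; auto_computable.
Qed.

Variable S : nat -> bool.
Hypothesis cS : computable_seq (fun k => S k : nat).

Lemma computable_S n (a : n.-tuple nat -> nat) :
  computable a -> computable (fun v => nat_of_bool (S (a v))).
Proof. exact: (computable_unary (g := fun k => S k : nat)). Qed.

Lemma computable_mask n (k t u : n.-tuple nat -> nat) :
  computable k -> computable t -> computable u ->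
  computable (fun v => mask S (k v) (t v) (u v)).
Proof.
move=> ck ct cu.
apply: (@computable_sum _ k (fun v j => S (t v + k v - j) * ((u v %/ 2 ^ j) %% 2) * 2 ^ j)%N) => //.
apply: computableM; last by auto_computable.
apply: computableM; last by auto_computable.
by apply: computable_S; auto_computable.
Qed.

Lemma computable_common_horizon n (t : n.-tuple nat -> nat) :
  computable t -> computable (fun v => common_horizon (t v)).
Proof. by move=> ct; apply: computable_horizon; auto_computable. Qed.

Lemma computable_potential n (tau t m : n.-tuple nat -> nat) :
  computable tau -> computable t -> computable m ->
  computable (fun v => potential S bad_dyadic (tau v) (t v) (m v)).
Proof.
move=> ctau ct cm; have cH := computable_common_horizon ct.
pose len v := (common_horizon (t v) - t v)%N.
have clen : computable len by rewrite /len; auto_computable.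
pose leaf v i := (m v * 2 ^ len v + mask S (len v) (t v) i)%N.
pose ev v i k := ((2 ^ tau v <= k) &&
  bad_dyadic k (leaf v i %/ 2 ^ (common_horizon (t v) - horizon k)))%N.
apply: (eq_computable (f := fun v =>
    \sum_(i < 2 ^ len v) \sum_(k < 2 ^ t v) (ev v i k : nat))%N).
  move=> v; rewrite /potential sum_leaves_mask; apply: eq_bigr => i _.
  rewrite -(big_mkord predT (fun k => ev v i k : nat)) /=.
  case: (leqP (2 ^ tau v) (2 ^ t v)) => [le_tt|lt_tt]; last first.
    rewrite [RHS]big_geq ?(ltnW lt_tt) // big_nat_cond big1 // => k /andP[/andP[_ kt] _].
    by rewrite /ev leqNgt (ltn_trans kt lt_tt).
  rewrite (big_cat_nat (n := (2 ^ tau v)%N)) //= [X in (X + _)%N]big_nat_cond.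
  rewrite [X in (X + _)%N]big1 ?add0n; last first.
    by move=> k /andP[/andP[_ kt] _]; rewrite /ev leqNgt kt.
  rewrite big_nat_cond [RHS]big_nat_cond; apply: eq_bigr => k /andP[/andP[tk _] _].
  by rewrite /ev tk.
apply: (@computable_sum _ (fun v => 2 ^ len v)%N
  (fun v i => \sum_(k < 2 ^ t v) (ev v i k : nat))%N); first by auto_computable.
apply: (@computable_sum _ (fun w : n.+1.-tuple nat => 2 ^ t (behead_tuple w))%N
  (fun w k => ev (behead_tuple w) (thead w) k : nat)); first by auto_computable.
have cleaf : computable (fun w : n.+2.-tuple nat =>
    leaf (behead_tuple (behead_tuple w)) (thead (behead_tuple w))).
  rewrite /leaf; apply: computableD; first by auto_computable.
  by apply: computable_mask; auto_computable.
have chk := computable_horizon (@computable_thead n.+1).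
apply: (@computable_and _ (fun w : n.+2.-tuple nat => (_ <= _)%N)); first by auto_computable.
apply: computable_bad_dyadic; first by auto_computable.
by auto_computable.
Qed.

Lemma computable_good n (tau t m : n.-tuple nat -> nat) :
  computable tau -> computable t -> computable m ->
  computable (fun v => nat_of_bool (good S bad_dyadic (tau v) (t v) (m v))).
Proof.
move=> ctau ct cm; rewrite /good.
have cH := computable_common_horizon ct; have cp := computable_potential ctau ct cm.
auto_computable.
Qed.

Lemma computable_good_prefix n (tau t : n.-tuple nat -> nat) :
  computable tau -> computable t ->
  computable (fun v => good_prefix S bad_dyadic (tau v) (t v)).
Proof.
move=> ctau ct.
pose h (v : n.-tuple nat) k r :=
  if (k.+1 <= tau v)%N || good S bad_dyadic (tau v) k.+1 (2 * r)
  then (2 * r)%N else (2 * r + S k.+1)%N.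
apply: (@computable_rec n (fun=> 0%N) h
  (fun v k => good_prefix S bad_dyadic (tau v) k) t) => //; first by auto_computable.
have cS1 : computable (fun w : n.+2.-tuple nat => nat_of_bool (S (thead w).+1)).
  by apply: computable_S; auto_computable.
rewrite /h; apply: computable_if.
- apply: (eq_computable (f := fun w : n.+2.-tuple nat => nat_of_bool
    (~~ (~~ ((thead w).+1 <= tau (behead_tuple (behead_tuple w)))%N &&
    ~~ good S bad_dyadic (tau (behead_tuple (behead_tuple w))) (thead w).+1
          (2 * thead (behead_tuple w)))))).
    by move=> w; rewrite negb_and !negbK.
  apply: computable_neg; apply: computable_and; apply: computable_neg; first by auto_computable.
  by apply: computable_good; auto_computable.
- by auto_computable.
- by auto_computable.
Qed.

End ComputablePrefix.

(** * Numbers that avoid the bad events are normal *)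

Lemma qlevel_le_self k : (qlevel k <= k)%N.
Proof.
rewrite /qlevel; apply: (@leq_trans (\sum_(j < k) 1)%N); last by rewrite sum1_card card_ord.
by apply: leq_sum => j _; exact: leq_b1.
Qed.

Section Normality.
Variable R : realType.

Lemma trunc_within_one (z z' : R) : 0 <= z' -> z' <= z -> z <= z' + 1 ->
  exists e : 'I_2, Num.trunc z = (Num.trunc z' + e)%N.
Proof.
move=> z'0 lo up; have /andP[a1 a2] := truncn_itv z'0.
have z0 : 0 <= z := le_trans z'0 lo.
have /andP[c1 c2] := truncn_itv z0.
have le1 : (Num.trunc z' <= Num.trunc z)%N by exact: le_truncn.
have le2 : (Num.trunc z < (Num.trunc z').+2)%N.
  rewrite -(ltr_nat R); apply: le_lt_trans c1 _; apply: le_lt_trans up _.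
  by rewrite -[X in _ < X]natr1 ltrD2r.
exists (inord (Num.trunc z - Num.trunc z')); rewrite inordK; lia.
Qed.

(** Digit counts at the lengths of the grid control those at all lengths, because
    every length is at most, and almost equal to, one of the grid. *)
Lemma grid_cover q N : (0 < q)%N -> (0 < N)%N -> let k := trunc_log 2 N in
  exists2 i, (i <= q)%N & (N <= grid q k i)%N /\ (q * grid q k i <= N * q.+1)%N.
Proof.
move=> q0 N0 k; have /andP[kN Nk] := @trunc_log_bounds 2 N isT N0.
rewrite -/k in kN Nk; have p0 : (0 < 2 ^ k)%N by rewrite expn_gt0.
rewrite expnS in Nk; rewrite /grid; move: (2 ^ k)%N p0 kN Nk => p p0 pN Np.
pose i := ((N - p) * q %/ p).+1.
have i1 : (i.-1 * p <= (N - p) * q)%N by exact: leq_trunc_div.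
have i2 : ((N - p) * q < i * p)%N by rewrite -ltn_divLR.
have g1 : ((i * p) %/ q * q <= i * p)%N by exact: leq_trunc_div.
exists i; first by rewrite /i ltn_divLR //; nia.
split.
  rewrite -leq_subLR leq_divRL //; exact: ltnW.
rewrite /i /= in i1 g1 *; nia.
Qed.

Section SimplyNormal.
Variables (x y : R) (M : nat -> nat) (k1 : nat).
Hypothesis x01 : 0 <= x < 1.
Hypothesis y0 : 0 <= y.
Hypothesis M_approx : forall t,
  y + (M t)%:R / 2 ^+ t <= x <= y + (M t).+1%:R / 2 ^+ t.
Hypothesis M_avoids : forall k, (k1 <= k)%N -> ~~ bad (qlevel k) k
  (fun N b => Num.trunc (b%:R ^+ N * (y + (M (horizon k))%:R / 2 ^+ horizon k))).

Let x0 : 0 <= x. Proof. by case/andP: x01. Qed.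

(** Truncation of [x] lowers the integer part of [b ^ N * x] by at most one, which
    the carry [e] in the bad events accounts for. *)
Lemma digit_count_grid (b k i d : nat) :
  odd b -> (3 <= b)%N -> (b <= qlevel k)%N -> (k1 <= k)%N -> (i <= qlevel k)%N ->
  (d < b)%N ->
  (b * qlevel k * digit_count b d (grid (qlevel k) k i)
     (Num.trunc (b%:R ^+ grid (qlevel k) k i * x)) <=
   grid (qlevel k) k i * (qlevel k + 10 * b))%N.
Proof.
move=> ob b3 bq k1k iq db; have := M_avoids k1k; set q := qlevel k in bq iq *.
set N := grid q k i.
set K := horizon k; set X : R := y + (M K)%:R / 2 ^+ K => avoid.
have bN0 : 0 < b%:R ^+ N :> R by rewrite exprn_gt0 // ltr0n; lia.
have q0 : (0 < q)%N by lia.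
have X0 : 0 <= X by rewrite addr_ge0 // divr_ge0 // exprn_ge0.
have NK : b%:R ^+ N <= 2 ^+ K :> R.
  rewrite -!natrX ler_nat /K /horizon expnM.
  apply: (@leq_trans ((2 ^ k) ^ N)); first rewrite leq_exp2r.
  - apply: leq_trans bq _; apply: leq_trans (qlevel_le_self k) (ltnW (ltn_expl _ _)) => //.
  - by rewrite /N /grid addn_gt0 expn_gt0.
  - apply: leq_pexp2l; first by rewrite expn_gt0.
    rewrite /N /grid expnS mul2n -addnn leq_add2l -[X in (_ <= X)%N](mulKn _ q0).
    by rewrite leq_div2r // leq_mul2r iq orbT.
have [e te] : exists e : 'I_2,
    Num.trunc (b%:R ^+ N * x) = (Num.trunc (b%:R ^+ N * X) + e)%N.
  have /andP[lo up] := M_approx K; apply: trunc_within_one.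
  - by rewrite mulr_ge0 // ltW.
  - by rewrite ler_pM2l.
  - apply: (@le_trans _ _ (b%:R ^+ N * (X + (2 ^+ K)^-1))).
      by rewrite ler_pM2l // -addrA -[X in _ + (_ + X)]mul1r -mulrDl natr1.
    by rewrite mulrDr lerD2l ler_pdivrMr ?exprn_gt0 // mul1r.
rewrite te leqNgt; apply: contraNN avoid => ex.
have iq' : (i < q.+1)%N by [].
have bq' : (b < q.+1)%N by [].
apply/existsP; exists (Ordinal iq'); apply/existsP; exists (Ordinal bq').
by apply/existsP; exists (Ordinal db); apply/existsP; exists e; rewrite /= ob b3.
Qed.

(** Upper bounds for the frequencies of all the digits suffice, because the
    frequencies add up to one. *)
Lemma simply_normal_odd (b : nat) : odd b -> (3 <= b)%N -> simply_normal b x.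
Proof.
move=> ob b3; have b1 : (1 < b)%N by exact: leq_trans b3.
have b0 : (0 < b)%N by exact: leq_trans b3.
have bR : 0 < b%:R :> R by rewrite ltr0n.
pose w : digit_seq b := fun j => inord (expansion_digit b x j).
have wE j : w j = (Num.trunc (b%:R ^+ j.+1 * x) %% b)%N :> nat.
  rewrite inordK /expansion_digit ?fracpart_id //.
  by rewrite (ltn_predK b1) ltn_mod.
exists w; first exact: expansion_exists.
pose D (d : digit b) n := (\sum_(j < n) (w j == d))%N.
have DE d n : D d n = digit_count b d n (Num.trunc (b%:R ^+ n * x)).
  rewrite digit_count_trunc //; apply: eq_bigr => j _.
  by rewrite -wE.
have D_sum n : (\sum_(d : digit b) D d n = n)%N.
  rewrite exchange_big /= (eq_bigr (fun=> 1%N)) ?sum1_card ?card_ord // => j _.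
  by rewrite (bigD1 (w j)) //= eqxx big1 // => d /negbTE; rewrite eq_sym => ->.
have D_mono d n n' : (n <= n')%N -> (D d n <= D d n')%N.
  move=> /subnKC <-; rewrite /D big_split_ord /=; exact: leq_addr.
have upper (e : R) : 0 < e -> exists n0, forall n d, (n0 <= n)%N -> (0 < n)%N ->
    (D d n)%:R / n%:R <= b%:R^-1 + e.
  move=> e0; pose Q := maxn b (Num.trunc (21 / e)).+1.
  exists (2 ^ (maxn k1 (2 ^ (Q ^ 40))))%N => n d n0n n_gt0.
  set k := trunc_log 2 n.
  have : (maxn k1 (2 ^ (Q ^ 40)) <= k)%N by exact: trunc_log_max.
  rewrite geq_max => /andP[k1k Qk]; have Qq : (Q <= qlevel k)%N by exact: qlevel_ge.
  move: Qq; rewrite geq_max => /andP[bq eq]; have q0 : (0 < qlevel k)%N by lia.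
  have [i iq [nN Nn]] := grid_cover q0 n_gt0; rewrite -/k in nN Nn.
  have dlt : (d < b)%N by rewrite -[X in (_ < X)%N](ltn_predK b1).
  have := digit_count_grid ob b3 bq k1k iq dlt; rewrite /= -DE.
  have := D_mono d _ _ nN; move: Nn nN; set N := grid _ _ _; set q := qlevel k in bq eq q0 *.
  move=> Nn nN DnN DN.
  have qe : 21 / e <= q%:R.
    by apply: le_trans (ltW (truncnS_gt _)) _; rewrite ler_nat.
  have qR : 0 < q%:R :> R by rewrite ltr0n.
  have nR : 0 < n%:R :> R by rewrite ltr0n.
  have H : (b * q * q * D d n <= n * (q.+1 * (q + 10 * b)))%N.
    have -> : (b * q * q * D d n = q * (b * q * D d n))%N by lia.
    apply: (@leq_trans (q * (N * (q + 10 * b)))%N).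
      rewrite leq_mul2l; apply/orP; right; apply: leq_trans DN.
      by rewrite leq_mul2l DnN orbT.
    by rewrite !mulnA leq_mul2r; apply/orP; right.
  rewrite ler_pdivrMr //.
  move: H; rewrite -(ler_nat R) !natrM natrD natrM -[q.+1%:R]natr1.
  have bqR : b%:R <= q%:R :> R by rewrite ler_nat.
  have b3R : 3 <= b%:R :> R by rewrite (ler_nat R 3).
  rewrite ler_pdivrMr // in qe.
  have key : b%:R * q%:R * (D d n)%:R * q%:R <= b%:R * q%:R * q%:R * ((b%:R^-1 + e) * n%:R) ->
     (D d n)%:R <= (b%:R^-1 + e) * n%:R :> R.
    by rewrite mulrAC ler_pM2l // !mulr_gt0.
  move=> H; apply: key; rewrite [leLHS]mulrAC; apply: (le_trans H).
  have -> : b%:R * q%:R * q%:R * ((b%:R^-1 + e) * n%:R) =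
     n%:R * (q%:R * q%:R + b%:R * q%:R * (q%:R * e)) by field; rewrite gt_eqF.
  rewrite ler_pM2l //.
  apply: (@le_trans _ _ (q%:R * q%:R + b%:R * q%:R * 21)); last first.
    by rewrite lerD2l ler_pM2l ?mulr_gt0 // mulrC [q%:R * e]mulrC.
  move: (q%:R : R) (b%:R : R) qR b3R bqR => qq bb q0' b3' bq'; nra.
move=> d; apply/cvgrPdist_le => e e0.
have eb0 : 0 < e / b%:R by rewrite divr_gt0.
have [n0 up] := upper _ eb0; near=> n.
have n_gt0 : (0 < n)%N by near: n; exists 1%N.
have nn0 : (n0 <= n)%N by near: n; exists n0.
have nR : 0 < n%:R :> R by rewrite ltr0n.
have lowerd : b%:R^-1 - e <= (D d n)%:R / n%:R.
  have : \sum_(d' : digit b | d' != d) (D d' n)%:R / n%:R <=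
      \sum_(d' : digit b | d' != d) (b%:R^-1 + e / b%:R) :> R.
    by apply: ler_sum => d' _; exact: up.
  rewrite sumr_const cardC1 card_ord /= -mulr_suml -natr_sum.
  have -> : (\sum_(d' : digit b | d' != d) D d' n = n - D d n)%N.
    set rest := (\sum_(d' | _) _)%N.
    have E : (D d n + rest = n)%N by rewrite -[RHS](D_sum n) [RHS](bigD1 d).
    by rewrite -[X in (X - _)%N]E addKn.
  have Dn : (D d n <= n)%N by rewrite -[X in (_ <= X)%N](D_sum n) (bigD1 d) //= leq_addr.
  rewrite natrB // mulrBl divff ?gt_eqF // -[leRHS]mulr_natl.
  have -> : (b.-1)%:R = b%:R - 1 :> R by rewrite -subn1 natrB.
  have -> : (b%:R - 1) * (b%:R^-1 + e / b%:R) = 1 + e - b%:R^-1 - e / b%:R :> R.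
    by field; rewrite gt_eqF.
  by move=> H; move: (ltW eb0); lra.
have upperd : (D d n)%:R / n%:R <= b%:R^-1 + e.
  apply: le_trans (up n d nn0 n_gt0) _; rewrite lerD2l ler_pdivrMr // ler_peMr ?ltW //.
  by rewrite ltr1n.
by rewrite ler_norml; apply/andP; split; lra.
Unshelve. all: by end_near. Qed.

Lemma normal_of_avoid : normal_in_odd_bases x.
Proof.
move=> b b1 ob k k0; apply: simply_normal_odd; first by rewrite oddX ob orbT.
have b3 : (3 <= b)%N by case: b b1 ob => [|[|[|]]].
by apply: leq_trans b3 _; rewrite -{1}[b]expn1 leq_pexp2l // ltnW.
Qed.

End SimplyNormal.
End Normality.

(** * Numbers deterministic in base 2 and normal in odd bases *)

Lemma sum_tail_ge (P : nat -> bool) (N n : nat) : (N <= n)%N ->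
  (forall j, (N <= j)%N -> P j) -> (n - N <= \sum_(j < n) P j)%N.
Proof.
move=> /subnKC <- PN; rewrite addKn big_split_ord /=.
apply: leq_trans (leq_addl _ _); rewrite -{1}[(n - N)%N]card_ord -sum1_card.
by apply: leq_sum => j _; rewrite PN // leq_addr.
Qed.

Section Density.
Variable R : realType.

Lemma count_in_ord (T : set nat) n : count_in T 1 n = (\sum_(j < n) (j.+1 \in T))%N.
Proof. by rewrite /count_in big_add1 big_mkord. Qed.

Lemma deterministic_of_density_zero (x : R) (w : digit_seq 2) (T : set nat) :
  is_expansion x w -> (forall j, w j != ord0 -> T j.+1) -> density_zero R T ->
  deterministic 2 x.
Proof.
move=> xw wT T0; apply: (deterministic_of_sparse xw).
apply: (@squeeze_cvgr _ _ _ _ (fun=> 0) (fun n => (count_in T 1 n)%:R / n%:R));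
  [ | exact: cvg_cst | exact: T0].
near=> n; rewrite divr_ge0 //= ler_wpM2r ?invr_ge0 // ler_nat count_in_ord.
apply: leq_sum => j _; case: (boolP (w j != ord0)) => // /wT Tj.
by rewrite mem_set.
Unshelve. all: by end_near. Qed.

Lemma density_zero_coinfinite (T : set nat) : density_zero R T ->
  forall N, exists2 j, (N <= j)%N & ~ T j.+1.
Proof.
move=> T0 N; apply: contrapT => none.
have all_in j : (N <= j)%N -> T j.+1.
  by move=> Nj; apply: contrapT => nT; apply: none; exists j.
have : 1 <= 0 :> R; last by rewrite ler10.
have lim1 : (fun n => 1 - N%:R * n%:R^-1 : R) @ \oo --> (1 : R).
  rewrite -[X in _ --> X]subr0; apply: cvgB; first exact: cvg_cst.
  rewrite -[X in _ --> X](mulr0 N%:R); apply: cvgM; [exact: cvg_cst | exact: cvg_inv_nat].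
apply: (ler_cvg_to lim1 T0).
near=> n; have n0 : 0 < n%:R :> R by rewrite ltr0n; near: n; exists 1%N.
have Nn : (N <= n)%N by near: n; exists N.
rewrite ler_pdivlMr // mulrBl mul1r divfK ?gt_eqF //.
rewrite -natrB // ler_nat count_in_ord.
apply: (@sum_tail_ge (fun j => j.+1 \in T)) => // j /all_in; exact: mem_set.
Unshelve. all: by end_near. Qed.

End Density.

Section OddNormal.
Variable R : realType.

Definition bad_real (y : R) (k m : nat) : bool :=
  bad (qlevel k) k (fun N b => Num.trunc (b%:R ^+ N * (y + m%:R / 2 ^+ horizon k))).

Lemma bad_real0 : bad_real 0 = bad_dyadic.
Proof.
apply/funext => k; apply/funext => m; rewrite /bad_real /bad_dyadic.
congr (bad _ _ _); apply/funext => N; apply/funext => b; rewrite add0r.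
apply: truncn_def; rewrite mulrA -natrX -natrM -natrX.
have p0 : 0 < (2 ^ horizon k)%:R :> R by rewrite ltr0n expn_gt0.
rewrite ler_pdivlMr // ltr_pdivrMr // -!natrM ler_nat ltr_nat leq_trunc_div /=.
by rewrite -ltn_divLR // expn_gt0.
Qed.

Definition choice_digit (s : nat -> bool) (E : nat -> nat -> bool) (tau j : nat) : nat :=
  (good_prefix s E tau j.+1 - 2 * good_prefix s E tau j)%N.

Lemma good_prefixS s E tau j : good_prefix s E tau j.+1 =
  (2 * good_prefix s E tau j + choice_digit s E tau j)%N /\
  (choice_digit s E tau j <= (tau <= j) && s j.+1)%N.
Proof.
rewrite /choice_digit /=; case: ifP => [_|H]; first by rewrite subnn addn0.
rewrite addKn; split=> //.
by move/negbT: H; rewrite negb_or -ltnNge ltnS => /andP[-> _].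
Qed.

Lemma good_prefix_horner s E tau n :
  good_prefix s E tau n = horner 2 (choice_digit s E tau) n.
Proof. by elim: n => // n IH; rewrite (good_prefixS s E tau n).1 IH /= mulnC. Qed.

(** The bound on the probability of the bad events does not depend on the
    background number [y], so the digits outside [S] may be prescribed; this is the
    freedom that produces uncountably many numbers. *)
Theorem odd_normal (S : set nat) (rho y : R) (c : nat -> bool) (T : set nat) :
  sparsity_exponent S rho ->
  (forall p, c p -> ~ S p) ->
  S `<=` T -> (forall p, c p -> T p) -> density_zero R T ->
  series (fun j => (c j.+1)%:R / 2 ^+ j.+1 : R) @ \oo --> y ->
  exists tau0, forall tau, (tau0 <= tau)%N ->
    exists2 x : R, 0 <= x < 1 /\ normal_in_odd_bases x &
    exists2 w : digit_seq 2, is_expansion x w &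
      forall j, w j = (choice_digit (fun p => p \in S) (bad_real y) tau j + c j.+1)%N :> nat.
Proof.
move=> Srho cS ST cT T0 cvy.
have c_lt j : ((c j.+1 : nat) < 2)%N by case: (c _).
have y0 : 0 <= y.
  by have /andP[+ _] := (series_cvg_bounds (isT : (1 < 2)%N) c_lt y).1 cvy 0%N; rewrite mul0r.
have [k0 rare] := bad_probability Srho.
exists (maxn k0 1) => tau; rewrite geq_max => /andP[k0tau tau0].
set s := fun p => p \in S; set E := bad_real y.
have E_rare k t m n : (k0 <= k)%N -> (2 ^ t <= k)%N -> (t + n = horizon k)%N ->
    ((\sum_(u <- leaves s n t m) E k u) * (k * k.+1) <= 2 ^ n)%N.
  move=> k0k tk tn; have := rare k t m n y k0k tk tn y0.
  have kk : 0 < k%:R * k.+1%:R :> R.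
    by rewrite mulr_gt0 // ltr0n; apply: leq_trans tk; rewrite expn_gt0.
  by rewrite ler_pdivlMr // -natr_sum -!natrM -(natrX _ 2 n) ler_nat.
have k0t : (k0 <= 2 ^ tau)%N by apply: leq_trans k0tau (ltnW (ltn_expl _ _)).
set zd := choice_digit s E tau.
have zd_S j : (zd j <= s j.+1)%N.
  by apply: leq_trans (good_prefixS s E tau j).2 _; case: (tau <= j)%N.
have zd_lt j : (zd j < 2)%N by apply: leq_ltn_trans (zd_S j) _; case: (s _).
have [z cvz] := @horner_cvg R 2 zd isT zd_lt.
have w_lt j : (zd j + c j.+1 < 2)%N.
  have := zd_S j; have := @cS j.+1; rewrite /s.
  case: (c j.+1) => [/(_ isT) nS|_]; first by rewrite (memNset nS) leqn0 => /eqP ->.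
  by rewrite addn0 => /leq_ltn_trans; apply; case: (_ \in _).
pose w : digit_seq 2 := fun j => inord (zd j + c j.+1)%N.
have wE j : w j = (zd j + c j.+1)%N :> nat by rewrite inordK.
have w_T j : w j != 0%N :> nat -> T j.+1.
  rewrite wE; have := zd_S j; rewrite /s; case: (boolP (j.+1 \in S)) => [/set_mem Sj _ _|_].
    exact: ST.
  by rewrite leqn0 => /eqP ->; rewrite add0n eqb0 negbK => /cT.
have notail : ~ (exists N, forall j, (N <= j)%N -> w j = 2.-1 :> nat).
  move=> [N tail]; have [j Nj nT] := density_zero_coinfinite T0 N.
  by apply: nT; apply: w_T; rewrite tail.
have [x [x01 xw cvx _]] := @expansion_sum R 2 w isT notail.
have xE : x = y + z.
  apply: (cvg_unique _ cvx); first exact: Rhausdorff.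
  rewrite (_ : series _ = (fun n => series (fun j => (c j.+1)%:R / 2 ^+ j.+1) n +
    series (fun j => (zd j)%:R / 2 ^+ j.+1) n)); first exact: cvgD.
  apply/funext => n; rewrite !seriesEnat /= -big_split /=; apply: eq_bigr => j _.
  by rewrite wE natrD mulrDl addrC.
exists x; last by exists w.
split=> //; apply: (@normal_of_avoid R x y (good_prefix s E tau) (2 ^ tau)) => //.
- move=> t; rewrite xE !lerD2l good_prefix_horner -/zd.
  exact: (series_cvg_bounds (isT : (1 < 2)%N) zd_lt z).1 cvz t.
- by move=> k tk; apply: (good_prefix_avoids E_rare).
Qed.

End OddNormal.

(** * The squares form a computable sparse set *)

Lemma no_injection_bool_nat (g : (nat -> bool) -> nat) : ~ injective g.
Proof.
move=> g_inj; pose s n := `[< forall t, g t = n -> ~~ t n >].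
case Es: (s (g s)); move: (Es); rewrite /s.
  by move=> /asboolP /(_ s erefl); rewrite -/(s (g s)) Es.
move=> /asboolPn; apply => t gts; have ts := g_inj _ _ gts.
by rewrite ts; move: Es; rewrite /s => ->.
Qed.

Lemma uncountable_of_injection (T : choiceType) (A : set T) (x : (nat -> bool) -> T) :
  (forall s, A (x s)) -> injective x -> ~ countable A.
Proof.
move=> xA x_inj /countable_injP[f f_inj].
apply: (@no_injection_bool_nat (f \o x)) => s t /= fst.
by apply: x_inj; apply: f_inj => //; rewrite inE.
Qed.

Definition squares : set nat := [set p | exists2 i, (0 < i)%N & p = (i * i)%N].
Definition squares_succ : set nat := [set p | exists2 i, (0 < i)%N & p = (i * i).+1].

Lemma int_sqrt n : exists r, (r * r <= n < r.+1 * r.+1)%N.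
Proof.
elim: n => [|n [r /andP[rn nr]]]; first by exists 0%N.
case: (leqP (r.+1 * r.+1) n.+1) => H; [exists r.+1 | exists r]; apply/andP; split; lia.
Qed.

Lemma sqr_lt_root a b : (a * a < b * b)%N -> (a < b)%N.
Proof. by rewrite !mulnn ltn_exp2r. Qed.

Lemma squares_not_succ p : squares_succ p -> ~ squares p.
Proof.
move=> [i i0 ->] [j j0 E].
have ij : (i < j)%N by apply: sqr_lt_root; rewrite -E.
have ji : (j < i.+1)%N by apply: sqr_lt_root; rewrite -E; lia.
lia.
Qed.

Lemma count_in_count (T : set nat) m n :
  count_in T m n = count (fun p => p \in T) (index_iota m n.+1).
Proof. by rewrite /count_in -sum1_count [RHS]big_mkcond. Qed.

Section Squares.
Variable R : realType.

(** The parameter [r] is the integer square root of [n]. *)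
Lemma density_zero_of_sqrt (T : set nat) (C : nat) :
  (forall r n, (r * r <= n < r.+1 * r.+1)%N -> (count_in T 1 n <= C * r.+1)%N) ->
  density_zero R T.
Proof.
move=> HT; apply/cvgrPdist_le => e e0.
pose r0 := (Num.trunc ((2 * C)%:R / e)).+1.
near=> n; have [r rn] := int_sqrt n; have cnt := HT r n rn.
have nr0 : (r0.+1 * r0.+1 <= n)%N by near: n; exists (r0.+1 * r0.+1)%N.
have r0r : (r0 <= r)%N by apply: ltnW; rewrite -ltnS; apply: sqr_lt_root; case/andP: rn => _ nr; exact: leq_ltn_trans nr0 nr.
have r_gt0 : (0 < r)%N by apply: leq_trans r0r.
have rR : 0 < r%:R :> R by rewrite ltr0n.
have n0 : 0 < n%:R :> R by rewrite ltr0n (leq_trans _ nr0).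
rewrite sub0r normrN ger0_norm ?divr_ge0 // ler_pdivrMr //.
have re : (2 * C)%:R <= e * r%:R.
  rewrite mulrC -ler_pdivrMr //; apply: le_trans (ltW (truncnS_gt _)) _.
  by rewrite ler_nat.
apply: (@le_trans _ _ ((2 * C)%:R * r%:R)).
  by rewrite -natrM ler_nat; apply: leq_trans cnt _; rewrite [(2 * C)%N]mulnC -mulnA leq_mul2l; lia.
apply: (@le_trans _ _ (e * r%:R * r%:R)); first by rewrite ler_wpM2r // ltW.
by rewrite -mulrA ler_wpM2l ?(ltW e0) // -natrM ler_nat; case/andP: rn.
Unshelve. all: by end_near. Qed.

Lemma count_image (T : set nat) (f : nat -> nat) (r n : nat) :
  (forall p, T p -> (p <= n)%N -> exists2 i, (i <= r)%N & p = f i) ->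
  (count_in T 1 n <= r.+1)%N.
Proof.
move=> Tf; rewrite count_in_count -size_filter -[X in (_ <= X)%N](size_iota 0).
rewrite -[X in (_ <= X)%N](size_map f).
apply: uniq_leq_size; first by rewrite filter_uniq // iota_uniq.
move=> p; rewrite mem_filter mem_index_iota => /andP[/set_mem Tp /andP[_ pn]].
have [i ir ->] := Tf p Tp pn; apply/mapP; exists i => //.
by rewrite mem_iota.
Qed.

Lemma density_zero_squares : density_zero R squares.
Proof.
apply: (@density_zero_of_sqrt _ 1) => r n /andP[_ nr]; rewrite mul1n.
apply: (@count_image _ (fun i => i * i)%N) => p [i i0 ->] pn.
exists i => //; nia.
Qed.

Lemma density_zero_squares_succ : density_zero R (squares `|` squares_succ).
Proof.
apply: (@density_zero_of_sqrt _ 2) => r n /andP[_ nr].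
have c1 : (count_in squares 1 n <= r.+1)%N.
  apply: (@count_image _ (fun i => i * i)%N) => p [i i0 ->] pn.
  by exists i => //; nia.
have c2 : (count_in squares_succ 1 n <= r.+1)%N.
  apply: (@count_image _ (fun i => (i * i).+1)%N) => p [i i0 ->] pn.
  by exists i => //; nia.
rewrite mul2n -addnn; apply: leq_trans (leq_add c1 c2).
rewrite /count_in -big_split /=; apply: leq_sum => p _.
by rewrite in_setU; case: (_ \in _); case: (_ \in _).
Qed.

(** The squares of all integers between [r / 2] and [r] lie in the window. *)
Lemma count_squares_ge a r k : (4 <= r)%N -> (a <= r)%N -> (r * r <= k)%N ->
  (r <= 2 * count_in squares a (a + k))%N.
Proof.
move=> r4 ar rk; have hr : (r <= 2 * (r - r./2))%N by lia.
apply: leq_trans hr _; rewrite leq_mul2l /= count_in_count -size_filter.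
pose l := [seq (i * i)%N | i <- iota (r./2).+1 (r - r./2)].
rewrite -[X in (X <= _)%N](size_iota (r./2).+1).
rewrite -[X in (X <= _)%N](size_map (fun i => i * i)%N).
apply: uniq_leq_size.
  rewrite map_inj_uniq ?iota_uniq // => i j ij; nia.
move=> p /mapP[i]; rewrite mem_iota => /andP[ri ir] ->.
rewrite mem_filter mem_index_iota mem_set /=; last by exists i => //; lia.
apply/andP; split; nia.
Qed.

Lemma limn_einf_ge (u : (\bar R)^nat) (c : \bar R) n0 :
  (forall n, (n0 <= n)%N -> (c <= u n)%E) -> (c <= limn_einf u)%E.
Proof.
move=> cu; rewrite limn_einf_lim (cvg_lim _ (@cvg_einfs_sup R u)) //.
apply: (@le_trans _ _ (einfs u n0)); last by apply: ereal_sup_ubound; exists n0.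
by apply: le_ereal_inf_tmp => _ [n n0n <-]; exact: cu.
Qed.

Lemma sparsity_exponent_squares : sparsity_exponent squares (2^-1 : R).
Proof.
split; first by rewrite invr_gt0.
rewrite /=; apply: (@lt_le_trans _ _ 2%:E); first by rewrite lte_fin ltr1n.
pose k0 := (Num.trunc (expR 960 : R)).+1.
apply: (@limn_einf_ge _ _ k0) => k k0k.
apply: le_ereal_inf_tmp => _ [a ak <-]; rewrite lee_fin.
have [r /andP[rk kr]] := int_sqrt k.
have kR : expR 960 <= k%:R :> R.
  by apply: le_trans (ltW (truncnS_gt _)) _; rewrite ler_nat.
have k_pos : 0 < k%:R :> R by apply: lt_le_trans kR; exact: expR_gt0.
set X := ln k%:R; have kE : k%:R = expR X :> R by rewrite lnK.
have X960 : 960 <= X by rewrite -ler_expR -kE.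
have X0 : 0 <= X / 2 by rewrite divr_ge0 //; lra.
have sq : (expR (X / 2)) ^+ 2 = k%:R :> R.
  by rewrite kE -expRM_natl; congr expR; field.
have rX : X ^+ 2 / 8 <= r%:R.
  have up : expR (X / 2) <= r%:R + 1.
    rewrite natr1 -(@ler_pXn2r R 2) ?nnegrE ?expR_ge0 // sq -natrX ler_nat -mulnn.
    exact: ltnW.
  have lo : 1 + X ^+ 2 / 8 <= expR (X / 2).
    apply: le_trans (expR_ge1Dxn 1 X0).
    by rewrite (_ : X ^+ 2 / 8 = (X / 2) ^+ 2 / 2) //; field.
  lra.
(* 960 = 8 * 120, and 120 = 2 * 2 * 30 *)
have r_big : 120 * X <= r%:R by apply: le_trans rX; nra.
have ar : (a <= r)%N.
  have a2 : (a * a <= k)%N.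
    move: ak; rewrite powR12_sqrt // => ak.
    rewrite -(ler_nat R) natrM -expr2 -[leRHS]sqr_sqrtr //.
    by rewrite lerXn2r ?nnegrE ?sqrtr_ge0.
  nia.
have r4 : (4 <= r)%N by rewrite -(ler_nat R); apply: le_trans r_big; lra.
have := count_squares_ge r4 ar rk; rewrite -(ler_nat R) natrM => cnt.
rewrite ler_pdivlMr; last by rewrite mulr_gt0 //; lra.
lra.
Qed.

Lemma computable_squares : computable_set squares.
Proof.
rewrite /computable_set /computable_seq.
apply: (eq_computable (f := fun v : 1.-tuple nat =>
  nat_of_bool [exists i : 'I_(thead v).+1, (0 < i)%N && (i * i == thead v)%N])).
  move=> v; congr nat_of_bool; apply/existsP/idP => [[i /andP[i0 /eqP iv]]|/set_mem[i i0 iv]].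
    by apply/idP/mem_set; exists (nat_of_ord i).
  have iv' : (i < (thead v).+1)%N by nia.
  by exists (Ordinal iv'); apply/andP; split=> //; apply/eqP/esym.
apply: (@computable_ex _ (fun v => (thead v).+1) (fun v i => (0 < i)%N && (i * i == thead v)%N)).
  by auto_computable.
by auto_computable.
Qed.

Lemma computable_half : computable_real (2^-1 : R).
Proof.
exists 2%N; split=> //; exists (fun j => inord (j == 0%N) : digit 2).
  apply/expansionP => //; rewrite fracpart_id; last first.
    by apply/andP; split; [rewrite invr_ge0 | rewrite invf_lt1 // ltr1n].
  pose wd j : nat := (inord (j == 0%N) : digit 2).
  have hE n : horner 2 wd n.+1 = (2 ^ n)%N.
    elim: n => [|n IH]; first by rewrite /= /wd inordK.
    change (horner 2 wd n.+1 * 2 + wd n.+1 = 2 ^ n.+1)%N.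
    by rewrite IH /wd inordK // addn0 expnSr.
  case=> [|n].
    apply: truncn_def; rewrite expr0 mul1r invr_ge0 ler0n /=.
    by rewrite invf_lt1 // ltr1n.
  rewrite -/wd hE exprSr mulfK //; apply: truncn_def.
  by rewrite -natrX lexx ltr_nat ltnSn.
apply: (eq_computable (f := fun v : 1.-tuple nat => nat_of_bool (thead v == 0%N))).
  by move=> v; rewrite inordK //; case: (_ == _).
by auto_computable.
Qed.

Lemma computably_sparse_squares : computably_sparse R squares.
Proof.
split; [exact: computable_squares | split |].
- by move=> _ [i i0 ->]; rewrite /= muln_gt0 i0.
- exact: density_zero_squares.
- by exists 2^-1; exact: sparsity_exponent_squares.
- by exists 2^-1; [exact: computable_half | exact: sparsity_exponent_squares].
Qed.

(** Free digits in the places [i ^ 2 + 1] give uncountably many numbers. *)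
Theorem uncountable_odd_normal :
  ~ countable [set x : R | deterministic 2 x /\ normal_in_odd_bases x].
Proof.
pose c (s : nat -> bool) p := `[< exists2 i, p = (i.+1 * i.+1).+1 & s i >].
pose T := squares `|` squares_succ.
have T0 : density_zero R T := density_zero_squares_succ.
have c_succ s p : c s p -> squares_succ p.
  by move=> /asboolP[i -> _]; exists i.+1.
have ex (s : nat -> bool) : exists x : R, [/\ deterministic 2 x, normal_in_odd_bases x &
    exists2 w : digit_seq 2, is_expansion x w &
      forall i, w (i.+1 * i.+1)%N = s i :> nat].
  have c_lt j : (c s j.+1 < 2)%N by case: (c s j.+1).
  have [y cvy] := @horner_cvg R 2 (fun j => c s j.+1) isT c_lt.
  have [tau0 H] := @odd_normal R squares 2^-1 y (c s) T sparsity_exponent_squares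
    (fun p cp => squares_not_succ (c_succ s p cp)) (@subsetUl _ _ _)
    (fun p cp => or_intror (c_succ s p cp)) T0 cvy.
  have [x [x01 xn] [w xw wE]] := H tau0 (leqnn _); exists x; split=> //.
    apply: (deterministic_of_density_zero xw _ T0) => j wj.
    have := (good_prefixS (fun p => p \in squares) (bad_real y) tau0 j).2.
    case: (boolP (j.+1 \in squares)) => [/set_mem Sj _|_]; first by left.
    rewrite andbF leqn0 => /eqP ch0; right; apply: (c_succ s).
    have : w j != 0%N :> nat by [].
    by rewrite wE ch0 add0n eqb0 negbK.
  exists w => // i; rewrite wE.
  have nS : ~ squares (i.+1 * i.+1).+1 by apply: squares_not_succ; exists i.+1.
  have := (good_prefixS (fun p => p \in squares) (bad_real y) tau0 (i.+1 * i.+1)).2.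
  rewrite (memNset nS) andbF leqn0 => /eqP ->; rewrite add0n; congr nat_of_bool.
  apply/asboolP/idP => [[j ij sj]|si]; last by exists i.
  by have -> : i = j by nia.
have [x xP] := choice ex.
apply: (@uncountable_of_injection _ _ x) => [s|s t st].
  by have [] := xP s.
have [_ _ [w xw wE]] := xP s; have [_ _ [w' xw' wE']] := xP t.
apply/funext => i; apply/eqP; rewrite -(inj_eq (f := nat_of_bool)); last by case; case.
rewrite -wE -wE' (expansion_unique _ _ xw) // (expansion_unique _ _ xw') //.
by rewrite st.
Qed.

End Squares.

(** * Sums of rapidly decreasing powers of 2 *)

(** The binary digits of the sum of the [2 ^- n i]; the bound on the index makes
    the test decidable. *)
Definition support_digit (n : nat -> nat) (j : nat) : bool :=
  [exists i : 'I_j.+2, n i == j.+1].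

Section Lacunary.
Variables (R : realType) (S : set nat) (n : nat -> nat).
Hypothesis n_mono : {homo n : i j / (i < j)%N}.
Hypothesis nS : forall i, S (n i).
Hypothesis S_pos : S `<=` [set k | (0 < k)%N].
Hypothesis S_density : density_zero R S.

Let n_le : {homo n : i j / (i <= j)%N}.
Proof. exact: ltnW_homo. Qed.

Let n_ge i : (i <= n i)%N.
Proof. by elim: i => // i IH; exact: leq_ltn_trans IH (n_mono (ltnSn i)). Qed.

Lemma support_digitP j : reflect (exists i, n i = j.+1) (support_digit n j).
Proof.
apply: (iffP existsP) => [[i /eqP nij]|[i nij]]; first by exists i.
have ij : (i < j.+2)%N by rewrite ltnS -nij.
by exists (Ordinal ij); rewrite nij.
Qed.

Lemma support_digit_gap i j : (n i <= j)%N -> (j.+1 < n i.+1)%N -> support_digit n j = false.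
Proof.
move=> nij jn; apply/support_digitP => -[k nk].
case: (leqP k i) => [/n_le|/n_le]; rewrite nk; lia.
Qed.

Lemma support_digit_first j : (j.+1 < n 0)%N -> support_digit n j = false.
Proof.
move=> jn; apply/support_digitP => -[k nk].
by have := n_le (leq0n k); rewrite nk leqNgt jn.
Qed.

Definition support_word : digit_seq 2 := fun j => inord (support_digit n j).

Lemma support_wordE j : support_word j = support_digit n j :> nat.
Proof. by rewrite inordK //; case: (support_digit n j). Qed.

Lemma support_word_in j : support_word j != ord0 -> S j.+1.
Proof.
move=> wj; have : support_word j != 0%N :> nat by [].
by rewrite support_wordE eqb0 negbK => /support_digitP[i <-].
Qed.

Let word_term (j : nat) : R := (support_word j : nat)%:R / 2 ^+ j.+1.

Lemma sum_word_gap (a c : nat) : (a < c)%N ->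
  (forall j, (a <= j)%N -> (j.+1 < c)%N -> support_digit n j = false) ->
  support_digit n c.-1 -> \sum_(a <= j < c) word_term j = (2 ^+ c)^-1.
Proof.
move=> ac gap last; rewrite -(ltn_predK ac) big_nat_recr /=; last by lia.
rewrite big_nat_cond big1 ?add0r.
  by rewrite /word_term support_wordE last mul1r.
move=> j /andP[/andP[aj jc] _]; rewrite /word_term support_wordE gap ?mul0r //; lia.
Qed.

(** The sum of the [2 ^- n i] is a subsequence of the partial sums of the binary
    expansion. *)
Lemma series_word i :
  series word_term (n i) = series (fun i => (2 ^+ n i)^-1 : R) i.+1.
Proof.
have n0 i' : (0 < n i')%N := S_pos (nS i').
have dig i' : support_digit n (n i').-1 by apply/support_digitP; exists i'; rewrite prednK.
elim: i => [|i IH].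
  rewrite !seriesEnat /= big_nat1 sum_word_gap // => j _; exact: support_digit_first.
have -> : series (fun i => (2 ^+ n i)^-1 : R) i.+2 =
    series (fun i => (2 ^+ n i)^-1 : R) i.+1 + (2 ^+ n i.+1)^-1.
  by rewrite !seriesEnat /= big_nat_recr.
rewrite -IH.
rewrite !seriesEnat /= (big_cat_nat (n := n i)) ?n_le //=; congr (_ + _).
by apply: sum_word_gap => // [|j]; [exact: n_mono | exact: support_digit_gap].
Qed.

Lemma dyadic_sum_expansion :
  0 <= dyadic_sum R n < 1 /\ is_expansion (dyadic_sum R n) support_word.
Proof.
have notail : ~ (exists N, forall j, (N <= j)%N -> support_word j = 2.-1 :> nat).
  move=> [N tail]; have [j Nj nSj] := density_zero_coinfinite S_density N.
  by apply: nSj; apply: support_word_in; apply/eqP => wj; have := tail j Nj; rewrite wj.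
have [x [x01 xw cvx _]] := @expansion_sum R 2 support_word isT notail.
suff -> : dyadic_sum R n = x by [].
apply: cvg_lim => //; rewrite -cvg_shiftS.
rewrite (_ : (fun i => _) = (fun i => series word_term (n i))); last first.
  by apply/funext => i; rewrite series_word.
apply: (cvg_comp _ _ _ cvx) => A [N _ NA]; exists N => // i /= Ni.
by apply: NA; exact: leq_trans Ni (n_ge i).
Qed.

Lemma deterministic_dyadic_sum : deterministic 2 (dyadic_sum R n).
Proof.
exact: (deterministic_of_density_zero dyadic_sum_expansion.2 support_word_in S_density).
Qed.

Lemma computable_dyadic_sum : computable_seq n -> computable_real (dyadic_sum R n).
Proof.
move=> cn; exists 2%N; split=> //; exists support_word; first exact: dyadic_sum_expansion.2.
apply: (eq_computable (f := fun v : 1.-tuple nat => nat_of_bool (support_digit n (thead v)))).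
  by move=> v; rewrite support_wordE.
apply: (@computable_ex _ (fun v => (thead v).+2) (fun v i => n i == (thead v).+1)); first by auto_computable.
have cni : computable (fun w : 2.-tuple nat => n (thead w)).
  by apply: (computable_unary cn); auto_computable.
by apply: (@computable_eq _ (fun w : 2.-tuple nat => n (thead w))) => //; auto_computable.
Qed.

Hypothesis n_ratio : (fun i => (n i)%:R / (n i.+1)%:R : R) @ \oo --> (0 : R).

(** In an even base the powers of the base absorb the first terms of the series, so
    a long gap in the binary expansion gives a long run of zeros. *)
Lemma even_base_zero (b i j : nat) (w : digit_seq b) : (1 < b)%N -> ~~ odd b ->
  is_expansion (dyadic_sum R n) w -> (n i <= j)%N -> (b * j.+1 < n i.+1)%N ->
  w j = 0%N :> nat.
Proof.
move=> b1 eb xw nij jn; have [x01 x2] := dyadic_sum_expansion.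
rewrite (expansion_unique j b1 xw) /expansion_digit fracpart_id //.
move: x01 x2; set x := dyadic_sum R n => x01 x2.
pose h := horner 2 (fun j => support_word j) (n i); pose m := (n i.+1).-1.
have nim : (n i <= m)%N by rewrite /m; have := n_mono (ltnSn i); lia.
have gap p : horner 2 (fun j => support_word j) (n i + p) = (h * 2 ^ p)%N ->
    (n i + p < m)%N -> horner 2 (fun j => support_word j) (n i + p.+1) = (h * 2 ^ p.+1)%N.
  move=> IH pm; rewrite addnS /= IH support_wordE (@support_digit_gap i) ?leq_addr //.
    by rewrite addn0 expnSr mulnA.
  by move: pm; rewrite /m; lia.
have hm : horner 2 (fun j => support_word j) m = (h * 2 ^ (m - n i))%N.
  rewrite -{1}(subnKC nim); have : (m - n i <= m - n i)%N by [].
  elim: {1 3 4}(m - n i)%N => [|p IH] pm; first by rewrite addn0 muln1.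
  by apply: gap; [apply: IH; exact: ltnW | move: pm; lia].
have p2 p : 0 < 2 ^+ p :> R by rewrite exprn_gt0.
have bj : 0 < b%:R ^+ j :> R by rewrite exprn_gt0 // ltr0n ltnW.
have xm : h%:R / 2 ^+ n i <= x /\ x < h%:R / 2 ^+ n i + (2 ^+ m)^-1.
  have := (expansionP x support_word isT).1 x2 m; rewrite fracpart_id // hm => tr.
  have xm0 : 0 <= 2 ^+ m * x by rewrite mulr_ge0 ?(ltW (p2 m)) //; case/andP: x01.
  have := truncn_itv xm0; rewrite tr => /andP[lo up].
  have hE : h%:R / 2 ^+ n i = (h * 2 ^ (m - n i))%:R / 2 ^+ m :> R.
    rewrite natrM natrX -{2}(subnKC nim) exprD; field.
    by rewrite !gt_eqF.
  rewrite hE; split; first by rewrite ler_pdivrMr // mulrC.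
  by rewrite -[X in _ + X]mul1r -mulrDl natr1 ltr_pdivlMr // mulrC.
(* the integer that the first terms contribute to the digits from place [j] on *)
have [q qE] : exists q : nat, b%:R ^+ j * (h%:R / 2 ^+ n i) = q%:R :> R.
  have [c bE] : exists c, b = (2 * c)%N.
    by exists b./2; rewrite mul2n -[LHS]odd_double_half (negbTE eb).
  exists (h * (2 ^ (j - n i) * c ^ j))%N.
  have P0 := p2 (n i); have Pj : 2 ^+ j = 2 ^+ (j - n i) * 2 ^+ n i :> R.
    by rewrite -exprD subnK.
  rewrite bE natrM exprMn Pj !natrM !natrX.
  by field; rewrite gt_eqF.
have [lo up] := xm.
suff -> : Num.trunc (b%:R ^+ j.+1 * x) = (b * q)%N by rewrite modnMr.
have bR : 0 < b%:R :> R by rewrite ltr0n ltnW.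
apply: truncn_def; rewrite natrM -qE exprS -mulrA ler_pM2l // ler_pM2l // lo /=.
rewrite -natr1 natrM -qE.
apply: (@lt_le_trans _ _ (b%:R * (b%:R ^+ j * (h%:R / 2 ^+ n i + (2 ^+ m)^-1)))).
  by rewrite ltr_pM2l // ltr_pM2l.
rewrite !mulrDr lerD2l mulrA -exprS ler_pdivrMr // mul1r -!natrX ler_nat.
apply: (@leq_trans ((2 ^ b) ^ j.+1)); first by rewrite leq_exp2r // ltnW // ltn_expl.
by rewrite -expnM leq_exp2l // /m; lia.
Qed.

(** All base-[b] digits from place [n i] to about place [n i.+1 / b] vanish, and
    this is almost the whole initial segment; along such lengths the frequency of
    the digit 0 is close to 1. *)
Theorem nonnormal_dyadic_sum (b : nat) : (1 < b)%N -> ~~ odd b ->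
  ~ normal b (dyadic_sum R n).
Proof.
move=> b1 eb /(_ 1%N isT); rewrite expn1 => -[w xw /(_ ord0) freq].
have bR : 0 < b%:R :> R by rewrite ltr0n ltnW.
have q4 : 0 < 4^-1 :> R by rewrite invr_gt0.
have b2 : b%:R^-1 <= 2^-1 :> R by rewrite lef_pV2 ?posrE // ler_nat.
move/cvgrPdist_le: freq => /(_ _ q4)[N0 _ freq].
have e8 : 0 < (16 * b%:R)^-1 :> R by rewrite invr_gt0 mulr_gt0.
move/cvgrPdist_le: n_ratio => /(_ _ e8)[I0 _ ratio].
pose i := maxn I0 (2 * b * N0.+1)%N.
have i_I0 : (I0 <= i)%N by exact: leq_maxl.
have := ratio i i_I0; rewrite /= sub0r normrN ger0_norm ?divr_ge0 // => ri.
have n1 : (0 < n i.+1)%N by exact: leq_ltn_trans (leq0n _) (n_mono (ltnSn i)).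
have gapN : (16 * b * n i <= n i.+1)%N.
  move: ri; rewrite ler_pdivrMr ?ltr0n // mulrC ler_pdivlMr ?mulr_gt0 //.
  by rewrite -!natrM ler_nat mulnC.
have big_i : (2 * b * N0.+1 <= n i.+1)%N.
  by apply: leq_trans (leq_maxr I0 _) _; apply: leq_trans (n_ge i) (n_le (leqnSn i)).
pose N := ((n i.+1).-1 %/ b)%N.
have Nb : (N * b <= (n i.+1).-1)%N by exact: leq_trunc_div.
have Nb' : ((n i.+1).-1 < N.+1 * b)%N by rewrite -ltn_divLR // ltnW.
have N_ni : (8 * n i <= N)%N.
  have ni0 : (0 < n i)%N by exact: S_pos (nS i).
  rewrite -(leq_pmul2r (ltnW b1)); nia.
have N_N0 : (N0 <= N)%N by rewrite -(leq_pmul2r (ltnW b1)); nia.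
have N_gt0 : (0 < N)%N.
  by have ni0 : (0 < n i)%N := S_pos (nS i); lia.
have zeros : (N - n i <= \sum_(j < N) (w j == ord0))%N.
  have niN : (n i <= N)%N by lia.
  rewrite -(big_mkord predT (fun j => (w j == ord0) : nat)) (big_cat_nat (n := n i)) //=.
  apply: leq_trans (leq_addl _ _).
  rewrite -[X in (X <= _)%N]muln1 -sum_nat_const_nat big_nat_cond [leqRHS]big_nat_cond.
  apply: leq_sum => j /andP[/andP[nij jN] _].
  suff -> : w j = ord0 by rewrite eqxx.
  apply: val_inj; apply: (even_base_zero b1 eb xw nij).
  apply: leq_ltn_trans (_ : N * b < _)%N; first by rewrite mulnC leq_mul2r jN orbT.
  by rewrite -ltnS prednK // in Nb.
have := freq N N_N0; rewrite /= => /ler_normlP[close _].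
have NR : 0 < N%:R :> R by rewrite ltr0n.
have : 7 / 8 <= (\sum_(j < N) (w j == ord0))%N%:R / N%:R :> R.
  rewrite ler_pdivlMr // mulrC mulrA ler_pdivrMr // -!natrM ler_nat; lia.
move: close; rewrite opprB; lra.
Qed.

End Lacunary.

Lemma increasing_enum_unique (n n' : nat -> nat) :
  {homo n : i j / (i < j)%N} -> {homo n' : i j / (i < j)%N} ->
  (forall p, (exists i, n i = p) <-> (exists i, n' i = p)) -> n = n'.
Proof.
move=> n_mono n'_mono same; apply/funext; elim/ltn_ind => i IH.
have le_of (f g : nat -> nat) : {homo f : i j / (i < j)%N} ->
    {homo g : i j / (i < j)%N} -> (forall p, (exists i, f i = p) -> exists i, g i = p) ->
    (forall j, (j < i)%N -> f j = g j) -> (g i <= f i)%N.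
  move=> fm gm fg fgi; have [k gk] := fg (f i) (ex_intro _ i erefl).
  rewrite -gk; case: (leqP i k) => [ik | ki]; first exact: (ltnW_homo gm).
  by have := fm _ _ ki; rewrite (fgi k ki) gk ltnn.
apply/eqP; rewrite eqn_leq; apply/andP; split.
  exact: le_of n'_mono n_mono (fun p => (same p).2) (fun j ji => esym (IH j ji)).
exact: le_of n_mono n'_mono (fun p => (same p).1) IH.
Qed.

Lemma dyadic_sum_inj (R : realType) (S : set nat) (n n' : nat -> nat) :
  S `<=` [set k | (0 < k)%N] -> density_zero R S ->
  {homo n : i j / (i < j)%N} -> (forall i, S (n i)) ->
  {homo n' : i j / (i < j)%N} -> (forall i, S (n' i)) ->
  dyadic_sum R n = dyadic_sum R n' -> n = n'.
Proof.
move=> Spos S0 n_mono nS n'_mono n'S E.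
have [_ e1] := dyadic_sum_expansion n_mono nS Spos S0.
have [_ e2] := dyadic_sum_expansion n'_mono n'S Spos S0.
have same j : support_digit n j = support_digit n' j.
  have bool_inj : injective nat_of_bool by case; case.
  apply: bool_inj; rewrite -!support_wordE (expansion_unique _ _ e1) // (expansion_unique _ _ e2) //.
  by rewrite E.
apply: increasing_enum_unique => // -[|p].
  by split=> -[i ni]; [have := Spos _ (nS i) | have := Spos _ (n'S i)]; rewrite ni.
split=> [/(support_digitP n_mono) H | /(support_digitP n'_mono) H].
  by apply/(support_digitP n'_mono); rewrite -same.
by apply/(support_digitP n_mono); rewrite same.
Qed.

Section UncountableLacunary.
Variable R : realType.

(** The roots of the exponents grow like factorials, and their parities are free. *)
Theorem uncountable_even_nonnormal (b : nat) : (1 < b)%N -> ~~ odd b ->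
  ~ countable [set x : R | deterministic 2 x /\ nonnormal_in_even_bases_upto b x].
Proof.
move=> _ _.
pose m (s : nat -> bool) i := (2 * i.+1`! + s i)%N.
pose n s i := (m s i * m s i)%N.
have f1 i : (1 <= i.+1`!)%N by exact: fact_gt0.
have m_step s i : (m s i < m s i.+1)%N.
  by rewrite /m [i.+2`!]factS; have := f1 i; case: (s i); nia.
have n_mono s : {homo n s : i j / (i < j)%N}.
  apply: homo_ltn; first exact: ltn_trans.
  by move=> i; rewrite /n; have := m_step s i; nia.
have nS s i : squares (n s i).
  by exists (m s i) => //; rewrite /m; have := f1 i; lia.
have Spos : squares `<=` [set k | (0 < k)%N].
  by move=> _ [i i0 ->]; rewrite /= muln_gt0 i0.
have S0 := @density_zero_squares R.
have ratio s : (fun i => (n s i)%:R / (n s i.+1)%:R : R) @ \oo --> (0 : R).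
  apply: (@squeeze_cvgr _ _ _ _ (fun=> 0) (fun i => 4 * i.+1%:R^-1)).
  - near=> i; rewrite divr_ge0 //=.
    have n1 : 0 < (n s i.+1)%:R :> R by rewrite ltr0n; exact: Spos (nS s _).
    rewrite ler_pdivrMr // mulrAC ler_pdivlMr ?ltr0n // -!natrM ler_nat.
    have : (m s i * i.+2 <= 2 * m s i.+1)%N.
      by rewrite /m [i.+2`!]factS; have := f1 i; case: (s i); nia.
    by rewrite /n; nia.
  - exact: cvg_cst.
  - rewrite -[X in _ --> X](mulr0 4); apply: cvgM; first exact: cvg_cst.
    exact: cvg_harmonic.
apply: (@uncountable_of_injection _ _ (fun s => dyadic_sum R (n s))) => [s|s t E].
  split; first exact: (deterministic_dyadic_sum (n_mono s) (nS s) Spos S0).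
  by move=> b' b1 eb _; exact: (nonnormal_dyadic_sum (n_mono s) (nS s) Spos S0 (ratio s)).
have nst := dyadic_sum_inj Spos S0 (n_mono s) (nS s) (n_mono t) (nS t) E.
apply/funext => i; have : n s i = n t i by rewrite nst.
rewrite /n /m; have := f1 i; case: (s i); case: (t i) => //; nia.
Unshelve. all: by end_near. Qed.

End UncountableLacunary.

(** * Explicit families *)

Lemma infinite_of_unbounded (T : Type) (A : set T) (g : T -> nat) :
  (forall p, exists2 a, A a & (p < g a)%N) -> infinite_set A.
Proof.
move=> unbounded finA; have /finite_seqP[s As] := finite_image g finA.
have [a Aa] := unbounded (\max_(k <- s) k); apply/negP; rewrite -leqNgt.
have : (g @` A) (g a) by exists a.
rewrite As /= => gs.
exact: (@leq_bigmax_seq _ s predT id (g a) gs isT).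
Qed.

Section Final.
Variable R : realType.

Lemma sparse_unbounded (S : set nat) (rho : R) : sparsity_exponent S rho ->
  forall p, exists q, (p <= q)%N && (q \in S).
Proof.
move=> /sparse_binary[L0 windows] p; pose L := maxn L0 (maxn p 2).
have := windows L (2 ^ L.-1)%N p (leq_maxl _ _) (leqnn _) _.
have pL : (p <= 8 * L + 9)%N.
  by have := leq_maxr L0 (maxn p 2); have := leq_maxl p 2; rewrite -/L; lia.
have L2 : (2 <= L)%N.
  by apply: leq_trans (leq_maxr p 2) (leq_maxr L0 _).
move=> /(_ pL) big; apply: contrapT => none; move: big; rewrite leqNgt => /negP; apply.
rewrite /count_in big_nat_cond big1; first by lia.
move=> q /andP[/andP[pq _] _]; case: (boolP (q \in S)) => // qS.
by case: none; exists q; rewrite pq.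
Qed.

Section LacunaryFamily.
Variable S : set nat.
Hypothesis S_comp : computable_set S.
Hypothesis S_unbounded : forall p, exists q, (p <= q)%N && (q \in S).

Definition next_in (p : nat) : nat := ex_minn (S_unbounded p).

Lemma next_inP p : (p <= next_in p)%N /\ S (next_in p).
Proof. by rewrite /next_in; case: ex_minnP => q /andP[pq /set_mem]. Qed.

Lemma computable_next_in : computable_seq next_in.
Proof.
apply: (@computable_search _ (fun v q => (thead v <= q)%N && (q \in S))).
  apply: (@computable_and _ (fun w : 2.-tuple nat => (_ <= _)%N)); first by auto_computable.
  by apply: (computable_unary S_comp); auto_computable.
move=> v; rewrite /next_in; case: ex_minnP => q pq qmin; split=> // k kq.
by apply/negP => /qmin; rewrite leqNgt kq.
Qed.

(** The factor [i.+1] makes the ratio of successive terms tend to infinity. *)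
Fixpoint fast_seq (p i : nat) : nat :=
  if i is i'.+1 then next_in (i * fast_seq p i').+1 else next_in p.

Lemma fast_seqS p i : (i.+1 * fast_seq p i < fast_seq p i.+1)%N.
Proof. exact: (next_inP _).1. Qed.

Lemma fast_seq_lacunary p : lacunary_seqs R S (fast_seq p).
Proof.
split.
- apply: (@computable_rec 1 (fun=> next_in p) (fun _ i r => next_in (i.+1 * r).+1)
    (fun _ i => fast_seq p i) (fun v => thead v)) => //; last by auto_computable.
    by auto_computable.
  by apply: (computable_unary computable_next_in); auto_computable.
- apply: homo_ltn; first exact: ltn_trans.
  by move=> i; apply: leq_ltn_trans (fast_seqS p i); rewrite leq_pmull.
- by case=> [|i]; exact: (next_inP _).2.
- apply: (@squeeze_cvgr _ _ _ _ (fun=> 0) (fun i => i.+1%:R^-1)).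
  + near=> i; rewrite divr_ge0 //=; have lt := fast_seqS p i.
    rewrite ler_pdivrMr ?ltr0n ?(leq_ltn_trans _ lt) // mulrC ler_pdivlMr ?ltr0n //.
    by rewrite -natrM ler_nat mulnC ltnW.
  + exact: cvg_cst.
  + exact: cvg_harmonic.
Unshelve. all: by end_near. Qed.

Lemma infinite_lacunary : infinite_set (lacunary_seqs R S).
Proof.
apply: (@infinite_of_unbounded _ _ (fun n => n 0%N)) => p.
exists (fast_seq p.+1); first exact: fast_seq_lacunary.
exact: (next_inP p.+1).1.
Qed.

End LacunaryFamily.

Lemma normal_neq0 (x : R) : normal_in_odd_bases x -> x != 0.
Proof.
move=> /(_ 3%N isT isT 1%N isT); rewrite expn1 => -[w xw /(_ (inord 1)) freq].
apply/eqP => x0; rewrite x0 in xw.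
have w0 j : w j = ord0.
  apply: val_inj; rewrite /= (expansion_unique j _ xw) // /expansion_digit fracpart_id ?lexx ?ltr01 //.
  by rewrite mulr0 truncn0.
have : (3%:R^-1 : R) = 0.
  apply: (cvg_unique _ freq); first exact: Rhausdorff.
  rewrite (_ : (fun n => _) = (fun=> 0)); first exact: cvg_cst.
  apply/funext => n; rewrite big1 ?mul0r // => j _; rewrite w0.
  by rewrite -val_eqE /= inordK.
by apply/eqP; rewrite invr_eq0 pnatr_eq0.
Qed.

(** One number for every [d], with zero digits up to place [tau0 + d], so that
    infinitely many of them are distinct. *)
Lemma odd_normal_family (S : set nat) : computably_sparse R S ->
  exists (x : nat -> R) (F : 2.-tuple nat -> nat),
    computable F /\ forall d,
      [/\ digits_supported_in S (x d), deterministic 2 (x d),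
          normal_in_odd_bases (x d), 0 < x d < (2 ^+ d)^-1 &
          exists2 w : digit_seq 2, is_expansion (x d) w &
            forall j, F [tuple d; j] = w j].
Proof.
move=> [S_comp [S_pos S_dens _] [rho _ Srho]].
have cv0 : series (fun j => (false : nat)%:R / 2 ^+ j.+1 : R) @ \oo --> (0 : R).
  rewrite (_ : series _ = (fun=> 0)); first exact: cvg_cst.
  by apply/funext => n; rewrite seriesEnat /= big1 // => j _; rewrite mul0r.
have [tau0 H] := @odd_normal R S rho 0 (fun=> false) S Srho (fun p f => False_ind _ (notF f))
  (@subset_refl _ S) (fun p f => False_ind _ (notF f)) S_dens cv0.
rewrite bad_real0 in H.
pose s p := p \in S.
pose digit_of d j := choice_digit s bad_dyadic (tau0 + d) j.
have ex d : exists x : R, (0 <= x < 1 /\ normal_in_odd_bases x) /\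
    exists2 w : digit_seq 2, is_expansion x w & forall j, w j = digit_of d j :> nat.
  have [x xn [w xw wE]] := H (tau0 + d)%N (leq_addr _ _).
  by exists x; split=> //; exists w => // j; rewrite wE addn0.
have [x xP] := choice ex.
pose F (v : 2.-tuple nat) :=
  (good_prefix s bad_dyadic (tau0 + tnth v ord0) (tnth v (inord 1)).+1 %% 2)%N.
have digit_le d j : (digit_of d j <= (tau0 + d <= j)%N && s j.+1)%N.
  exact: (good_prefixS _ _ _ _).2.
exists x, F; split.
  have c0 := @computable_proj 2 ord0; have c1 := @computable_proj 2 (inord 1).
  have cg : computable (fun v : 2.-tuple nat =>
      good_prefix s bad_dyadic (tau0 + tnth v ord0) (tnth v (inord 1)).+1).
    by apply: computable_good_prefix => //; auto_computable.
  by rewrite /F; auto_computable.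
move=> d; have [[x01 xn] [w xw wE]] := xP d.
have w_S j : w j != ord0 -> S j.+1.
  move=> wj; have : w j != 0%N :> nat by [].
  rewrite wE; have := digit_le d j; rewrite /s; case: (boolP (j.+1 \in S)) => [/set_mem //|_].
  by rewrite andbF leqn0 => /eqP ->.
split=> //.
- split=> //; exists (fun k => digit_of d k.-1 == 1%N).
  rewrite -cvg_shiftS.
  rewrite (_ : (fun n => _) = series (fun j => (w j : nat)%:R / 2 ^+ j.+1 : R)); last first.
    apply/funext => n; rewrite !seriesEnat /= big_nat_recl //.
    rewrite memNset ?add0r; last by move=> /S_pos.
    apply: eq_bigr => j _ /=; rewrite wE; have := digit_le d j; rewrite /s.
    case: (_ \in S); last by rewrite andbF leqn0 => /eqP ->; rewrite mul0r.
    by move=> /leq_trans/(_ (leq_b1 _)); case: (digit_of d j) => [|[|?]].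
  by have := xw.1; rewrite -/(fracpart (x d)) fracpart_id.
- exact: (deterministic_of_density_zero xw w_S S_dens).
- have x0 : 0 < x d by rewrite lt_def normal_neq0 //; case/andP: x01.
  rewrite x0 /=.
  have p2 : 0 < 2 ^+ d :> R by rewrite exprn_gt0.
  have := (expansionP (x d) w isT).1 xw d; rewrite fracpart_id //.
  have -> : horner 2 (fun j => w j) d = 0%N.
    rewrite (@eq_horner _ _ (fun=> 0%N)); last first.
      move=> j jd; rewrite wE; apply/eqP; rewrite -leqn0.
      have lt_j : (tau0 + d <= j)%N = false by apply/negbTE; rewrite -ltnNge ltn_addl.
      by apply: leq_trans (digit_le d j) _; rewrite lt_j.
    by elim: (d) => //= n ->.
  have := truncn_itv (mulr_ge0 (ltW p2) (ltW x0)).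
  by move=> /[swap] -> /andP[_]; rewrite -ltr_pdivlMl // mulr1.
- exists w => // j; rewrite wE /F.
  have -> : tnth [tuple d; j] ord0 = d by [].
  have -> : tnth [tuple d; j] (inord 1) = j by rewrite (tnth_nth 0%N) /= inordK.
  rewrite (good_prefixS s bad_dyadic (tau0 + d) j).1 mulnC modnMDl modn_small //.
  by apply: leq_ltn_trans (digit_le d j) _; case: (_ && _).
Qed.

End Final.

Theorem corollary1 (R : realType) :
  (* (i) *)
  ~ countable [set x : R | deterministic 2 x /\ normal_in_odd_bases x] /\
  (* (ii) *)
  (forall b : nat, (1 < b)%N -> ~~ odd b ->
     ~ countable [set x : R |
         deterministic 2 x /\ nonnormal_in_even_bases_upto b x]) /\
  (* (iii) *)
  (exists S : set nat, computably_sparse R S) /\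
  (forall S : set nat, computably_sparse R S ->
     (* the family for (i) *)
     (exists x : rat -> R,
        [/\ computes_binary_digits x,
            forall eps : rat, 0 < eps < 2%:Q / 3%:Q ->
              [/\ digits_supported_in S (x eps), deterministic 2 (x eps) &
                  normal_in_odd_bases (x eps)] &
            infinite_set [set x eps | eps in [set eps | 0 < eps < 2%:Q / 3%:Q]]]) /\
     (* the family for (ii) *)
     [/\ countable (lacunary_seqs R S), infinite_set (lacunary_seqs R S),
         {in lacunary_seqs R S &, injective (@dyadic_sum R)} &
         forall n, lacunary_seqs R S n ->
           [/\ computable_real (dyadic_sum R n), deterministic 2 (dyadic_sum R n) &
               forall b : nat, (1 < b)%N -> ~~ odd b ->
                 nonnormal_in_even_bases_upto b (dyadic_sum R n)]]).
Proof.
split; first exact: uncountable_odd_normal.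
split; first exact: uncountable_even_nonnormal.
split; first by exists squares; exact: computably_sparse_squares.
move=> S S_sparse; have [S_comp [S_pos S_dens _] [rho _ Srho]] := S_sparse; split.
  have [x [F [F_comp xP]]] := odd_normal_family S_sparse.
  exists (fun eps => x `|denq eps|%N); split.
  - pose arg (i : 'I_2) (v : 3.-tuple nat) := tnth v (lift ord0 i).
    exists (fun v => F [tuple arg i v | i < 2]).
      by apply: computable_comp => // i; exact: computable_proj.
    move=> eps _; have [_ _ _ _ [w xw wF]] := xP `|denq eps|%N.
    exists w => // j; rewrite -wF; congr F.
    apply: eq_from_tnth => i; rewrite tnth_mktuple /arg.
    by case: i => -[|[|//]] ?; rewrite !(tnth_nth 0%N).
  - by move=> eps _; have [] := xP `|denq eps|%N.
  - apply: (@infinite_of_unbounded _ _ (fun a : R => Num.trunc a^-1)) => p.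
    pose eps : rat := (p.+2%:Z%:~R)^-1; have dE : `|denq eps|%N = p.+2 by rewrite denqVz.
    exists (x p.+2).
      exists eps; last by rewrite dE.
      rewrite /= invr_gt0 ltr0n /=; apply: (@le_lt_trans _ _ 2^-1); last by [].
      by rewrite lef_pV2 ?posrE ?ltr0n // (ler_nat rat 2).
    have [_ _ _ /andP[x0 x2] _] := xP p.+2.
    have xV : 2 ^+ p.+2 < (x p.+2)^-1 by rewrite -[ltLHS]invrK ltf_pV2 ?posrE ?invr_gt0 ?exprn_gt0.
    have xV0 : 0 <= (x p.+2)^-1 by rewrite invr_ge0 ltW.
    have /andP[_ up] := truncn_itv xV0.
    have := lt_trans xV up; rewrite -natrX ltr_nat ltnS; apply: leq_trans.
    exact: ltn_trans (ltnW (ltnSn _)) (ltn_expl p.+2 (ltnSn 1)).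
split.
- apply: sub_countable countable_computable; apply: subset_card_le.
  by move=> n [].
- exact: infinite_lacunary S_comp (sparse_unbounded Srho).
- move=> n n' /set_mem[_ n_mono nS _] /set_mem[_ n'_mono n'S _].
  exact: (dyadic_sum_inj S_pos S_dens n_mono nS n'_mono n'S).
move=> n [n_comp n_mono nS n_ratio]; split.
- exact: (computable_dyadic_sum n_mono nS S_pos S_dens).
- exact: (deterministic_dyadic_sum n_mono nS S_pos S_dens).
move=> _ _ _ b b1 eb _; exact: (nonnormal_dyadic_sum n_mono nS S_pos S_dens n_ratio).
Qed.
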